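(* If $X \subseteq \mathbb{P}^3$ is a smooth quadric surface, then every curve on $X$ (i.e. every nonzero effective divisor) represents the first Chern class of an Ulrich bundle on $X$.
   Context: We work over an algebraically closed field of characteristic zero. Ulrich bundles: let $X \subseteq \mathbb{P}^n$ be a smooth projective variety of dimension $k$, and let $S$ be the homogeneous coordinate ring (polynomial ring) of $\mathbb{P}^n$. For a vector bundle $\mathcal{E}$ on $X$ put $\Gamma_*(\mathcal{E}) = \bigoplus_{m \in \mathbb{Z}} H^0(\mathcal{E}(m))$. A (nonzero) vector bundle $\mathcal{E}$ is an Ulrich bundle if $\Gamma_*(\mathcal{E})$ is a graded Cohen-Macaulay $S$-module whose minimal graded free resolution has the linear form $0 \leftarrow \Gamma_*(\mathcal{E}) \leftarrow S^{\beta_0} \leftarrow S(-1)^{\beta_1} \leftarrow \cdots \leftarrow S(-(n-k))^{\beta_{n-k}} \leftarrow 0$. *)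

(* Defs.v *)
From HB Require Import structures.
From mathcomp Require Import all_boot all_order all_algebra.
From mathcomp.multinomials Require Export mpoly.
Set Implicit Arguments.
Unset Strict Implicit.
Unset Printing Implicit Defensive.
Import GRing.Theory.
Local Open Scope ring_scope.

(* Conventions.  A point of P^n is given by any nonzero coordinate vector
   x : 'I_n.+1 -> k, and a subset X of P^n by the set of all coordinate vectors
   of its points.  A section of O_X(m) over an open set U is the function it
   induces on the coordinate vectors of the points of U, so that regular
   functions (m = 0) are functions as in the classical theory of varieties and
   the sections of O_X(m) are homogeneous functions of degree m.  Open sets are
   principal opens D(h) = {x | h(x) <> 0}, h homogeneous: they form a basis of
   the Zariski topology. *)

Section Algebra.
Variables (k : fieldType) (n : nat).
Local Notation S := {mpoly k[n]}.

Definition prime_ideal (P : S -> Prop) : Prop :=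
  [/\ P 0,
      forall p q, P p -> P q -> P (p + q),
      forall p q, P q -> P (p * q),
      ~ P 1 &
      forall p q, P (p * q) -> P p \/ P q].

Definition prime_chain (J : S -> Prop) (d : nat) (P : nat -> S -> Prop) : Prop :=
  [/\ forall i, (i <= d)%N -> prime_ideal (P i),
      forall p, J p -> P 0%N p &
      forall i, (i < d)%N ->
        (forall p, P i p -> P i.+1 p) /\ (exists p, P i.+1 p /\ ~ P i p)].

(* The Krull dimension of S/J is d. *)
Definition krull_dim (J : S -> Prop) (d : nat) : Prop :=
  (exists P, prime_chain J d P) /\ ~ (exists P, prime_chain J d.+1 P).

Definition homogz (d : int) (p : S) : Prop :=
  if d is Posz e then p \is e.-homog else p = 0.

(* Modules of functions T -> W, on which S acts through ev : T -> k^n by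
   (p f)(t) = p(ev t) f(t). *)
Section Modules.
Variables (T : Type) (W : lmodType k) (ev : T -> 'I_n -> k).
Implicit Types (M : (T -> W) -> Prop) (G : int -> (T -> W) -> Prop).

Definition total G (f : T -> W) : Prop :=
  exists (m : nat) (d : 'I_m -> int) (g : 'I_m -> T -> W),
    (forall j, G (d j) (g j)) /\ f =1 (fun t => \sum_(j < m) g j t).

Definition annihilator M (p : S) : Prop :=
  forall f, M f -> forall t, p.@[ev t] *: f t = 0.

(* f belongs to (theta) M *)
Definition in_multiple M (theta : seq S) (f : T -> W) : Prop :=
  exists w : 'I_(size theta) -> T -> W,
    (forall j, M (w j)) /\
    f =1 (fun t => \sum_(j < size theta) (theta`_j).@[ev t] *: w j t).

Definition regular_sequence M (theta : seq S) : Prop :=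
  (forall i f, (i < size theta)%N -> M f ->
     in_multiple M (take i theta) (fun t => (theta`_i).@[ev t] *: f t) ->
     in_multiple M (take i theta) f)
  /\ (exists f, M f /\ ~ in_multiple M theta f).

(* The depth of M in the irrelevant ideal equals the Krull dimension of
   S / ann M (the former never exceeds the latter). *)
Definition cohen_macaulay M : Prop :=
  exists (d : nat) (theta : seq S),
    [/\ krull_dim (annihilator M) d,
        size theta = d,
        forall p, p \in theta -> p@_(0%MM) = 0 &
        regular_sequence M theta].

(* 0 <- total G <- F_0 <- F_1 <- ..., where F_i is free with a basis of beta i
   elements whose degrees are a i, F_0 -> total G is given by gen, and
   F_i.+1 -> F_i by A i, acting on column vectors. *)
Definition minimal_graded_free_resolution G (beta : nat -> nat)
    (a : forall i, 'I_(beta i) -> int) (gen : 'I_(beta 0) -> T -> W)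
    (A : forall i, 'M[S]_(beta i, beta i.+1)) : Prop :=
  [/\ (forall j, G (a 0%N j) (gen j))
        /\ (forall i j l, homogz (a i.+1 l - a i j) (A i j l)),
      forall i j l, (A i j l)@_(0%MM) = 0,
      forall f, total G f -> exists p : 'cV[S]_(beta 0),
        f =1 (fun t => \sum_j (p j 0).@[ev t] *: gen j t),
      forall p : 'cV[S]_(beta 0),
        (forall t, \sum_j (p j 0).@[ev t] *: gen j t = 0)
        <-> exists q : 'cV[S]_(beta 1), p = A 0 *m q &
      forall i (p : 'cV[S]_(beta i.+1)),
        A i *m p = 0 <-> exists q : 'cV[S]_(beta i.+2), p = A i.+1 *m q].

(* 0 <- total G <- S^b_0 <- S(-1)^b_1 <- ... <- S(-c)^b_c <- 0 *)
Definition has_linear_resolution G (c : nat) : Prop :=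
  exists beta a gen A,
    [/\ @minimal_graded_free_resolution G beta a gen A,
        forall i j, a i j = i%:Z &
        forall i, (c < i)%N -> beta i = 0%N].

End Modules.
End Algebra.

Section Geometry.
Variables (k : fieldType) (n : nat).
Local Notation S := {mpoly k[n.+1]}.
Local Notation pt := ('I_n.+1 -> k).

Definition hypersurface (F : S) (x : pt) : Prop :=
  (exists i, x i != 0) /\ F.@[x] = 0.

(* Jacobian criterion. *)
Definition smooth_hypersurface (F : S) : Prop :=
  forall x, hypersurface F x -> exists i, (F^`M(i)).@[x] != 0.

Variable X : pt -> Prop.

Definition vanishing_ideal (p : S) : Prop := forall x, X x -> p.@[x] = 0.

Definition proj_dim (d : nat) : Prop := krull_dim vanishing_ideal d.+1.

Definition on (h : S) (x : pt) : Prop := X x /\ h.@[x] != 0.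

(* f is a section of O_X(m) over D(h): near every point it is a quotient p / q
   of homogeneous polynomials with deg p = deg q + m.  After multiplying p and q
   by the same polynomial, the neighbourhood may be taken to be D(q). *)
Definition regular_on (m : int) (h : S) (f : pt -> k) : Prop :=
  forall x, on h x -> exists (d e : nat) (p q : S),
    [/\ p \is d.-homog, q \is e.-homog, d%:Z = e%:Z + m, q.@[x] != 0 &
        forall y, on h y -> q.@[y] != 0 -> f y = p.@[y] / q.@[y]].

Definition regular_mx_on (h : S) r s (g : pt -> 'M[k]_(r, s)) : Prop :=
  forall a b, regular_on 0 h (fun x => g x a b).

Definition open_cover N (h : 'I_N -> S) : Prop :=
  (forall i, exists d, h i \is d.-homog) /\
  (forall x, X x -> exists i, (h i).@[x] != 0).

(* A vector bundle trivialised over D(chart i); trans i j transforms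
   coordinates over D(chart j) into coordinates over D(chart i). *)
Record bundle_data := BundleData {
  rk : nat;
  ncharts : nat;
  chart : 'I_ncharts -> S;
  trans : 'I_ncharts -> 'I_ncharts -> pt -> 'M[k]_rk }.

Record vector_bundle := VectorBundle {
  vb_data :> bundle_data;
  vb_cover : open_cover (@chart vb_data);
  vb_regular : forall i j : 'I_(ncharts vb_data),
    regular_mx_on (chart i * chart j) (trans i j);
  vb_id : forall (i : 'I_(ncharts vb_data)) x, on (chart i) x ->
    trans i i x = 1%:M;
  vb_cocycle : forall (i j l : 'I_(ncharts vb_data)) x,
    on (chart i * chart j * chart l) x ->
    trans i j x *m trans j l x = trans i l x }.

Definition bundle_iso (E E' : bundle_data) : Prop :=
  exists (phi : 'I_(ncharts E') -> 'I_(ncharts E) -> pt -> 'M[k]_(rk E', rk E))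
         (psi : 'I_(ncharts E) -> 'I_(ncharts E') -> pt -> 'M[k]_(rk E, rk E')),
    [/\ forall l i, regular_mx_on (chart l * chart i) (phi l i),
        forall i l, regular_mx_on (chart i * chart l) (psi i l),
        forall l i x, on (chart l * chart i) x ->
          phi l i x *m psi i l x = 1%:M /\ psi i l x *m phi l i x = 1%:M &
        forall i j l m x, on (chart i * chart j * (chart l * chart m)) x ->
          phi l i x *m trans i j x = trans l m x *m phi m j x].

Definition det_bundle (E : bundle_data) : bundle_data :=
  @BundleData 1 (ncharts E) (@chart E) (fun i j x => (\det (trans i j x))%:M).

(* Effective Cartier divisors: local equations deqn i on D(dchart i) that are
   nonzerodivisors (they vanish on no nonempty open set) and differ by the
   units dunit i j. *)
Record eff_divisor := EffDivisor {
  dncharts : nat;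
  dchart : 'I_dncharts -> S;
  deqn : 'I_dncharts -> pt -> k;
  dunit : 'I_dncharts -> 'I_dncharts -> pt -> k;
  d_cover : open_cover dchart;
  d_regular : forall i, regular_on 0 (dchart i) (deqn i);
  d_nonzerodiv : forall i (h : S) d, h \is d.-homog ->
    (exists x, on (dchart i * h) x) ->
    exists x, on (dchart i * h) x /\ deqn i x != 0;
  d_unit_regular : forall i j, regular_on 0 (dchart i * dchart j) (dunit i j);
  d_unit_id : forall i x, on (dchart i) x -> dunit i i x = 1;
  d_unit_cocycle : forall i j l x, on (dchart i * dchart j * dchart l) x ->
    dunit i j x * dunit j l x = dunit i l x;
  d_eqn : forall i j x, on (dchart i * dchart j) x ->
    deqn i x = dunit i j x * deqn j x }.

Definition nonzero_divisor (D : eff_divisor) : Prop :=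
  exists (i : 'I_(dncharts D)) x, on (dchart i) x /\ deqn i x = 0.

(* O_X(D); the deqn i are the coordinates of its canonical section. *)
Definition divisor_bundle (D : eff_divisor) : bundle_data :=
  @BundleData 1 (dncharts D) (@dchart D) (fun i j x => (dunit i j x)%:M).

(* c_1(E) = c_1(det E) = [D] in Pic X, which is the divisor class group when X
   is smooth. *)
Definition represents_c1 (D : eff_divisor) (E : bundle_data) : Prop :=
  bundle_iso (det_bundle E) (divisor_bundle D).

(* H^0(E(m)): the coordinates of a section over D(chart i) are sections of
   O_X(m), extended by 0 outside D(chart i) so that equal sections are equal as
   functions. *)
Definition twisted_sections (E : bundle_data) (m : int)
    (s : 'I_(ncharts E) * pt -> 'cV[k]_(rk E)) : Prop :=
  [/\ forall i a, regular_on m (chart i) (fun x => s (i, x) a 0),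
      forall i j x, on (chart i * chart j) x ->
        s (i, x) = trans i j x *m s (j, x) &
      forall i x, ~ on (chart i) x -> s (i, x) = 0].

(* Over an infinite field homogeneous functions of distinct degrees are linearly
   independent, so the sum of the H^0(E(m)) inside the space of functions is
   direct. *)
Definition Gamma_star (E : bundle_data) := total (@twisted_sections E).

Definition ulrich (E : vector_bundle) : Prop :=
  [/\ (0 < rk E)%N,
      cohen_macaulay (fun t : 'I_(ncharts E) * pt => t.2) (@Gamma_star E) &
      exists d, proj_dim d /\
        has_linear_resolution (fun t : 'I_(ncharts E) * pt => t.2)
          (@twisted_sections E) (n - d)].

End Geometry.

(* Main.v *)
(* In suitable linear coordinates a smooth quadric surface has the equation
   l00 l11 = l01 l10, so it is the image of P^1 x P^1 under the Segre map
   l_bb' = s_b u_b', and sections of line bundles on it are bihomogeneous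
   polynomials in s_0, s_1, u_0, u_1.  The ring of these polynomials is
   factorial, hence an effective divisor D has a global equation G; if G has
   bidegree (a, b), then O(D) = O(a, b) is the determinant of
   E = O(1,0)^a + O(0,1)^b.  The module Gamma_*(O(1,0)) is generated by s_0 and
   s_1 with the relations s_0 l_1b = s_1 l_0b, i.e. it is the cokernel of a
   2 x 2 matrix of linear forms whose determinant is the equation of the
   quadric; this is its linear resolution, and likewise for O(0,1). *)

(* Local sections and local equations are given as quotients of polynomials on principal opens; the
   obstacle is to glue them. Two facts about the ring of s_0, s_1, u_0, u_1 do it: unique
   factorization, which gives lowest terms, and the Nullstellensatz for one prime p: a polynomial
   vanishing on the zeros of p is divisible by p. Vectors with s = 0 or u = 0 represent no point,
   but these two planes have codimension two, so they contain the zero set of no prime. The bidegree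
   of G is not built into its construction. Rescaling s and u multiplies G by a function without
   zeros and poles, hence by a constant, and this constant is a power of each scaling factor with
   nonnegative exponent. That D is nonzero excludes a = b = 0, hence rank 0. The Cohen-Macaulay
   property is checked directly: l00, l11, l01 - l10 is a regular sequence, and the cone has
   dimension 3, where the upper bound rests on the algebraic dependence of n + 1 polynomials in n
   variables. *)
Require Import Defs.
From HB Require Import structures.
From Stdlib Require Import Classical FunctionalExtensionality.
From mathcomp Require Import all_boot all_order all_algebra.
From mathcomp Require Import ring.
Set Implicit Arguments.
Unset Strict Implicit.
Unset Printing Implicit Defensive.
Import GRing.Theory.
Local Open Scope ring_scope.

(** * Factorial rings and Gauss's lemma *)

Section Divisibility.
Variable R : idomainType.
Implicit Types (a b p q u : R) (s : seq R).

Definition divides a b := exists c, b = a * c.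

Definition prime_elt p :=
  [/\ p != 0, p \isn't a GRing.unit &
      forall a b, divides p (a * b) -> divides p a \/ divides p b].

Definition factored (m : nat) a :=
  exists u s, [/\ u \is a GRing.unit, forall p, p \in s -> prime_elt p,
    size s = m & a = u * \prod_(p <- s) p].

Lemma divides_mulr a b c : divides a b -> divides a (b * c).
Proof. by case=> d ->; exists (d * c); rewrite mulrA. Qed.

Lemma divides_mull a b c : divides a b -> divides a (c * b).
Proof. by rewrite mulrC; apply: divides_mulr. Qed.

Lemma prime_divides_unit p u : prime_elt p -> u \is a GRing.unit -> ~ divides p u.
Proof.
move=> [_ pu _] uu [c e]; move: uu; rewrite e unitrM => /andP[hp _].
by rewrite hp in pu.
Qed.

Lemma prime_divides_prod p s : prime_elt p ->
  divides p (\prod_(q <- s) q) -> exists2 q, q \in s & divides p q.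
Proof.
move=> hp; elim: s => [|q s IH].
  by rewrite big_nil => /(prime_divides_unit hp (unitr1 _)).
rewrite big_cons; case: hp => _ _ h /h[d|/IH[r rs d]].
  by exists q; rewrite ?inE ?eqxx.
by exists r; rewrite ?inE ?rs ?orbT.
Qed.

Lemma prime_associate p q : prime_elt p -> prime_elt q -> divides p q ->
  exists2 u, u \is a GRing.unit & q = p * u.
Proof.
move=> [p0 pn hp] [q0 qn hq] [w e]; exists w => //.
have: divides q (p * w) by exists 1; rewrite mulr1.
case/hq=> [[v ev]|[v ev]].
  have: q * (1 - v * w) = 0.
    by rewrite mulrBr mulr1 {1}e mulrA -ev subrr.
  move/eqP; rewrite mulf_eq0 (negPf q0) subr_eq0 /= => /eqP h.
  by apply/unitrP; exists v; rewrite [w * v]mulrC -h.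
have: q * (1 - p * v) = 0 by rewrite mulrBr mulr1 mulrCA -ev -e subrr.
move/eqP; rewrite mulf_eq0 (negPf q0) subr_eq0 /= => /eqP h.
by case/negP: pn; apply/unitrP; exists v; rewrite [v * p]mulrC -h.
Qed.

Lemma factoredM m n a b : factored m a -> factored n b -> factored (m + n) (a * b).
Proof.
move=> [u [s [uu hs es ->]]] [v [t [vu ht et ->]]].
exists (u * v), (s ++ t); split.
- by rewrite unitrM uu.
- by move=> p; rewrite mem_cat => /orP[/hs|/ht].
- by rewrite size_cat es et.
by rewrite big_cat /= mulrACA.
Qed.

Lemma factored_unit u : u \is a GRing.unit -> factored 0 u.
Proof. by move=> uu; exists u, [::]; split=> //; rewrite big_nil mulr1. Qed.

Lemma factored_prime p : prime_elt p -> factored 1 p.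
Proof.
move=> hp; exists 1, [:: p]; split; rewrite ?unitr1 ?big_seq1 ?mul1r //.
by move=> q; rewrite inE => /eqP->.
Qed.

Lemma factored_neq0 m a : factored m a -> a != 0.
Proof.
move=> [u [s [uu hs _ ->]]]; rewrite mulf_neq0 //.
  by apply: contraTneq uu => ->; rewrite unitr0.
elim: s hs => [|p s IH] hs; first by rewrite big_nil oner_neq0.
rewrite big_cons mulf_neq0 //; first by case: (hs p (mem_head _ _)).
by apply: IH => q qs; apply: hs; rewrite inE qs orbT.
Qed.

(** The number of prime factors is tracked because it is the measure of the induction in
    [content_split]. *)
Lemma factored_divide m p b : prime_elt p -> factored m (p * b) ->
  exists2 n, m = n.+1 & factored n b.
Proof.
move=> hp [u [s [uu hs es e]]].
have: divides p (u * \prod_(q <- s) q) by exists b.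
case: (hp) => p0 _ h /h[/(prime_divides_unit hp uu)//|].
case/(prime_divides_prod hp)=> q qs pq.
have [w wu ew] := prime_associate hp (hs q qs) pq.
have ps := perm_to_rem qs.
exists (size (rem q s)); first by rewrite -es (perm_size ps).
exists (u * w), (rem q s); split=> //.
- by rewrite unitrM uu.
- by move=> r /mem_rem; apply: hs.
apply: (mulfI p0); rewrite e (perm_big _ ps) big_cons /= ew; ring.
Qed.

Lemma factored_ind (P : R -> Prop) :
  (forall u, u \is a GRing.unit -> P u) ->
  (forall p a, prime_elt p -> a != 0 -> P a -> P (p * a)) ->
  forall m a, factored m a -> P a.
Proof.
move=> Pu Pp m a [u [s [uu hs _ ->]]].
elim: s hs => [|p s IH] hs; first by rewrite big_nil mulr1; apply: Pu.
have hs': forall q, q \in s -> prime_elt q.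
  by move=> q qs; apply: hs; rewrite inE qs orbT.
rewrite big_cons mulrCA; apply: Pp; [exact: hs (mem_head _ _)| |exact: IH].
by apply: (@factored_neq0 (size s)); exists u, s.
Qed.

(** Each prime factor of [a] costs one factor [h], so multiplicities are absorbed in the exponent.
    This turns a denominator without zeros on D(h) into a power of [h]. *)
Lemma divides_power h m a : factored m a ->
  (forall p, prime_elt p -> divides p a -> divides p h) -> exists N, divides a (h ^+ N).
Proof.
move: m a; apply: factored_ind => [u uu _|p a hp a0 IH hpa].
  by exists 0%N, u^-1; rewrite mulrV.
have [q hq [c ec]|N [c ec]] := IH.
  by apply: hpa => //; exists (p * c); rewrite ec mulrCA.
have [d ed] : divides p h by apply: hpa => //; exists a.
by exists N.+1, (d * c); rewrite exprS ec ed; ring.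
Qed.

(** The factors are prime elements, not merely irreducible ones, so existence of a factorization
    already entails its uniqueness. *)
Definition ufd := forall a, a != 0 -> exists m, factored m a.

Lemma ufd_ind (P : R -> Prop) : ufd ->
  (forall u, u \is a GRing.unit -> P u) ->
  (forall p a, prime_elt p -> a != 0 -> P a -> P (p * a)) ->
  forall a, a != 0 -> P a.
Proof. by move=> U Pu Pp a /U[m]; apply: factored_ind. Qed.

(** The primes of the denominator are cancelled one at a time against the numerator, so lowest terms
    are reached without a gcd. *)
Lemma reduced_fraction : ufd -> forall b, b != 0 -> forall a,
  exists a' b', [/\ b' != 0, a * b' = a' * b &
    forall p, prime_elt p -> divides p b' -> ~ divides p a'].
Proof.
move=> U; apply: (ufd_ind U) => [u uu a|p b hp b0 IH a].
  exists a, u; split=> //; first by apply: contraTneq uu => ->; rewrite unitr0.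
  by move=> p hp /(prime_divides_unit hp uu).
have [a' [b' [b'0 e red]]] := IH a.
case: (classic (divides p a')) => [[c ec]|npa].
  exists c, b'; split=> //; first by rewrite e ec; ring.
  by move=> q hq /(red q hq) h [d ed]; apply: h; exists (p * d); rewrite ec ed; ring.
exists a', (p * b'); split.
- by rewrite mulf_neq0 //; case: hp.
- by rewrite mulrCA e; ring.
move=> q hq; case: (hq) => _ _ h /h[d|/red]; last exact.
have [u uu ep] := prime_associate hq hp d; move=> [c ec]; apply: npa.
by exists (u^-1 * c); rewrite ec ep -mulrA mulVKr.
Qed.

End Divisibility.

Section Gauss.
Variable R : idomainType.
Hypothesis U : ufd R.
Implicit Types (a b c p : R) (f g h : {poly R}).

Lemma divides_polyC p f : divides p%:P f <-> forall i, divides p f`_i.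
Proof.
split=> [[g ->] i|h]; first by exists g`_i; rewrite coefCM.
have [g hg]: exists g : nat -> R, forall i, (i < size f)%N -> f`_i = p * g i.
  elim: (size f) => [|n [g hg]]; first by exists (fun=> 0).
  have [c ec] := h n; exists (fun i => if i == n then c else g i) => i.
  by rewrite ltnS leq_eqVlt; case: eqP => [->|_] //= /hg.
exists (\poly_(i < size f) g i); apply/polyP=> i.
rewrite coefCM coef_poly; case: ltnP => [/hg//|]; rewrite mulr0.
by move/(nth_default 0).
Qed.

Lemma divides_lead p f g : divides p%:P (f * g) -> divides p (lead_coef f * lead_coef g).
Proof. by rewrite -lead_coefM lead_coefE => /divides_polyC. Qed.

Lemma divides_drop_lead p f : prime_elt p -> divides p (lead_coef f) -> f != 0 ->
  exists2 f' : {poly R}, (size f' < size f)%N & exists g, f = p%:P * g + f'.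
Proof.
move=> hp [c ec] f0; exists (f - (lead_coef f)%:P * 'X^((size f).-1)); last first.
  by exists (c%:P * 'X^((size f).-1)); rewrite mulrA -polyCM -ec addrC subrK.
have sf : (0 < size f)%N by rewrite size_poly_gt0.
rewrite -{2}(prednK sf) ltnS; apply/leq_sizeP=> j hj.
rewrite coefB coefCM coefXn; case: eqP => [->|/eqP ne].
  by rewrite lead_coefE mulr1 subrr.
rewrite mulr0 subr0 nth_default // -(prednK sf) ltn_neqAle hj andbT eq_sym; exact: ne.
Qed.

(** Gauss's lemma. A prime dividing a product divides one of the two leading coefficients; removing
    that leading term does not change the factor modulo [p], whence induction on the sizes. *)
Lemma prime_polyC p : prime_elt p -> prime_elt p%:P.
Proof.
move=> hp; case: (hp) => p0 pn h; split; first by rewrite polyC_eq0.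
  by rewrite poly_unitE coefC size_polyC p0 eqxx.
move=> a b; have [n] := ubnP (size a + size b)%N; elim: n a b => // n IH a b.
rewrite ltnS => hn hab.
have [->|a0] := eqVneq a 0; first by left; exists 0; rewrite mulr0.
have [->|b0] := eqVneq b 0; first by right; exists 0; rewrite mulr0.
have [pa|pb] := h _ _ (divides_lead hab).
  have [a' sa [g ea]] := divides_drop_lead hp pa a0.
  have [||[c ec]|] := IH a' b.
  - by apply: leq_trans hn; rewrite ltn_add2r.
  - by case: hab => c ec; exists (c - g * b); rewrite mulrBr -ec ea; ring.
  - by left; exists (g + c); rewrite ea ec; ring.
  - by right.
have [b' sb [g eb]] := divides_drop_lead hp pb b0.
have [||?|[c ec]] := IH a b'.
- by apply: leq_trans hn; rewrite ltn_add2l.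
- by case: hab => c ec; exists (c - g * a); rewrite mulrBr -ec eb; ring.
- by left.
- by right; exists (g + c); rewrite eb ec; ring.
Qed.

Definition primitive f := forall p, prime_elt p -> ~ divides p%:P f.

Lemma primitive_cancel f g c : primitive f -> c != 0 ->
  divides f (c%:P * g) -> divides f g.
Proof.
move=> pf c0; move: c c0 g; apply: (ufd_ind U) => [u uu g|p c hp c0 IH g].
  move=> [w e]; exists (u^-1%:P * w); rewrite mulrCA -e mulrA -polyCM mulVr //.
  by rewrite mul1r.
move=> [w e]; have [_ _ h] := prime_polyC hp.
have: divides p%:P (f * w) by exists (c%:P * g); rewrite -e polyCM mulrA.
case/h=> [/(pf p hp)//|[v ev]].
apply: IH; exists v; apply: (@mulfI _ p%:P); first by rewrite polyC_eq0; case: hp.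
by rewrite [RHS]mulrCA -ev -e polyCM mulrA.
Qed.

(** Each prime of [c] stays prime as a constant polynomial, so it divides [g] or [h] and is
    cancelled there without a change of degree. Thus a factorization over the fraction field yields
    one over [R]. *)
Lemma clear_denominator f c g h : c != 0 -> c%:P * f = g * h ->
  exists g' h', [/\ f = g' * h', size g' = size g & size h' = size h].
Proof.
move: c g h; suff H : forall c, c != 0 -> forall g h, c%:P * f = g * h ->
  exists g' h', [/\ f = g' * h', size g' = size g & size h' = size h].
  by move=> c g h c0; apply: H.
apply: (ufd_ind U) => [u uu g h|p c hp c0 IH g h] e.
  have ui: u^-1 != 0 by rewrite invr_eq0; apply: contraTneq uu => ->; rewrite unitr0.
  exists (u^-1%:P * g), h; split=> //; last by rewrite size_Cmul.
  by rewrite -mulrA -e mulrA -polyCM mulVr // mul1r.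
have [P0 _ hP] := prime_polyC hp.
have p0 : p != 0 by case: hp.
have: divides p%:P (g * h) by exists (c%:P * f); rewrite -e polyCM mulrA.
case/hP=> [[w ew]|[w ew]].
  have [|g' [h' [E1 E2 E3]]] := IH w h.
    by apply: (mulfI P0); rewrite mulrA -polyCM e ew mulrA.
  by exists g', h'; split=> //; rewrite E2 ew size_Cmul.
have [|g' [h' [E1 E2 E3]]] := IH g w.
  by apply: (mulfI P0); rewrite mulrA -polyCM e ew mulrCA.
by exists g', h'; split=> //; rewrite E3 ew size_Cmul.
Qed.

Definition indecomposable f := forall g h, f = g * h -> (size g <= 1)%N \/ (size h <= 1)%N.

(** Over the fraction field [f] is irreducible, so its gcd with [g] is 1 or [f]. The denominators
    that appear are removed by primitivity. *)
Lemma indecomposable_bezout f g : primitive f -> indecomposable f -> f != 0 ->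
  divides f g \/ exists u v c, c != 0 /\ u * f + v * g = c%:P.
Proof.
move=> pf irr f0.
have [cop|ncop] := boolP (coprimep f g).
  right; have /Pdiv.Idomain.Bezout_coprimepP[[u v] /=] := cop.
  move/eqpP=> [[c1 c2] /= /andP[c10 c20] e].
  exists (c1%:P * u), (c1%:P * v), c2; split=> //.
  by rewrite -!mulrA -mulrDr mul_polyC e -mul_polyC mulr1.
left; have [d0|d0] := eqVneq (gcdp f g) 0.
  by move/eqP: d0; rewrite gcdp_eq0 (negPf f0).
have /Pdiv.Idomain.dvdpP[[c e] /= c0 E1] := Pdiv.Idomain.dvdp_gcdl f g.
have /Pdiv.Idomain.dvdpP[[c2 w] /= c20 E2] := Pdiv.Idomain.dvdp_gcdr f g.
rewrite -!mul_polyC in E1 E2.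
have [e' [d' [ef se sd]]] := clear_denominator c0 E1.
(* The gcd is not constant, so its cofactor in [f] must be. *)
have := irr _ _ ef; rewrite se sd => -[]; last first.
  rewrite coprimep_def in ncop; rewrite leq_eqVlt (negPf ncop) /= ltnS leqn0.
  by rewrite size_poly_eq0 (negPf d0).
have e0 : e != 0.
  apply: contraNneq f0 => e0; move/eqP: E1; rewrite e0 mul0r mulf_eq0 polyC_eq0.
  by rewrite (negPf c0).
move=> /size1_polyC; set eps := e`_0 => ee.
have eps0 : eps != 0 by move: e0; rewrite ee polyC_eq0.
apply: (@primitive_cancel f g (eps * c2)) => //; first by rewrite mulf_neq0.
exists (w * c%:P); rewrite polyCM -mulrA E2 mulrCA -ee -E1; ring.
Qed.

(** Every prime extracted from [f] is also a factor of its leading coefficient, which bounds the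
    number of extractions. *)
Lemma content_split m f : f != 0 -> factored m (lead_coef f) ->
  exists c g, [/\ c != 0, f = c%:P * g & primitive g].
Proof.
elim: m f => [|m IH] f f0 hm.
  exists 1, f; split; rewrite ?oner_neq0 ?mul1r // => p hp [g e].
  have [n //] : exists2 n, 0%N = n.+1 & factored n (lead_coef g).
  apply: (@factored_divide _ 0 p) => //.
  by rewrite -(lead_coefC p) -lead_coefM -e.
case: (classic (primitive f)) => [pf|npf].
  by exists 1, f; split; rewrite ?oner_neq0 ?mul1r.
have [p hp [g e]] : exists2 p, prime_elt p & divides p%:P f.
  apply: NNPP => h; apply: npf => p hp d; apply: h; by exists p.
have g0 : g != 0 by apply: contraNneq f0 => g0; rewrite e g0 mulr0.
have [n [en] hn] : exists2 n, m.+1 = n.+1 & factored n (lead_coef g).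
  apply: (@factored_divide _ m.+1 p) => //.
  by rewrite -(lead_coefC p) -lead_coefM -e.
subst n.
have [c [h [c0 eh ph]]] := IH g g0 hn.
exists (p * c), h; split=> //; first by rewrite mulf_neq0 //; case: hp.
by rewrite e eh polyCM mulrA.
Qed.

Lemma factored_polyC c : c != 0 -> exists m, factored m c%:P.
Proof.
move: c; apply: (ufd_ind U) => [u uu|p c hp c0 [m IH]].
  exists 0%N; apply: factored_unit; rewrite poly_unitE coefC size_polyC uu andbT.
  by have -> : u != 0 by apply: contraTneq uu => ->; rewrite unitr0.
exists (1 + m)%N; rewrite polyCM; apply: factoredM => //.
exact/factored_prime/prime_polyC.
Qed.

(** If [f] divides [a * b] but not [a], the Bezout identity times [b] shows that [f] divides a
    constant multiple of [b], and primitivity removes the constant. *)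
Lemma primitive_prime f : primitive f -> indecomposable f -> (1 < size f)%N -> prime_elt f.
Proof.
move=> pf irr sf; have f0 : f != 0 by rewrite -size_poly_gt0 ltnW.
split=> //; first by rewrite poly_unitE gtn_eqF.
move=> a b [w e]; have [?|[u [v [c [c0 E]]]]] := indecomposable_bezout a pf irr f0.
  by left.
right; apply: (@primitive_cancel f b c) => //.
by exists (u * b + v * w); rewrite -E mulrDr mulrDl -(mulrA v) e; ring.
Qed.

Lemma poly_ufd : ufd {poly R}.
Proof.
move=> f; have [n] := ubnP (size f); elim: n f => // n IH f; rewrite ltnS => sf f0.
have [|m hm] := @U (lead_coef f); first by rewrite lead_coef_eq0.
have [c [g [c0 ef pg]]] := content_split f0 hm.
have g0 : g != 0 by apply: contraNneq f0 => g0; rewrite ef g0 mulr0.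
have sg : size g = size f by rewrite ef size_Cmul.
have [mc hc] := factored_polyC c0.
suff [mg hg] : exists m, factored m g by exists (mc + mg)%N; rewrite ef; apply: factoredM.
have [g1|g1] := leqP (size g) 1.
  rewrite (size1_polyC g1); apply: factored_polyC.
  by rewrite -polyC_eq0 -size1_polyC.
case: (classic (indecomposable g)) => [irr|nirr].
  by exists 1%N; apply/factored_prime/primitive_prime.
have [a [b [eg sa sb]]] : exists a b : {poly R}, [/\ g = a * b, (1 < size a)%N & (1 < size b)%N].
  apply: NNPP => h; apply: nirr => a b e; apply: NNPP => h'; apply: h; exists a, b.
  by split=> //; rewrite ltnNge; apply/negP => ?; apply: h'; [left|right].
have a0 : a != 0 by rewrite -size_poly_gt0 ltnW.
have b0 : b != 0 by rewrite -size_poly_gt0 ltnW.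
have sab : size g = (size a + size b).-1 by rewrite eg size_mul.
have [|//|ma ha] := IH a.
  by apply: leq_trans sf; rewrite -sg sab -ltnS prednK ?addn_gt0 ?size_poly_gt0 ?a0 // -addn2 leq_add2l.
have [|//|mb hb] := IH b.
  by apply: leq_trans sf; rewrite -sg sab -ltnS prednK ?addn_gt0 ?size_poly_gt0 ?a0 // -addn2 addnC leq_add2r.
by exists (ma + mb)%N; rewrite eg; apply: factoredM.
Qed.

(** The converse of [primitive_prime]; it makes the Bezout alternative available for a prime of
    positive degree. *)
Lemma prime_primitive f : prime_elt f -> (1 < size f)%N -> primitive f /\ indecomposable f.
Proof.
move=> [f0 fn hf] sf; have leqf (a : {poly R}) : a != 0 -> divides f a -> (size f <= size a)%N.
  move=> a0 [b e]; have b0 : b != 0 by apply: contraNneq a0 => b0; rewrite e b0 mulr0.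
  by rewrite e size_mul // -ltnS prednK ?addn_gt0 ?size_poly_gt0 ?f0 // -addn1 leq_add2l size_poly_gt0.
split=> [p hp [g e]|a b e].
  have g0 : g != 0 by apply: contraNneq f0 => g0; rewrite e g0 mulr0.
  have p0 : p%:P != 0 by rewrite polyC_eq0; case: hp.
  have: divides f (p%:P * g) by exists 1; rewrite mulr1.
  case/hf=> [/(leqf _ p0)|[w ew]].
    by rewrite leqNgt (leq_ltn_trans (size_polyC_leq1 p) sf).
  have: f * (1 - p%:P * w) = 0 by rewrite mulrBr mulr1 mulrCA -ew -e subrr.
  move/eqP; rewrite mulf_eq0 (negPf f0) subr_eq0 /= => /eqP E.
  have [_ pn _] := prime_polyC hp.
  by case/negP: pn; apply/unitrP; exists w; rewrite mulrC -E.
have a0 : a != 0 by apply: contraNneq f0 => a0; rewrite e a0 mul0r.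
have b0 : b != 0 by apply: contraNneq f0 => b0; rewrite e b0 mulr0.
have: divides f (a * b) by exists 1; rewrite mulr1.
have E : (size f).+1 = (size a + size b)%N.
  by rewrite e size_mul // prednK // addn_gt0 size_poly_gt0 a0.
case/hf=> [/(leqf _ a0) h|/(leqf _ b0) h]; [right|left].
  by rewrite -(leq_add2l (size a)) -E addn1 ltnS.
by rewrite -(leq_add2r (size b)) -E add1n ltnS.
Qed.

(** * The Nullstellensatz for one prime polynomial *)

Section Nullstellensatz.
Variables (k : closedFieldType) (T : Type) (ev : T -> {rmorphism R -> k}).
Hypothesis vanish0 : forall h : R, (forall t, ev t h = 0) -> h = 0.
Hypothesis null : forall p h : R, prime_elt p ->
  (forall t, ev t p = 0 -> ev t h = 0) -> divides p h.

(** A nonconstant [f + 1] would have a root, and there [f] would be -1 instead of 0. *)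
Lemma closed_poly_vanish (f : {poly k}) : (forall a : k, f.[a] = 0) -> f = 0.
Proof.
move=> h; apply/eqP/negPn/negP => f0.
have f10 : f + 1 != 0.
  apply/eqP=> e; have := h 0; rewrite -[f](addrK 1) e sub0r hornerN hornerC.
  by move/eqP; rewrite oppr_eq0 oner_eq0.
have [s1|s1] := eqVneq (size (f + 1)) 1%N.
  have /eqP/size_poly1P[c c0 ec] := s1.
  have: f = (c - 1)%:P by rewrite polyCB -ec addrK.
  by move=> ef; move: (h 0) f0; rewrite ef hornerC => ->; rewrite eqxx.
have [a] := closed_rootP _ s1; rewrite rootE hornerD h hornerC add0r.
by rewrite oner_eq0.
Qed.

Lemma poly_vanish (f : {poly R}) : (forall t (a : k), (map_poly (ev t) f).[a] = 0) -> f = 0.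
Proof.
move=> h; apply/polyP=> i; rewrite coef0; apply: vanish0 => t.
by rewrite -coef_map /= (closed_poly_vanish (h t)) coef0.
Qed.

(** A prime of positive degree that does not divide [h] satisfies u p + v h = c with a nonzero
    constant c. At a point where neither c nor the leading coefficient of p vanishes, p has a root;
    there h vanishes as well, and so would c. A constant prime is treated coefficientwise by the
    hypothesis on [R]. *)
Lemma poly_nullstellensatz (p h : {poly R}) : prime_elt p ->
  (forall t (a : k), (map_poly (ev t) p).[a] = 0 -> (map_poly (ev t) h).[a] = 0) ->
  divides p h.
Proof.
move=> hp H; have p0 : p != 0 by case: hp.
have [sp|sp] := leqP (size p) 1.
  have ep := size1_polyC sp; set c := p`_0 in ep.
  have hc : prime_elt c.
    split; first by rewrite -polyC_eq0 -ep.
      apply/negP=> cu; case: hp => _ /negP[]; rewrite ep poly_unitE coefC cu size_polyC.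
      by rewrite -polyC_eq0 -ep p0.
    move=> a b [w e]; case: hp => _ _; rewrite ep => hp'.
    case: (hp' a%:P b%:P); first by exists w%:P; rewrite -!polyCM e.
      by move/divides_polyC/(_ 0%N); rewrite coefC; left.
    by move/divides_polyC/(_ 0%N); rewrite coefC; right.
  rewrite ep; apply/divides_polyC=> i; apply: null => // t ct.
  have: map_poly (ev t) h = 0.
    by apply: closed_poly_vanish => a; apply: H; rewrite ep map_polyC hornerC.
  by move/polyP/(_ i); rewrite coef_map coef0.
have [pp irr] := prime_primitive hp sp.
have [//|[u [v [c [c0 e]]]]] := indecomposable_bezout h pp irr p0.
have l0 : lead_coef p != 0 by rewrite lead_coef_eq0.
have [t ht] : exists t, ev t (c * lead_coef p) <> 0.
  apply: not_all_ex_not => /vanish0/eqP; by rewrite mulf_eq0 (negPf c0) (negPf l0).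
move/eqP: ht; rewrite rmorphM mulf_eq0 negb_or => /andP[tc tl].
have [a] : exists a : k, root (map_poly (ev t) p) a.
  by apply/closed_rootP; rewrite size_map_poly_id0 // gtn_eqF.
rewrite rootE => /eqP ra; case/eqP: tc.
have := congr1 (fun f => (map_poly (ev t) f).[a]) e.
by rewrite rmorphD !rmorphM /= hornerD !hornerM ra H // !mulr0 addr0 map_polyC hornerC.
Qed.

End Nullstellensatz.
End Gauss.

(** * Transport of factorizations along an isomorphism *)

Section RingIso.
Variables (A B : idomainType) (f : A -> B) (g : B -> A).
Hypotheses (fK : cancel f g) (gK : cancel g f).
Hypotheses (f0 : f 0 = 0) (f1 : f 1 = 1) (fM : {morph f : x y / x * y}).

Lemma divides_iso a b : divides a b <-> divides (f a) (f b).
Proof.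
split=> [[c ->]|[c e]]; first by exists (f c); rewrite fM.
by exists (g c); apply: (can_inj fK); rewrite fM gK.
Qed.

Lemma unit_iso a : (f a \is a GRing.unit) = (a \is a GRing.unit).
Proof.
apply/unitrP/unitrP=> -[b [e1 e2]]; last by exists (f b); rewrite -!fM e1 e2 f1.
by exists (g b); split; apply: (can_inj fK); rewrite fM gK f1.
Qed.

Lemma prime_iso a : prime_elt a -> prime_elt (f a).
Proof.
move=> [a0 an h]; split.
- by rewrite -f0 (can_eq fK).
- by rewrite unit_iso.
move=> b c; rewrite -(gK b) -(gK c) -fM => /divides_iso/h.
by case=> /divides_iso; [left|right].
Qed.

Lemma ufd_iso : ufd A -> ufd B.
Proof.
move=> U b b0; have [|m [u [s [uu hs es e]]]] := U (g b).
  by rewrite -(inj_eq (can_inj fK)) gK f0.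
exists m, (f u), (map f s); split.
- by rewrite unit_iso.
- by move=> _ /mapP[q qs ->]; apply: prime_iso; apply: hs.
- by rewrite size_map.
by rewrite -[LHS]gK e fM (big_morph f fM f1) big_map.
Qed.

End RingIso.

(** * Multivariate polynomials as polynomials in the last variable *)

Section MpolyIso.
Variables (n : nat) (k : closedFieldType).
Local Notation widen := (widen_ord (leqnSn n)).

Lemma muniX (m : 'X_{1..n.+1}) : muni ('X_[m] : {mpoly k[n.+1]}) =
  'X_[[multinom m (widen i) | i < n]] *: 'X^(m ord_max).
Proof. by rewrite muniE msuppX big_seq1 mcoeffX eqxx scale1r. Qed.

Definition uni_back (f : {poly {mpoly k[n]}}) : {mpoly k[n.+1]} :=
  (map_poly (@mwiden n k) f).['X_ord_max].

Lemma uni_back_is_additive : additive uni_back.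
Proof. by move=> f g; rewrite /uni_back rmorphB hornerD hornerN. Qed.

Lemma uni_back_is_multiplicative : multiplicative uni_back.
Proof.
split=> [f g|]; rewrite /uni_back; first by rewrite rmorphM hornerM.
by rewrite rmorph1 hornerC.
Qed.

HB.instance Definition _ := GRing.isAdditive.Build _ _ uni_back uni_back_is_additive.
HB.instance Definition _ :=
  GRing.isMultiplicative.Build _ _ uni_back uni_back_is_multiplicative.

Lemma mnmwiden_split (m : 'X_{1..n.+1}) :
  (mnmwiden [multinom m (widen i) | i < n] + U_(ord_max) *+ m ord_max)%MM = m.
Proof.
apply/mnmP=> i; rewrite mnmDE mulmnE mnm1E.
have [j ->|->] := unliftP ord_max i.
  have -> : lift ord_max j = widen j by apply: val_inj; rewrite /= /bump leqNgt ltn_ord.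
  rewrite mnmwiden_widen mnmE -val_eqE /= gtn_eqF ?ltn_ord //.
  by rewrite mul0n addn0.
by rewrite mnmwiden_ordmax eqxx mul1n.
Qed.

Lemma muniK : cancel (@muni n k) uni_back.
Proof.
apply: mpolyind => [|c m p _ _ IH]; first by rewrite muni0 rmorph0.
rewrite muniD [LHS]raddfD; congr (_ + _); last exact: IH.
rewrite muniZ muniX /= /uni_back !map_polyZ /= map_polyXn !hornerZ hornerXn mwidenC mwidenX.
by rewrite mpolyXn -mpolyXD mnmwiden_split mul_mpolyC.
Qed.

Lemma muni_mwiden (p : {mpoly k[n]}) : muni (mwiden p) = p%:P.
Proof.
elim/mpolyind: p => [|c m p _ _ IH]; first by rewrite !rmorph0.
rewrite mwidenD muniD polyCD; congr (_ + _); last exact: IH.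
rewrite mwidenZ mwidenX muniZ muniX mnmwiden_ordmax expr0 alg_polyC -mul_polyC -polyCM.
rewrite mul_mpolyC; congr (_ *: 'X_[_])%:P.
by apply/mnmP=> i; rewrite mnmE mnmwiden_widen.
Qed.

Lemma uni_backK : cancel uni_back (@muni n k).
Proof.
elim/poly_ind => [|f c IH]; first by rewrite !rmorph0.
rewrite !rmorphD !rmorphM /= IH; congr (_ * _ + _).
  rewrite /uni_back map_polyX hornerX muniX mnm1E eqxx.
  have -> : [multinom (U_(ord_max : 'I_n.+1)%MM (widen i)) | i < n] = 0%MM.
    by apply/mnmP=> i; rewrite mnmE mnm1E -val_eqE /= gtn_eqF ?ltn_ord // mnm0E.
  by rewrite mpolyX0 scale1r.
by rewrite /uni_back map_polyC hornerC muni_mwiden.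
Qed.

Lemma muni_mmap (S : comNzRingType) (c : {rmorphism k -> S})
    (p : {mpoly k[n.+1]}) (v : 'I_n.+1 -> S) :
  (map_poly (mmap c (v \o widen)) (muni p)).[v ord_max] = mmap c v p.
Proof.
elim/mpolyind: p => [|a m p _ _ IH]; first by rewrite !rmorph0 horner0.
rewrite muniD [map_poly _ _]raddfD mmapD hornerD; congr (_ + _); last exact: IH.
rewrite muniZ muniX /= !map_polyZ /= map_polyXn !hornerZ hornerXn mmapC mmapZ !mmapX.
rewrite /mmap1 big_ord_recr /=; congr (_ * (_ * _)).
by apply: eq_bigr => i _; rewrite mnmE.
Qed.

Lemma muni_eval (p : {mpoly k[n.+1]}) (v : 'I_n.+1 -> k) :
  (map_poly (meval (v \o widen)) (muni p)).[v ord_max] = p.@[v].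
Proof. exact: muni_mmap. Qed.

End MpolyIso.

(** * Factoriality and Nullstellensatz by induction on the variables *)

Section MpolyUfd.
Variables (k : closedFieldType).

Lemma mpoly0_const (p : {mpoly k[0]}) : exists c, p = c%:MP.
Proof. by exists (p@_0%MM); apply: nvar0_mpolyC. Qed.

Lemma mpoly_ufd n : ufd {mpoly k[n]}.
Proof.
elim: n => [|n IH].
  move=> p p0; exists 0%N; apply: factored_unit.
  have [c ec] := mpoly0_const p.
  have c0 : c != 0 by rewrite -(mpolyC_eq0 0) -ec.
  by rewrite ec; apply/andP; rewrite mcoeffC eqxx mulr1 unitfE.
apply: (@ufd_iso {poly {mpoly k[n]}} {mpoly k[n.+1]} (@uni_back n k) (@muni n k)).
- exact: uni_backK.
- exact: muniK.
- exact: (rmorph0 (@uni_back n k)).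
- exact: (rmorph1 (@uni_back n k)).
- exact: (rmorphM (@uni_back n k)).
exact: poly_ufd.
Qed.

Lemma mpoly_vanish n (p : {mpoly k[n]}) : (forall v, p.@[v] = 0) -> p = 0.
Proof.
elim: n p => [|n IH] p h.
  by have [c ec] := mpoly0_const p; have := h (fun=> 0); rewrite ec mevalC => ->.
apply: (can_inj (@muniK n k)); rewrite rmorph0.
apply: (@poly_vanish _ k ('I_n -> k) (fun v => meval v)) => [q|v a]; first exact: IH.
pose w := fun i : 'I_n.+1 => if unlift ord_max i is Some j then v j else a.
rewrite -(h w) -muni_eval /w unlift_none; congr (_.[_]); apply: eq_map_poly => q /=.
apply: meval_eq => i /=.
have -> : widen_ord (leqnSn n) i = lift ord_max i.
  by apply: val_inj; rewrite /= /bump leqNgt ltn_ord.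
by rewrite liftK.
Qed.

Lemma mpoly_nullstellensatz n (p h : {mpoly k[n]}) : prime_elt p ->
  (forall v, p.@[v] = 0 -> h.@[v] = 0) -> divides p h.
Proof.
elim: n p h => [|n IH] p h hp H.
  (* Without variables every nonzero polynomial is a unit, so there is no prime. *)
  have [c ec] := mpoly0_const p; case: hp => p0 /negP[].
  have c0 : c != 0 by rewrite -(mpolyC_eq0 0) -ec.
  by rewrite ec; apply/andP; rewrite mcoeffC eqxx mulr1 unitfE.
apply/(divides_iso (@muniK n k) (@uni_backK n k) (@muniM n k)).
apply: (@poly_nullstellensatz _ _ k ('I_n -> k) (fun v => meval v)).
- exact: mpoly_ufd.
- exact: mpoly_vanish.
- by move=> q r hq; apply: IH.
- exact: (prime_iso (@muniK n k) (@uni_backK n k) (@muni0 n k) (@muni1 n k) (@muniM n k)).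
move=> v a; pose w := fun i : 'I_n.+1 => if unlift ord_max i is Some j then v j else a.
have E (q : {mpoly k[n.+1]}) : (map_poly (meval v) (muni q)).[a] = q.@[w].
  rewrite -muni_eval /w unlift_none; congr (_.[_]); apply: eq_map_poly => r /=.
  apply: meval_eq => i /=.
  have -> : widen_ord (leqnSn n) i = lift ord_max i.
    by apply: val_inj; rewrite /= /bump leqNgt ltn_ord.
  by rewrite liftK.
by move=> ep; apply: (etrans (E h)); apply: H; apply: etrans (esym (E p)) ep.
Qed.

Lemma mpoly_unit_const n (p : {mpoly k[n]}) : p \is a GRing.unit ->
  exists2 c, c != 0 & p = c%:MP.
Proof.
by move=> /andP[/eqP e u]; exists (p@_0%MM); rewrite // -unitfE.
Qed.

End MpolyUfd.

(** * Krull dimension of polynomial rings *)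

Section Dimension.
Variable k : closedFieldType.

(** [msize] is the degree plus one; with successors the bound is additive and also covers the zero
    polynomial. *)
Lemma msizeM_bound n (p q : {mpoly k[n]}) a b :
  (msize p <= a.+1)%N -> (msize q <= b.+1)%N -> (msize (p * q) <= (a + b).+1)%N.
Proof.
have [->|p0] := eqVneq p 0; first by rewrite mul0r msize0.
have [->|q0] := eqVneq q 0; first by rewrite mulr0 msize0.
move=> ha hb; rewrite msizeM //.
have := leq_add ha hb; rewrite addSn addnS.
by case: (msize p + msize q)%N => //= c; rewrite ltnS.
Qed.

Lemma msizeX_bound n (p : {mpoly k[n]}) a e :
  (msize p <= a.+1)%N -> (msize (p ^+ e) <= (a * e).+1)%N.
Proof.
move=> ha; elim: e => [|e IH]; first by rewrite expr0 msize1.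
by rewrite exprS mulnS; apply: msizeM_bound.
Qed.

Lemma msize_prod_bound n m (p : 'I_m -> {mpoly k[n]}) a :
  (forall i, (msize (p i) <= a.+1)%N) -> (msize (\prod_(i < m) p i) <= (m * a).+1)%N.
Proof.
elim: m p => [|m IH] p h; first by rewrite big_ord0 msize1.
rewrite big_ord_recl mulSn; apply: msizeM_bound => //.
by apply: IH => i; apply: h.
Qed.

Lemma wide_matrix_kernel m n (A : 'M[k]_(m, n)) : (n < m)%N -> exists2 u : 'rV_m, u != 0 & u *m A = 0.
Proof.
move=> hnm; have: kermx A != 0.
  rewrite kermx_eq0 /row_free; apply: contraTneq hnm => <-.
  by rewrite -leqNgt rank_leq_col.
by move/rowV0Pn=> [u /sub_kermxP h u0]; exists u.
Qed.

(* Among the monomials of box degree N in the f i, of which there are N^(n+1),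
   a linear relation exists because their values lie in a space of dimension
   O(N^n). *)
Lemma algebraic_dependence n (f : 'I_n.+1 -> {mpoly k[n]}) :
  exists2 Q : {mpoly k[n.+1]}, Q != 0 & mmap (@mpolyC n k) f Q = 0.
Proof.
pose d := \max_i msize (f i).
have hd i : (msize (f i) <= d.+1)%N.
  have h : (msize (f i) <= d)%N by apply: leq_bigmax.
  exact: leqW.
(* A product of n + 1 powers below N has degree at most (n + 1) d N, so its monomials lie in a box
   of side M. As M is at most ((n + 1) d + 1) N, this N makes N^(n+1) exceed M^n. *)
pose N := ((n.+1 * d).+1 ^ n).+1; pose M := (n.+1 * (d * N)).+1.
pose E := {ffun 'I_n.+1 -> 'I_N}; pose C := {ffun 'I_n -> 'I_M}.
pose g (e : E) := \prod_i f i ^+ e i.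
have hg e : (msize (g e) <= M)%N.
  apply: msize_prod_bound => i; apply: leq_trans (msizeX_bound _ (hd i)) _.
  by rewrite ltnS leq_mul2l (ltnW (ltn_ord _)) orbT.
pose A : 'M[k]_(#|{: E}|, #|{: C}|) :=
  \matrix_(a, b) (g (enum_val a))@_[multinom ((enum_val b : C) i : nat) | i < n].
have hcard : (#|{: C}| < #|{: E}|)%N.
  rewrite !card_ffun !card_ord expnS.
  apply: leq_ltn_trans (_ : ((n.+1 * d).+1 * N) ^ n < _)%N.
    have lexp a b e : (a <= b -> a ^ e <= b ^ e)%N.
      by move=> ab; elim: e => // e IH; rewrite !expnS leq_mul.
    by apply: lexp; rewrite [leqRHS]mulSn /M mulnA -[leqLHS]add1n leq_add2r.
  by rewrite expnMn ltn_mul2r expn_gt0 /= ltnS leqnn.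
have [u u0 hu] := wide_matrix_kernel A hcard.
pose mn (e : E) := [multinom (e i : nat) | i < n.+1].
have mn_inj : injective mn.
  by move=> e e' /mnmP h; apply/ffunP=> i; apply: val_inj; have := h i; rewrite !mnmE.
exists (\sum_(a < #|{: E}|) u 0 a *: 'X_[mn (enum_val a)]).
  have [a ha] : exists a, u 0 a != 0 by apply/rV0Pn.
  apply/eqP=> /(congr1 (mcoeff (mn (enum_val a)))); rewrite mcoeff0 raddf_sum /=.
  rewrite (bigD1 a) //= big1 ?addr0 => [|b nab].
    by rewrite mcoeffZ mcoeffX eqxx mulr1 => e; rewrite e eqxx in ha.
  by rewrite mcoeffZ mcoeffX (inj_eq mn_inj) (inj_eq enum_val_inj) (negPf nab) mulr0.
rewrite raddf_sum /=; apply/mpolyP=> m; rewrite mcoeff0 raddf_sum /=.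
have E1 a : (mmap (@mpolyC n k) f (u 0 a *: 'X_[mn (enum_val a)]))@_m = u 0 a * (g (enum_val a))@_m.
  rewrite mmapZ mmapX /= mul_mpolyC mcoeffZ; congr (_ * (_)@_m).
  by apply: eq_bigr => i _; rewrite mnmE.
rewrite (eq_bigr _ (fun a _ => E1 a)).
(* At monomials of the box the coefficient vanishes by the choice of [u]; any other monomial has too
   large a degree to occur. *)
have [hm|hm] := boolP [forall i, m i < M]%N.
  pose c : C := [ffun i => Ordinal (forallP hm i)].
  have := congr1 (fun B : 'rV_ _ => B 0 (enum_rank c)) hu; rewrite !mxE => h0; rewrite -[RHS]h0.
  apply: eq_bigr => a _; rewrite mxE enum_rankK; congr (_ * _@__).
  by apply/mnmP=> i; rewrite mnmE ffunE.
rewrite big1 // => a _; rewrite [X in _ * X]memN_msupp_eq0 ?mulr0 //.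
apply: msize_mdeg_ge; apply: leq_trans (hg _) _.
move: hm; rewrite negb_forall => /existsP[i]; rewrite -leqNgt => hi.
by apply: leq_trans hi _; rewrite mdegE (bigD1 i) //= leq_addr.
Qed.

Lemma prime_power_cancel n (P : {mpoly k[n]} -> Prop) x y j : prime_ideal P -> ~ P x ->
  P (y * x ^+ j) -> P y.
Proof.
move=> [_ _ _ P1 Pp] nx; elim: j y => [|j IH] y; first by rewrite expr0 mulr1.
by rewrite exprSr mulrA => /Pp[/IH|/nx].
Qed.

(* Coquand and Lombardi: in a nontrivial relation, the lowest power of each
   variable in turn can be cancelled, until a nonzero constant is left. *)
Lemma chain_independent n m (f : 'I_m -> {mpoly k[n]}) (P : nat -> {mpoly k[n]} -> Prop)
    (Q : {mpoly k[m]}) :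
  (forall i, (i <= m)%N -> prime_ideal (P i)) ->
  (forall i p, (i < m)%N -> P i p -> P i.+1 p) ->
  (forall i : 'I_m, P (m - i)%N (f i) /\ ~ P (m - i.+1)%N (f i)) ->
  Q != 0 -> ~ P 0%N (mmap (@mpolyC n k) f Q).
Proof.
elim: m f P Q => [|m IH] f P Q hP hsub hf Q0.
  have [c ec] := mpoly0_const Q; rewrite ec mmapC => hc.
  have c0 : c != 0 by rewrite -(mpolyC_eq0 0) -ec.
  have [_ _ Pm P1 _] := hP 0%N (leqnn _); apply: P1.
  have := Pm (c^-1)%:MP c%:MP hc; rewrite -mpolyCM mulVf //.
set w := f \o widen_ord (leqnSn m); set x := f ord_max.
have [x1 x0] : P 1%N x /\ ~ P 0%N x by have := hf ord_max; rewrite /= subSnn subnn.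
set q := muni Q; have q0 : q != 0.
  by apply: contraNneq Q0 => e; rewrite -(muniK Q) -/q e raddf0.
have [j qj hj] : exists2 j, q`_j != 0 & forall i, (i < j)%N -> q`_i = 0.
  have ex : exists j, q`_j != 0 by exists (size q).-1; rewrite -lead_coefE lead_coef_eq0.
  exists (ex_minn ex); case: ex_minnP => // j _ hmin i.
  by rewrite ltnNge; apply: contraNeq => /hmin.
rewrite -muni_mmap -/w -/x -/q => h.
have [r er] : exists r : {poly {mpoly k[n]}}, map_poly (mmap (@mpolyC n k) w) q =
    ((mmap (@mpolyC n k) w q`_j)%:P + r * 'X) * 'X^j.
  exists (\poly_(i < size q) mmap (@mpolyC n k) w q`_(i + j.+1)); apply/polyP=> i.
  rewrite coef_map coefMXn; case: ltnP => [/hj ->|hij]; first by rewrite /= mmap0.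
  rewrite coefD coefMX coefC coef_poly subn_eq0.
  have [le|lt] := leqP i j; first by rewrite addr0 (anti_leq (introT andP (conj le hij))).
  rewrite add0r -subnS subnSK //.
  rewrite subnK //; case: ltnP => // hs; rewrite [q`_i]nth_default; first exact: raddf0.
  by apply: leq_trans (ltnW hs) (leq_subr _ _).
rewrite er hornerM hornerXn in h.
have := prime_power_cancel (hP 0%N isT) x0 h.
rewrite hornerD hornerC hornerM hornerX => /(hsub 0%N _ isT) h1.
have [_ Pa Pm _ _] := hP 1%N isT.
apply: (IH w (fun i => P i.+1) q`_j) => //.
- by move=> i hi; apply: hP.
- by move=> i p hi; apply: hsub.
- by move=> i; have := hf (widen_ord (leqnSn m) i); rewrite /= subSS subSn ?(ltnW (ltn_ord i)) // subnSK.
rewrite -[X in P _ X](addrK (r.[x] * x)); apply: Pa => //.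
by rewrite -mulNr; apply: Pm.
Qed.

(** Prepending the zero ideal, strictly smaller because of [F], gives a chain with n + 1 strict
    inclusions. Elements picked from the successive differences would be algebraically independent,
    but n + 1 polynomials in n variables never are. *)
Lemma prime_chain_bound n (F : {mpoly k[n]}) (J : {mpoly k[n]} -> Prop) :
  F != 0 -> J F -> ~ exists P, prime_chain J n P.
Proof.
move=> F0 JF [P [hP hJ hs]].
have [f hf] : exists f : 'I_n.+1 -> {mpoly k[n]}, forall i : 'I_n.+1,
    if (i < n)%N then P (n - i)%N (f i) /\ ~ P (n - i.+1)%N (f i) else f i = F.
  have [g hg] : exists g : nat -> {mpoly k[n]}, forall i, (i < n)%N ->
      P (n - i)%N (g i) /\ ~ P (n - i.+1)%N (g i).
    have : forall j, (j <= n)%N -> exists g : nat -> {mpoly k[n]}, forall i, (i < j)%N ->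
      P (n - i)%N (g i) /\ ~ P (n - i.+1)%N (g i).
      elim=> [|j IHj] hj; first by exists (fun=> 0).
      have [g hg] := IHj (ltnW hj).
      have [|_ [p [h1 h2]]] := hs (n - j.+1)%N; first by rewrite ltn_subrL (leq_trans _ hj).
      exists (fun i => if i == j then p else g i) => i.
      rewrite ltnS leq_eqVlt; case: eqP => [->|_] /=; last exact: hg.
      by rewrite -[(n - j)%N](subnSK hj).
    by apply.
  exists (fun i : 'I_n.+1 => if (i < n)%N then g i else F) => i.
  by case hi: (i < n)%N => //; apply: hg.
have [Q Q0 hQ] := algebraic_dependence f.
pose P' i := if i is j.+1 then P j else fun p => p = 0.
apply: (@chain_independent n n.+1 f P' Q) => //.
- move=> [|i] hi; last exact: hP.
  split=> //; first by move=> p q -> ->; rewrite addr0.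
  - by move=> p q ->; rewrite mulr0.
  - by move/eqP; rewrite oner_eq0.
  - by move=> p q /eqP; rewrite mulf_eq0 => /orP[/eqP|/eqP]; [left|right].
- move=> [|i] p hi /= h; last by apply: (proj1 (hs i hi)).
  by rewrite h; case: (hP 0%N isT).
move=> i; have := hf i; rewrite subSS; case: ltnP => hi.
  by rewrite subSn ?(ltnW hi) //= -(subnSK hi).
have -> : (i : nat) = n by apply/anti_leq; rewrite hi -ltnS ltn_ord.
by rewrite subnn subSn // subnn /= => ->; split; [apply: hJ|apply/eqP].
Qed.

End Dimension.

(** * The normal form of a smooth quadric *)

Section QuadraticForm.
Variables (k : closedFieldType) (n : nat) (F : {mpoly k[n]}).
Hypothesis hF : F \is 2.-homog.

Definition qform (x : 'rV[k]_n) := F.@[fun i => x 0 i].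
(** The bilinear form of [qform], written with partial derivatives so that the Jacobian criterion
    becomes its nondegeneracy at isotropic vectors. *)
Definition polar (x y : 'rV[k]_n) := \sum_i y 0 i * (F^`M(i)).@[fun i => x 0 i].

Lemma monomial_deg2 (m : 'X_{1..n}) : mdeg m = 2%N -> exists i j, m = (U_(i) + U_(j))%MM.
Proof.
move=> hm; have [i hi] : exists i, m i != 0%N.
  apply: NNPP => h; have e : m = 0%MM.
    apply/mnmP=> i; rewrite mnm0E; apply/eqP; apply: contraT => hi.
    by case: h; exists i.
  by rewrite e mdeg0 in hm.
have le : (U_(i) <= m)%MM by rewrite lep1mP.
have : mdeg (m - U_(i)) = 1%N.
  by have := hm; rewrite -{1}(submK le) mdegD mdeg1 addn1 => -[].
by move/eqP/mdeg1P=> [j /eqP e]; exists i, j; rewrite -{1}(submK le) e addmC.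
Qed.

(** Taylor's formula, exact in degree 2. The defect [D] is linear in the polynomial, so products of
    two variables suffice. *)
Lemma qformD x y : qform (x + y) = qform x + polar x y + qform y.
Proof.
rewrite /qform /polar; set vx := fun i => x 0 i; set vy := fun i => y 0 i.
set vs := fun i => (x + y) 0 i.
pose D (p : {mpoly k[n]}) := p.@[vs] - (p.@[vx] + \sum_i y 0 i * (p^`M(i)).@[vx] + p.@[vy]).
suff: D F = 0 by move/eqP; rewrite subr_eq0 => /eqP.
have DD p q : D (p + q) = D p + D q.
  rewrite /D !mevalD.
  have -> : \sum_i y 0 i * ((p + q)^`M(i)).@[vx] =
     \sum_i y 0 i * (p^`M(i)).@[vx] + \sum_i y 0 i * (q^`M(i)).@[vx].
    by rewrite -big_split; apply: eq_bigr => i _; rewrite mderivD mevalD mulrDr.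
  ring.
have DZ c p : D (c *: p) = c * D p.
  rewrite /D !mevalZ.
  have -> : \sum_i y 0 i * ((c *: p)^`M(i)).@[vx] = c * \sum_i y 0 i * (p^`M(i)).@[vx].
    by rewrite big_distrr; apply: eq_bigr => i _; rewrite mderivZ mevalZ mulrCA.
  ring.
have DX m : mdeg m = 2%N -> D 'X_[m] = 0.
  case/monomial_deg2=> i [j ->]; rewrite /D mpolyXD !mevalM !mevalXU /vs !mxE.
  have -> : \sum_l y 0 l * (('X_i * 'X_j : {mpoly k[n]})^`M(l)).@[vx] =
      y 0 i * x 0 j + x 0 i * y 0 j.
    rewrite (eq_bigr (fun l => y 0 l * ((i == l)%:R * x 0 j) + y 0 l * (x 0 i * (j == l)%:R))).
      rewrite big_split /= (bigD1 i) //= big1 ?addr0 => [|l /negPf h]; last first.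
        by rewrite eq_sym h mul0r mulr0.
      rewrite (bigD1 j) //= [X in _ + (_ + X)]big1 ?addr0 => [|l /negPf h]; last first.
        by rewrite eq_sym h !mulr0.
      by rewrite !eqxx mul1r mulr1; ring.
    move=> l _; rewrite mderivM mevalD !mevalM !mevalXU !mderivX !mevalZ !mnm1E.
    have E a : (a == l)%:R * ('X_[U_(a) - U_(l)] : {mpoly k[n]}).@[vx] = (a == l)%:R.
      have [->|] := eqVneq a l; last by rewrite mul0r.
      have -> : (U_(l) - U_(l) = 0 :> 'X_{1..n})%MM by apply/mnmP=> t; rewrite mnmBE subnn mnm0E.
      by rewrite mpolyX0 meval1 mulr1.
    by rewrite !E mulrDr.
  by rewrite /vx /vy; ring.
rewrite [F]mpolyE big_seq; elim/big_rec: _ => [|m p hm IH].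
  by have := DZ 0 0; rewrite scale0r mul0r.
by rewrite DD IH addr0 DZ DX ?mulr0 // (dhomog_mf hF hm).
Qed.

Lemma polarDr x y z : polar x (y + z) = polar x y + polar x z.
Proof. by rewrite /polar -big_split; apply: eq_bigr => i _; rewrite mxE mulrDl. Qed.

Lemma polarZr c x y : polar x (c *: y) = c * polar x y.
Proof. by rewrite /polar big_distrr; apply: eq_bigr => i _; rewrite /= mxE mulrA. Qed.

Lemma polarC x y : polar x y = polar y x.
Proof.
have := qformD y x; rewrite addrC qformD => h.
by apply: (addrI (qform x)); apply: (addIr (qform y)); rewrite h; ring.
Qed.

Lemma polarDl x y z : polar (y + z) x = polar y x + polar z x.
Proof. by rewrite polarC polarDr !(polarC x). Qed.

Lemma polarZl c x y : polar (c *: y) x = c * polar y x.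
Proof. by rewrite polarC polarZr (polarC x). Qed.

Lemma qformZ c x : qform (c *: x) = c ^+ 2 * qform x.
Proof.
rewrite /qform [F]mpolyE !raddf_sum big_distrr big_seq [RHS]big_seq /=.
apply: eq_bigr => m hm; rewrite !mevalZ !mevalX mulrCA; congr (_ * _).
rewrite -(dhomog_mf hF hm : mdeg m = 2%N) mdegE expr_sum -big_split /=.
by apply: eq_bigr => i _; rewrite mxE exprMn.
Qed.

Lemma polarxx x : qform x = 0 -> polar x x = 0.
Proof.
move=> h; have := qformD x x; rewrite h addr0 add0r => <-.
have -> : x + x = 2%:R *: x by rewrite scaler_nat mulr2n.
by rewrite qformZ h mulr0.
Qed.

Lemma isotropic_in_plane f1 f2 :
  (forall a b, a *: f1 + b *: f2 = 0 -> a = 0 /\ b = 0) ->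
  exists a b, a *: f1 + b *: f2 != 0 /\ qform (a *: f1 + b *: f2) = 0.
Proof.
move=> ind; have [q1|q1] := eqVneq (qform f1) 0.
  exists 1, 0; rewrite scale0r addr0 scale1r; split=> //.
  apply/eqP=> e; have [] := ind 1 0; first by rewrite e scaler0 scale0r addr0.
  by move/eqP; rewrite oner_eq0.
pose P := (qform f1) *: 'X^2 + ((polar f1 f2) *: 'X + (qform f2)%:P).
have sP : size P = 3%N.
  rewrite /P size_polyDl size_scale ?size_polyXn //.
  apply: leq_ltn_trans (size_polyD _ _) _.
  rewrite gtn_max !(leq_ltn_trans (size_scale_leq _ _)) ?size_polyX //.
  by rewrite (leq_ltn_trans (size_polyC_leq1 _)).
have [a] : exists a, root P a by apply/closed_rootP; rewrite sP.
rewrite rootE /P !hornerD !hornerZ hornerXn hornerX hornerC => /eqP ha.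
exists a, 1; split.
  apply/eqP=> /ind[_ /eqP]; by rewrite oner_eq0.
by rewrite scale1r qformD qformZ polarZl -ha; ring.
Qed.

(** Two linear conditions leave a space of dimension at least n - 2, which contains a plane, and on
    every plane a quadratic form has a nontrivial zero. *)
Lemma isotropic_in_kernel (K : 'M[k]_(n, 2)) : (3 < n)%N ->
  exists x, [/\ x != 0, qform x = 0 & x *m K = 0].
Proof.
move=> hn; have hr : (1 < \rank (kermx K))%N.
  by rewrite mxrank_ker ltn_subRL (leq_ltn_trans _ hn) // addn1 ltnS rank_leq_col.
set B := row_base (kermx K); have Bf : row_free B := row_base_free _.
pose i0 := Ordinal (ltnW hr); pose i1 := Ordinal hr.
have EB a b : a *: row i0 B + b *: row i1 B =
    (a *: delta_mx 0 i0 + b *: delta_mx 0 i1) *m B.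
  by rewrite mulmxDl -!scalemxAl -!rowE.
have [a [b [h0 h1]]] : exists a b, a *: row i0 B + b *: row i1 B != 0 /\
    qform (a *: row i0 B + b *: row i1 B) = 0.
  apply: isotropic_in_plane => a b; rewrite EB => /eqP.
  rewrite -(mul0mx _ B) => /eqP/(row_free_inj Bf)/rowP h.
  by have := h i0; have := h i1; rewrite !mxE !eqxx /= !mulr1 !mulr0 addr0 add0r.
exists (a *: row i0 B + b *: row i1 B); split=> //.
apply/sub_kermxP; rewrite EB; apply: submx_trans (submxMl _ _) _.
by rewrite eq_row_base.
Qed.

Hypothesis hsm : forall x : 'rV[k]_n, x != 0 -> qform x = 0 -> exists y, polar x y != 0.

(** Two mutually orthogonal hyperbolic pairs, e0 with e3 and e1 with e2. The value -1 makes the form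
    a 2 x 2 determinant in the dual coordinates. *)
Lemma hyperbolic_basis : (3 < n)%N -> exists e0 e1 e2 e3 : 'rV[k]_n,
  [/\ [/\ qform e0 = 0, qform e1 = 0, qform e2 = 0 & qform e3 = 0],
      polar e0 e3 = 1, polar e1 e2 = -1 &
      [/\ polar e0 e1 = 0, polar e0 e2 = 0, polar e3 e1 = 0 & polar e3 e2 = 0]].
Proof.
move=> hn; have [e0 [e00 q0 _]] := isotropic_in_kernel 0 hn.
have hyp x c : x != 0 -> qform x = 0 -> exists y, polar x y = c.
  move=> x0 qx; have [y hy] := hsm x0 qx.
  by exists ((c / polar x y) *: y); rewrite polarZr mulfVK.
have [w hw] := hyp e0 1 e00 q0.
(* Adding this multiple of e0 makes w isotropic and keeps its pairing with e0. *)
pose e3 := w + (- qform w) *: e0.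
have b03 : polar e0 e3 = 1 by rewrite polarDr polarZr polarxx // mulr0 addr0.
have q3 : qform e3 = 0 by rewrite qformD qformZ polarZr (polarC w) hw q0; ring.
clearbody e3.
(* The columns are the linear forms [polar e0] and [polar e3], so e1 is chosen orthogonal to e0 and
   e3. *)
pose K : 'M[k]_(n, 2) := \matrix_(i, j) (F^`M(i)).@[fun l => (if j == 0 then e0 else e3) 0 l].
have [e1 [e10 q1 hK]] := isotropic_in_kernel K hn.
have b01 : polar e0 e1 = 0.
  by move/rowP/(_ 0): hK; rewrite !mxE => <-; apply: eq_bigr => i _; rewrite mxE.
have b31 : polar e3 e1 = 0.
  by move/rowP/(_ 1): hK; rewrite !mxE => <-; apply: eq_bigr => i _; rewrite mxE.
have [v hv] := hyp e1 (-1) e10 q1.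
(* The projection of v to the orthogonal complement of e0 and e3; its pairing with e1 does not
   change. *)
pose v' := v + (- polar v e3) *: e0 + (- polar v e0) *: e3.
have v0 : polar e0 v' = 0.
  by rewrite !polarDr !polarZr polarxx // b03 (polarC v e0); ring.
have v3 : polar e3 v' = 0.
  by rewrite !polarDr !polarZr (polarxx q3) (polarC e3 e0) b03 (polarC e3 v); ring.
have v1 : polar e1 v' = -1.
  by rewrite !polarDr !polarZr hv (polarC e1 e0) (polarC e1 e3) b01 b31; ring.
(* Since v' pairs to -1 with the isotropic e1, this coefficient makes the third vector isotropic. *)
exists e0, e1, (v' + qform v' *: e1), e3; split=> //.
- split=> //; rewrite qformD qformZ polarZr (polarC v') v1 q1; ring.
- by rewrite polarDr polarZr (polarxx q1) v1 mulr0 addr0.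
split=> //; first by rewrite polarDr polarZr v0 b01; ring.
by rewrite polarDr polarZr v3 b31; ring.
Qed.

End QuadraticForm.

(** Two binary digits: the same indices number the entries l_bb' of the 2 x 2 matrix and the
    variables s_b, u_b. *)
Definition ix (b b' : bool) : 'I_4 :=
  if b then if b' then @Ordinal 4 3 isT else @Ordinal 4 2 isT
  else if b' then @Ordinal 4 1 isT else @Ordinal 4 0 isT.

(* Locked, because unification of evaluations otherwise unfolds the sum. *)
Definition linform (k : closedFieldType) (L : 'M[k]_4) (j : 'I_4) : {mpoly k[4]} :=
  locked (\sum_i L i j *: 'X_i).

Lemma linform_eval (k : closedFieldType) (L : 'M[k]_4) j (x : 'I_4 -> k) :
  (linform L j).@[x] = \sum_i L i j * x i.
Proof. by rewrite /linform -lock raddf_sum; apply: eq_bigr => i _; rewrite /= mevalZ mevalXU. Qed.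

Lemma sum_ix (V : nmodType) (G : 'I_4 -> V) :
  \sum_i G i = G (ix false false) + G (ix false true) + G (ix true false) + G (ix true true).
Proof.
rewrite !big_ord_recl big_ord0 addr0 !addrA; do !congr (_ + _); congr G; exact: val_inj.
Qed.

Lemma quadric_normal_form (k : closedFieldType) (F : {mpoly k[4]}) :
  F \is 2.-homog -> smooth_hypersurface F ->
  exists L : 'M[k]_4, L \in unitmx /\
    F = linform L (ix false false) * linform L (ix true true)
        - linform L (ix false true) * linform L (ix true false).
Proof.
move=> hF hsm; have [|//|e0 [e1 [e2 [e3 [[q0 q1 q2 q3] b03 b12 [b01 b02 b31 b32]]]]]] :=
  @hyperbolic_basis k 4 F hF.
  move=> x x0 qx; have [|i hi] := hsm (fun i => x 0 i).
    by split=> //; apply/rV0Pn.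
  exists (delta_mx 0 i); rewrite /polar (bigD1 i) //= big1 => [|j /negPf h].
    by rewrite mxE !eqxx mul1r addr0.
  by rewrite mxE eqxx h mul0r.
pose e : 'M[k]_4 := \matrix_(j, i) (nth 0 [:: e0; e1; e2; e3] j) 0 i.
have ee (y : 'rV_4) : y *m e = y 0 (ix false false) *: e0 + y 0 (ix false true) *: e1
    + y 0 (ix true false) *: e2 + y 0 (ix true true) *: e3.
  by apply/rowP=> i; rewrite !mxE sum_ix !mxE.
have pe (y z : 'rV_4) : polar F (y *m e) z = y 0 (ix false false) * polar F e0 z +
   y 0 (ix false true) * polar F e1 z + y 0 (ix true false) * polar F e2 z +
   y 0 (ix true true) * polar F e3 z.
  by rewrite ee !polarDl // !polarZl.
have b30 : polar F e3 e0 = 1 by rewrite polarC.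
have b21 : polar F e2 e1 = -1 by rewrite polarC.
have b10 : polar F e1 e0 = 0 by rewrite polarC.
have b13 : polar F e1 e3 = 0 by rewrite polarC.
have b20 : polar F e2 e0 = 0 by rewrite polarC.
have b23 : polar F e2 e3 = 0 by rewrite polarC.
(* A vector of the left kernel pairs to zero with each of e0, ..., e3, and these pairings are its
   coordinates up to sign. *)
have eu : e \in unitmx.
  rewrite -row_free_unit -kermx_eq0; apply/rowV0P=> y /sub_kermxP ye.
  have h z : polar F (y *m e) z = 0.
    by rewrite ye -(scale0r 0) polarZl // mul0r.
  have := h e0; have := h e1; have := h e2; have := h e3; rewrite !pe.
  rewrite b03 b13 b23 polarxx // b02 b12 b32 !polarxx // b01 b21 b31 b10 b20 b30.
  rewrite !mulr0 !addr0 !add0r !mulr1 !mulrN1 => h0 /eqP; rewrite oppr_eq0 => /eqP h1 /eqP.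
  rewrite oppr_eq0 => /eqP h2 h3.
  apply/rowP=> i; rewrite mxE; case: i => [[|[|[|[|//]]]] hi];
  [rewrite -[RHS]h0|rewrite -[RHS]h1|rewrite -[RHS]h2|rewrite -[RHS]h3]; congr (y _ _); exact: val_inj.
(* The columns of the inverse are the coordinate functions with respect to e0, ..., e3. *)
exists (invmx e); split; first by rewrite unitmx_inv.
apply/eqP; rewrite -subr_eq0; apply/eqP/mpoly_vanish => x.
pose r : 'rV[k]_4 := \row_i x i; pose y := r *m invmx e.
have ey j : (linform (invmx e) j).@[x] = y 0 j.
  by rewrite linform_eval mxE; apply: eq_bigr => i _; rewrite mxE mulrC.
have eF : F.@[x] = qform F (y *m e).
  by rewrite /y mulmxKV //; apply: meval_eq => i; rewrite mxE.
rewrite !mevalB !mevalM !ey eF ee.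
rewrite !(qformD hF) !(qformZ hF).
rewrite !polarDl //.
rewrite !polarZl // !polarZr.
rewrite q0 q1 q2 q3.
rewrite b01 b02 b03 b12 b13 b23; ring.
Qed.

(** * The Segre map *)

Definition hb (j : 'I_4) : bool := (1 < j)%N.
Definition lb (j : 'I_4) : bool := odd j.

Arguments ix : simpl never.
Arguments hb : simpl never.
Arguments lb : simpl never.

Lemma ixK j : ix (hb j) (lb j) = j.
Proof. by case: j => [[|[|[|[|//]]]] h]; apply: val_inj. Qed.

Lemma hb_ix b b' : hb (ix b b') = b. Proof. by case: b; case: b'. Qed.
Lemma lb_ix b b' : lb (ix b b') = b'. Proof. by case: b; case: b'. Qed.

Section Segre.
Variables (k : closedFieldType) (L : 'M[k]_4).
Hypothesis LU : L \in unitmx.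
Local Notation S := {mpoly k[4]}.
Local Notation pt := ('I_4 -> k).
Implicit Types (p q h P Q : S) (x y z : pt) (c b : bool) (m : 'X_{1..4}).

(* The variable ix c b is the b-th homogeneous coordinate of the P^1 factor
   number c; ell c b b' is the product of coordinate b of factor c with
   coordinate b' of the other factor. *)
Definition ell c b b' : S := linform L (if c then ix b b' else ix b' b).

Definition quadric : S :=
  ell true false false * ell true true true - ell true false true * ell true true false.

Lemma quadricE c : quadric =
  ell c false false * ell c true true - ell c false true * ell c true false.
Proof. by case: c => //; rewrite /quadric [X in _ - X]mulrC. Qed.

Lemma linform_hl j : linform L j = ell true (hb j) (lb j).
Proof. by rewrite /ell ixK. Qed.

(** The inverse of [L] passes from the values s_b u_b' of the four linear forms to the original
    coordinates. *)
Definition segre z : pt :=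
  fun i => \sum_j invmx L j i * (z (ix true (hb j)) * z (ix false (lb j))).

Lemma linform_segre z j : (linform L j).@[segre z] = z (ix true (hb j)) * z (ix false (lb j)).
Proof.
pose r := \row_j (z (ix true (hb j)) * z (ix false (lb j))).
have -> : (linform L j).@[segre z] = (r *m invmx L *m L) 0 j.
  rewrite linform_eval [RHS]mxE; apply: eq_bigr => i _; rewrite mulrC mxE; congr (_ * _).
  by apply: eq_bigr => l _; rewrite mxE mulrC.
by rewrite mulmxKV // mxE.
Qed.

Lemma ell_segre c b b' z : (ell c b b').@[segre z] = z (ix c b) * z (ix (~~ c) b').
Proof. by rewrite /ell linform_segre; case: c; rewrite hb_ix lb_ix //= mulrC. Qed.

Lemma linform_inj x y : (forall j, (linform L j).@[x] = (linform L j).@[y]) -> x = y.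
Proof.
move=> h; pose r := \row_i x i; pose s := \row_i y i.
have : r *m L = s *m L.
  apply/rowP=> j; have := h j; rewrite !linform_eval !mxE => e.
  by under eq_bigr do rewrite mxE mulrC; under [RHS]eq_bigr do rewrite mxE mulrC.
move/(can_inj (mulmxK LU))=> /rowP e; apply: functional_extensionality => i.
by have := e i; rewrite !mxE.
Qed.

Definition pullback p : S := locked (comp_mpoly [tuple \sum_j invmx L j i *:
   ('X_(ix true (hb j)) * 'X_(ix false (lb j))) | i < 4]) p.

Lemma pullback_eval p z : (pullback p).@[z] = p.@[segre z].
Proof.
rewrite /pullback -lock comp_mpoly_meval; apply: meval_eq => i; rewrite tnth_mktuple raddf_sum /=.
by apply: eq_bigr => j _; rewrite mevalZ mevalM !mevalXU.
Qed.

Lemma pullbackM p q : pullback (p * q) = pullback p * pullback q.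
Proof. by rewrite /pullback -lock rmorphM. Qed.
Lemma pullbackD p q : pullback (p + q) = pullback p + pullback q.
Proof. by rewrite /pullback -lock raddfD. Qed.
Lemma pullbackN p : pullback (- p) = - pullback p.
Proof. by rewrite /pullback -lock raddfN. Qed.
Lemma pullbackZ a p : pullback (a *: p) = a *: pullback p.
Proof. by rewrite /pullback -lock linearZ. Qed.
Lemma pullback1 : pullback 1 = 1. Proof. by rewrite /pullback -lock rmorph1. Qed.
Lemma pullback0 : pullback 0 = 0. Proof. by rewrite /pullback -lock raddf0. Qed.

Lemma pullback_ell c b b' : pullback (ell c b b') = 'X_(ix c b) * 'X_(ix (~~ c) b').
Proof.
apply/eqP; rewrite -subr_eq0; apply/eqP/mpoly_vanish => z.
by rewrite mevalB pullback_eval ell_segre mevalM !mevalXU subrr.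
Qed.

(** These are the coordinate vectors of points of P^1 x P^1; the excluded ones form two planes of
    codimension two. *)
Definition good z := (exists b, z (ix true b) != 0) /\ (exists b, z (ix false b) != 0).

Lemma goodP c z : good z -> exists b b', z (ix c b) != 0 /\ z (ix (~~ c) b') != 0.
Proof. by move=> [[b hb] [b' hb']]; case: c; [exists b, b'|exists b', b]. Qed.

Lemma nonzero_ell x : (exists j, x j != 0) -> exists b b', (ell true b b').@[x] != 0.
Proof.
move=> [j xj]; apply: NNPP => h; case/eqP: xj.
have -> // : x = fun=> 0.
apply: linform_inj => l; rewrite [RHS]linform_eval big1 => [|t _]; last by rewrite mulr0.
apply/eqP; apply: contraT => n; case: h; exists (hb l), (lb l); by rewrite -linform_hl.
Qed.

Lemma ell_nonzero c b b' x : (ell c b b').@[x] != 0 -> exists j, x j != 0.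
Proof.
move=> h; apply: NNPP => n; case/eqP: h; rewrite linform_eval big1 // => i _.
by have [->|xi] := eqVneq (x i) 0; rewrite ?mulr0 //; case: n; exists i.
Qed.

Local Notation X := (hypersurface quadric).

Lemma segre_on z : good z -> X (segre z).
Proof.
move=> /(goodP true)[b [b' [h1 h2]]]; split; last first.
  by rewrite mevalB !mevalM !ell_segre; ring.
by apply: (@ell_nonzero true b b'); rewrite ell_segre mulf_neq0.
Qed.

(* The point of k^4 over x whose coordinate hb i in the first factor is 1. *)
Definition segre_lift (i : 'I_4) x : pt := fun v =>
  if hb v then (ell true (lb v) (lb i)).@[x] / (linform L i).@[x]
  else (ell true (hb i) (lb v)).@[x].

Lemma quadric_minor x b1 b2 b3 b4 : quadric.@[x] = 0 ->
  (ell true b1 b2).@[x] * (ell true b3 b4).@[x] = (ell true b3 b2).@[x] * (ell true b1 b4).@[x].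
Proof.
rewrite mevalB !mevalM => /eqP; rewrite subr_eq0 => /eqP.
suff H (f : bool -> bool -> k) : f false false * f true true = f false true * f true false ->
    f b1 b2 * f b3 b4 = f b3 b2 * f b1 b4 by apply: (H (fun b b' => (ell true b b').@[x])).
case: b1; case: b2; case: b3; case: b4 => h;
  first [ring | by rewrite h mulrC | by rewrite mulrC h | by rewrite -h mulrC].
Qed.

Lemma segre_liftK i x : quadric.@[x] = 0 -> (linform L i).@[x] != 0 ->
  segre (segre_lift i x) = x.
Proof.
move=> hx hi; apply: linform_inj => j; rewrite linform_segre /segre_lift !hb_ix !lb_ix.
apply: (mulIf hi); rewrite [LHS]mulrAC mulfVK // !linform_hl.
by rewrite (quadric_minor _ (lb i) _ _ hx) mulrC.
Qed.

Lemma segre_lift_hb i x : (linform L i).@[x] != 0 -> segre_lift i x (ix true (hb i)) = 1.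
Proof. by move=> hi; rewrite /segre_lift hb_ix lb_ix -linform_hl divff. Qed.

Lemma segre_lift_lb i x : segre_lift i x (ix false (lb i)) = (linform L i).@[x].
Proof. by rewrite /segre_lift hb_ix lb_ix -linform_hl. Qed.

Lemma segre_lift_good i x : (linform L i).@[x] != 0 -> good (segre_lift i x).
Proof.
move=> hi; split; first by exists (hb i); rewrite segre_lift_hb ?oner_neq0.
by exists (lb i); rewrite segre_lift_lb.
Qed.

Lemma segre_onto x : X x -> exists2 z, good z & x = segre z.
Proof.
move=> [xn qx]; have [b [b' h]] := nonzero_ell xn.
have h' : (linform L (ix b b')).@[x] != 0 by rewrite linform_hl hb_ix lb_ix.
exists (segre_lift (ix b b') x); first exact: segre_lift_good.
by rewrite segre_liftK.
Qed.

(** The torus acting on the coordinates of the two factors; its orbits on good vectors are the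
    points of P^1 x P^1. *)
Definition scale (a b : k) z : pt := fun v => (if hb v then a else b) * z v.

Lemma segre_scale (a b : k) z : segre (scale a b z) = fun i => a * b * segre z i.
Proof.
apply: functional_extensionality => i; rewrite /segre big_distrr; apply: eq_bigr => j _ /=.
by rewrite /scale !hb_ix; ring.
Qed.

Lemma good_scale (a b : k) z : a != 0 -> b != 0 -> good z -> good (scale a b z).
Proof.
move=> a0 b0 [[c hc] [d hd]].
by split; [exists c|exists d]; rewrite /scale hb_ix mulf_neq0.
Qed.

Definition wt c m := (m (ix c false) + m (ix c true))%N.

Lemma meval_scale (a b : k) z m :
  ('X_[m] : S).@[scale a b z] = a ^+ wt true m * b ^+ wt false m * ('X_[m] : S).@[z].
Proof.
rewrite !mevalX /= -![\prod_(i < 4) _]/(\prod_i _).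
rewrite !big_ord_recl !big_ord0 /scale /= /wt !exprMn !exprD.
rewrite -[ix true false]/(Ordinal (_ : 2 < 4)%N).
have -> : ix false false = ord0 by apply: val_inj.
have -> : ix false true = lift ord0 ord0 by apply: val_inj.
have -> : Ordinal (isT : (2 < 4)%N) = lift ord0 (lift ord0 ord0) by apply: val_inj.
have -> : ix true true = lift ord0 (lift ord0 (lift ord0 ord0)) by apply: val_inj.
ring.
Qed.

Lemma var_neq0 (i : 'I_4) : 'X_i != 0 :> S.
Proof.
apply/eqP=> e; have := mcoeffXU k i i; rewrite e mcoeff0 eqxx => /eqP.
by rewrite eq_sym oner_eq0.
Qed.

(** Multiplied by one variable of each factor, [P] vanishes at the remaining vectors too. *)
Lemma good_vanish P : (forall z, good z -> P.@[z] = 0) -> P = 0.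
Proof.
move=> h; have : P * ('X_(ix true true) * 'X_(ix false true)) = 0.
  apply: mpoly_vanish => z; rewrite !mevalM !mevalXU.
  have [->|n1] := eqVneq (z (ix true true)) 0; first by rewrite mul0r mulr0.
  have [->|n2] := eqVneq (z (ix false true)) 0; first by rewrite !mulr0.
  by rewrite h ?mul0r //; split; [exists true|exists true].
by move/eqP; rewrite !mulf_eq0 !(negPf (var_neq0 _)) !orbF => /eqP.
Qed.

Lemma good_vanish_mul P Q : Q != 0 -> (forall z, good z -> Q.@[z] != 0 -> P.@[z] = 0) -> P = 0.
Proof.
move=> Q0 h; have : P * Q = 0.
  apply: good_vanish => z gz; rewrite mevalM.
  by have [->|n] := eqVneq Q.@[z] 0; rewrite ?mulr0 // h ?mul0r.
by move/eqP; rewrite mulf_eq0 (negPf Q0) orbF => /eqP.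
Qed.

(** Scaling multiplies the coefficient at [m] by a character of the torus, and polynomials that
    agree on good vectors have equal coefficients. *)
Lemma scaled_coef P (a b u v : k) : (forall z, good z -> u * P.@[scale a b z] = v * P.@[z]) ->
  forall m, u * (a ^+ wt true m * b ^+ wt false m) * P@_m = v * P@_m.
Proof.
move=> h m.
pose Q := \sum_(m <- msupp P) (P@_m * (a ^+ wt true m * b ^+ wt false m)) *: ('X_[m] : S).
have cQ : Q@_m = P@_m * (a ^+ wt true m * b ^+ wt false m).
  rewrite /Q raddf_sum /=; have [hm|hm] := boolP (m \in msupp P).
    rewrite (bigD1_seq m) //= ?msupp_uniq // mcoeffZ mcoeffX eqxx mulr1 big1 ?addr0 // => i ni.
    by rewrite mcoeffZ mcoeffX (negPf ni) mulr0.
  rewrite memN_msupp_eq0 // mul0r big_seq big1 // => i hi.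
  by rewrite mcoeffZ mcoeffX; case: eqP hm => [<-|]; rewrite ?hi ?mulr0.
have : u *: Q - v *: P = 0.
  apply: good_vanish => z gz; rewrite mevalB !mevalZ -h // -mulrBr.
  suff -> : Q.@[z] = P.@[scale a b z] by rewrite subrr mulr0.
  rewrite [in RHS](mpolyE P) /Q !raddf_sum /=; apply: eq_bigr => i _.
  by rewrite !mevalZ meval_scale; ring.
move/(congr1 (mcoeff m)); rewrite mcoeff0 mcoeffB !mcoeffZ cQ => /eqP; rewrite subr_eq0 => /eqP <-.
ring.
Qed.

Lemma exists_separating (d e : nat) : d <> e -> exists2 a : k, a != 0 & a ^+ d != a ^+ e.
Proof.
move=> de; apply: NNPP => h.
have : 'X * ('X^d - 'X^e) = 0 :> {poly k}.
  apply: closed_poly_vanish => a; rewrite hornerM hornerD hornerN !hornerXn hornerX.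
  have [->|a0] := eqVneq a 0; first by rewrite mul0r.
  have [->|n] := eqVneq (a ^+ d) (a ^+ e); first by rewrite subrr mulr0.
  by case: h; exists a.
move/eqP; rewrite mulf_eq0 polyX_eq0 subr_eq0 /= => /eqP/(congr1 (fun p : {poly k} => p`_d)).
rewrite !coefXn eqxx; case: eqP => // _ /eqP; by rewrite oner_eq0.
Qed.

(** Scaling by (a, a^-1) fixes the image under [segre], so only the difference of the two weights
    can be read off. Exponents on both sides avoid negative powers. *)
Lemma torus_weight (s t : nat) P :
  (forall (a : k) z, a != 0 -> good z -> a ^+ s * P.@[scale a a^-1 z] = a ^+ t * P.@[z]) ->
  forall m, m \in msupp P -> (s + wt true m = t + wt false m)%N.
Proof.
move=> h m hm; apply: NNPP => /exists_separating[a a0 /eqP]; apply.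
have := scaled_coef (fun z => h a z a0) m; rewrite mcoeff_msupp in hm.
move/(mulIf hm); rewrite exprVn mulrA -exprD => /(congr1 (fun u => u * a ^+ wt false m)).
by rewrite mulfVK ?expf_neq0 // -exprD.
Qed.

Lemma bihomogeneous_weight (s t p q : nat) P :
  (forall (a b : k) z, a != 0 -> b != 0 -> good z ->
     a ^+ s * b ^+ t * P.@[scale a b z] = a ^+ p * b ^+ q * P.@[z]) ->
  forall m, m \in msupp P -> (s + wt true m = p)%N /\ (t + wt false m = q)%N.
Proof.
move=> h m hm; rewrite mcoeff_msupp in hm.
have o0 : (1 : k) != 0 := oner_neq0 _.
split; apply: NNPP => /exists_separating[a a0 /eqP]; apply.
  have := scaled_coef (fun z => h a 1 z a0 o0) m; move/(mulIf hm).
  by rewrite !expr1n !mulr1 -exprD.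
have := scaled_coef (fun z => h 1 a z o0 a0) m; move/(mulIf hm).
by rewrite !expr1n !mul1r -exprD.
Qed.

Lemma wt_pos c m d : wt c m = d.+1 -> exists b, m (ix c b) != 0%N.
Proof.
rewrite /wt => h; case e : (m (ix c false)) => [|u]; last by exists false; rewrite e.
by exists true; move: h; rewrite e add0n => ->.
Qed.

Lemma wtD c m m' : wt c (m + m') = (wt c m + wt c m')%N.
Proof. by rewrite /wt !mnmDE addnACA. Qed.

Lemma wtU c c' b : wt c U_(ix c' b) = (c == c').
Proof. by rewrite /wt !mnm1E; case: c; case: c'; case: b. Qed.

Lemma linform_homog j : linform L j \is 1.-homog.
Proof.
rewrite /linform -lock; apply: rpred_sum => i _; apply: dhomogZ.
by rewrite dhomogX; apply/eqP/mdeg1.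
Qed.

Lemma ell_homog c b b' : ell c b b' \is 1.-homog. Proof. exact: linform_homog. Qed.

(** A balanced monomial is a product of pairs s_b u_b', each of them the pullback of a linear
    form. *)
Lemma monomial_descends d m : wt true m = d -> wt false m = d ->
  exists2 p, p \is d.-homog & pullback p = 'X_[m].
Proof.
elim: d m => [|d IH] m.
  move=> h1 h2; exists 1; first exact: dhomog1.
  rewrite pullback1; have -> : m = 0%MM; last by rewrite mpolyX0.
  apply/mnmP=> i; rewrite mnm0E -(ixK i); move: h1 h2; rewrite /wt => /eqP.
  rewrite addn_eq0 => /andP[/eqP e1 /eqP e2] /eqP; rewrite addn_eq0 => /andP[/eqP e3 /eqP e4].
  by case: (hb i); case: (lb i).
move=> h1 h2; have [b hb] := wt_pos h1; have [b' hb'] := wt_pos h2.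
have le : (U_(ix true b) + U_(ix false b') <= m)%MM.
  apply/mnm_lepP=> i; rewrite mnmDE !mnm1E.
  have [<-|n1] := eqVneq (ix true b) i.
    have /negPf -> : ix false b' != ix true b by case: (b); case: (b').
    by rewrite addn0 lt0n.
  by rewrite add0n; case: eqP => // <-; rewrite lt0n.
have e := submK le; set m' := (m - _)%MM in e.
have [||p hp ep] := IH m'.
- by apply: succn_inj; rewrite -h1 -e !wtD !wtU addn1.
- by apply: succn_inj; rewrite -h2 -e !wtD !wtU addn1.
exists (ell true b b' * p).
  by apply: (@dhomogM _ _ _ 1%N); first exact: ell_homog.
by rewrite pullbackM ep pullback_ell -e !mpolyXD mulrC.
Qed.

Lemma sum_supp_ind (K : S -> Prop) P : K 0 -> (forall p q, K p -> K q -> K (p + q)) ->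
  (forall a m, m \in msupp P -> K (a *: 'X_[m])) -> K P.
Proof.
move=> K0 KD KX; rewrite [P]mpolyE big_seq; elim/big_rec: _ => // m p hm; apply: KD.
exact: KX.
Qed.

Lemma descends_homog d P :
  (forall m, m \in msupp P -> wt true m = d /\ wt false m = d) ->
  exists2 p, p \is d.-homog & pullback p = P.
Proof.
move=> h; apply: (@sum_supp_ind (fun P => exists2 p, p \is d.-homog & pullback p = P)).
- by exists 0; rewrite ?pullback0 ?rpred0.
- move=> _ _ [p hp <-] [q hq <-]; exists (p + q); last by rewrite pullbackD.
  exact: rpredD.
move=> a m /h[h1 h2]; have [p hp ep] := monomial_descends h1 h2.
by exists (a *: p); [apply: dhomogZ|rewrite pullbackZ ep].
Qed.

(** Each monomial has one variable of the factor [c] in excess; once it is split off, the rest is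
    balanced and descends. *)
Lemma descends_weight1 c P :
  (forall m, m \in msupp P -> wt c m = (wt (~~ c) m).+1) ->
  exists p0 p1, P = 'X_(ix c false) * pullback p0 + 'X_(ix c true) * pullback p1.
Proof.
move=> h; apply: (@sum_supp_ind (fun P => exists p0 p1,
  P = 'X_(ix c false) * pullback p0 + 'X_(ix c true) * pullback p1)).
- by exists 0, 0; rewrite !pullback0 !mulr0 addr0.
- move=> _ _ [p0 [p1 ->]] [q0 [q1 ->]]; exists (p0 + q0), (p1 + q1).
  by rewrite !pullbackD; ring.
move=> a m /h hm; have [b hb] := wt_pos hm.
have le : (U_(ix c b) <= m)%MM by rewrite lep1mP.
have e := submK le; set m' := (m - _)%MM in e.
have hw : wt c m' = wt (~~ c) m'.
  apply/eqP; rewrite -(eqn_add2r 1); move: hm; rewrite -e !wtD !wtU eqxx => ->.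
  by case: (c) => //=; rewrite addn0 addn1.
have [|p _ ep] := @monomial_descends (wt true m') m' erefl; first by case: (c) hw.
exists (if b then 0 else a *: p), (if b then a *: p else 0).
rewrite -e mpolyXD; case: (b); rewrite pullback0 pullbackZ ep mulr0 ?addr0 ?add0r;
  by rewrite -scalerAr mulrC.
Qed.

Lemma prime_msize P : prime_elt P -> (1 < msize P)%N.
Proof.
move=> [P0 Pn _]; rewrite ltnNge; apply/negP=> /msize1_polyC e; case/negP: Pn.
rewrite e; apply/andP; rewrite mcoeffC eqxx mulr1 unitfE; split=> //.
by rewrite -(mpolyC_eq0 4) -e.
Qed.

(** By degree, ['X_i] is a constant times [P]. At the j-th unit vector ['X_i] vanishes and ['X_j]
    does not, so [P] cannot divide both. *)
Lemma prime_two_vars P (i j : 'I_4) : prime_elt P -> i != j ->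
  divides P 'X_i -> divides P 'X_j -> False.
Proof.
move=> hP ij [A eA] [B eB]; have [P0 _ _] := hP.
have A0 : A != 0 by apply: contra_eq_neq eA => ->; rewrite mulr0; apply: var_neq0.
have sP := prime_msize hP.
have sA : (msize A <= 1)%N.
  have := congr1 (fun Q : S => msize Q) eA; rewrite msizeX mdeg1 msizeM //.
  move=> e; rewrite -(leq_add2l 2); apply: leq_trans (_ : _ <= msize P + msize A)%N _.
    by rewrite leq_add2r.
  by rewrite -(prednK (_ : 0 < msize P + msize A)%N) -?e // addn_gt0 (ltn_trans _ sP).
have := congr1 (meval (fun l => (l == j)%:R)) eA; rewrite mevalXU (negPf ij) mevalM.
have := congr1 (meval (fun l => (l == j)%:R)) eB; rewrite mevalXU eqxx mevalM => e1 /esym/eqP.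
rewrite mulf_eq0 => /orP[/eqP e2|].
  by move/eqP: e1; rewrite e2 mul0r oner_eq0.
rewrite (msize1_polyC sA) mevalC; apply/negP; rewrite -(mpolyC_eq0 4) -msize1_polyC //.
Qed.

(** By the Nullstellensatz [P] divides h s_b u_b' for all b and b'. If it did not divide [h], it
    would divide two distinct variables. Here the codimension two of the excluded planes enters. *)
Lemma prime_nonvanishing P h : prime_elt P ->
  (forall z, good z -> h.@[z] != 0 -> P.@[z] != 0) -> divides P h.
Proof.
move=> hP H; apply: NNPP => nd.
have key b b' : divides P 'X_(ix true b) \/ divides P 'X_(ix false b').
  have : divides P (h * ('X_(ix true b) * 'X_(ix false b'))).
    apply: mpoly_nullstellensatz => // z hz; rewrite !mevalM !mevalXU.
    have [->|n0] := eqVneq h.@[z] 0; first by rewrite mul0r.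
    have [->|n1] := eqVneq (z (ix true b)) 0; first by rewrite mul0r mulr0.
    have [->|n2] := eqVneq (z (ix false b')) 0; first by rewrite !mulr0.
    have := H z _ n0; rewrite hz eqxx => H'; have // : false.
    by apply: H'; split; [exists b|exists b'].
  by case: hP => _ _ hp /hp[/nd//|/hp].
case: (key false false) => d1; case: (key true true) => d2;
  by apply: (prime_two_vars hP _ d1 d2).
Qed.

(* In lowest terms P / Q the prime factors of Q occur in every local
   denominator, so they vanish nowhere on D(h) and divide h. *)
Lemma local_fraction_global (h : S) (f : pt -> k) :
  (forall z, good z -> h.@[z] != 0 -> exists A B : S, B.@[z] != 0 /\
     forall z', good z' -> h.@[z'] != 0 -> B.@[z'] != 0 -> f z' = A.@[z'] / B.@[z']) ->
  exists P N, forall z, good z -> h.@[z] != 0 -> f z * h.@[z] ^+ N = P.@[z].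
Proof.
move=> loc.
case: (classic (exists z, good z /\ h.@[z] != 0)) => [[z0 [gz0 hz0]]|none]; last first.
  by exists 0, 0%N => z gz hz; case: none; exists z.
have nz (Q : S) z : Q.@[z] != 0 -> Q != 0 by apply: contraNneq => ->; rewrite meval0.
have h0 := nz _ _ hz0.
have [A0 [B0 [Bz0 loc0]]] := loc z0 gz0 hz0; have B00 := nz _ _ Bz0.
have [P [Q [Q0 ePQ red]]] := reduced_fraction (@mpoly_ufd k 4) B00 A0.
have cross z : good z -> h.@[z] != 0 -> exists A B : S,
    [/\ B.@[z] != 0, f z = A.@[z] / B.@[z] & A * Q = P * B].
  move=> gz hz; have [A [B [Bz hAB]]] := loc z gz hz; have B1 := nz _ _ Bz.
  exists A, B; split=> //; first exact: hAB.
  (* The two quotients agree on a nonempty principal open, so the cross products are equal as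
     polynomials. *)
  have E : A * B0 = A0 * B.
    apply/eqP; rewrite -subr_eq0; apply/eqP.
    apply: (@good_vanish_mul _ (h * B * B0)); first by rewrite !mulf_neq0.
    move=> z'; rewrite !mevalM mulf_eq0 negb_or => gz' /andP[].
    rewrite mulf_eq0 negb_or => /andP[n1 n2] n3.
    have := hAB z' gz' n1 n2; rewrite (loc0 z' gz' n1 n3) => e.
    apply/eqP; rewrite mevalB !mevalM subr_eq0 -eqr_div //; by rewrite e.
  apply: (mulIf B00); rewrite mulrAC E mulrAC ePQ; ring.
have primes_h p : prime_elt p -> divides p Q -> divides p h.
  move=> hp pQ; apply: prime_nonvanishing => // z gz hz.
  have [A [B [Bz _ e]]] := cross z gz hz.
  have : divides p (P * B) by rewrite -e; apply: divides_mull.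
  case: (hp) => _ _ hpp /hpp[/(red p hp pQ)//|[C eC]].
  by move: Bz; rewrite eC mevalM mulf_eq0 negb_or => /andP[].
have [nQ hQ] := mpoly_ufd Q0.
have [N [W eW]] := divides_power hQ primes_h.
exists (P * W), N => z gz hz; have [A [B [Bz -> e]]] := cross z gz hz.
have := congr1 (meval z) eW; rewrite rmorphXn mevalM => eh.
have Qz : Q.@[z] != 0.
  have : h.@[z] ^+ N != 0 by rewrite expf_neq0.
  by rewrite eh mulf_eq0 negb_or => /andP[].
have := congr1 (meval z) e; rewrite !mevalM => e'.
by rewrite eh; apply: (mulIf Bz); rewrite mulrAC mulfVK // mulrA e'; ring.
Qed.

End Segre.

(** * Relations between linear forms on the quadric *)

Section Variables4.
Variable k : closedFieldType.
Local Notation S := {mpoly k[4]}.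
Local Notation pt := ('I_4 -> k).
Implicit Types (p q r a b : S) (y : pt) (i j l m : 'I_4).

Lemma mpoly_ring_ind (K : S -> Prop) : (forall c, K c%:MP) -> (forall i, K 'X_i) ->
  (forall p q, K p -> K q -> K (p + q)) -> (forall p q, K p -> K q -> K (p * q)) ->
  forall p, K p.
Proof.
move=> KC KX KD KM; have Kexp p n : K p -> K (p ^+ n).
  by move=> Kp; elim: n => [|n IH]; [rewrite expr0; apply: (KC 1)|rewrite exprS; apply: KM].
elim/mpolyind=> [|c m p _ _ Kp]; first exact: (KC 0).
apply: (KD) => //; rewrite -mul_mpolyC; apply: (KM) => //; rewrite mpolyXE_id.
by elim/big_rec: _ => [|i q _ Kq]; [apply: (KC 1)|apply: KM => //; apply: Kexp].
Qed.

Definition zero_at i y : pt := fun j => if j == i then 0 else y j.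

(** Division by a variable, with the remainder described through its values only. *)
Lemma split_var i p : exists q r, p = 'X_i * q + r /\ forall y, r.@[y] = p.@[zero_at i y].
Proof.
elim/mpoly_ring_ind: p => [c|j|p p' [q [r [e h]]] [q' [r' [e' h']]]|p p' [q [r [e h]]] [q' [r' [e' h']]]].
- by exists 0, c%:MP; split=> [|y]; rewrite ?mulr0 ?add0r // !mevalC.
- have [->|n] := eqVneq j i.
    exists 1, 0; split=> [|y]; first by rewrite mulr1 addr0.
    by rewrite meval0 mevalXU /zero_at eqxx.
  exists 0, 'X_j; split=> [|y]; first by rewrite mulr0 add0r.
  by rewrite !mevalXU /zero_at (negPf n).
- exists (q + q'), (r + r'); split=> [|y]; last by rewrite !mevalD h h'.
  by rewrite e e'; ring.
exists (q * q' * 'X_i + q * r' + r * q'), (r * r'); split=> [|y].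
  by rewrite e e'; ring.
by rewrite !mevalM h h'.
Qed.

Lemma var_prime i : prime_elt ('X_i : S).
Proof.
split; first exact: var_neq0.
  by apply/negP=> /mpoly_unit_const[c _ /(congr1 (fun p => msize p))];
     rewrite msizeX mdeg1 msizeC; case: (c != 0).
move=> a b [c e].
have [q [r [ea ha]]] := split_var i a; have [q' [r' [eb hb]]] := split_var i b.
have : r * r' = 0.
  apply: mpoly_vanish => y; rewrite mevalM ha hb -mevalM e mevalM mevalXU.
  by rewrite /zero_at eqxx mul0r.
move/eqP; rewrite mulf_eq0 => /orP[]/eqP r0.
  by left; exists q; rewrite ea r0 addr0.
by right; exists q'; rewrite eb r0 addr0.
Qed.

Lemma var_koszul i j a b : i != j -> 'X_i * a + 'X_j * b = 0 ->
  exists c, a = 'X_j * c /\ b = - ('X_i * c).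
Proof.
move=> ij e; have [_ _ hp] := var_prime j.
have : divides 'X_j ('X_i * a).
  by exists (- b); rewrite mulrN; apply/eqP; rewrite -subr_eq0 opprK e.
case/hp=> [d|[c ec]].
  case: (@prime_two_vars k 'X_j i j) => //; first exact: var_prime.
  by exists 1; rewrite mulr1.
exists c; split=> //; apply: (mulfI (var_neq0 k j)).
by move/eqP: e; rewrite ec addrC addr_eq0 => /eqP ->; ring.
Qed.

(** Setting x_l = x_m = 0 leaves a Koszul relation of x_i and x_j; the quotients of the divisions
    supply the other terms. Taking l = m gives the statement modulo a single variable. *)
Lemma var_koszul_mod i j l m a b e e' : i != j -> i != l -> i != m -> j != l -> j != m ->
  'X_i * a + 'X_j * b = 'X_l * e + 'X_m * e' ->
  exists c a' a'' b' b'', a = 'X_j * c + 'X_l * a' + 'X_m * a'' /\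
     b = - ('X_i * c) + 'X_l * b' + 'X_m * b''.
Proof.
move=> ij il im jl jm E.
have [a1 [r1 [ea1 h1]]] := split_var l a; have [a2 [r2 [ea2 h2]]] := split_var m r1.
have [b1 [s1 [eb1 g1]]] := split_var l b; have [b2 [s2 [eb2 g2]]] := split_var m s1.
have [|c [ec1 ec2]] := @var_koszul i j r2 s2 ij.
  apply: mpoly_vanish => y; rewrite mevalD !mevalM !mevalXU h2 h1 g2 g1.
  have := congr1 (meval (zero_at l (zero_at m y))) E.
  rewrite !mevalD !mevalM !mevalXU /zero_at eqxx (negPf il) (negPf im) (negPf jl) (negPf jm).
  by rewrite eqxx => ->; case: ifP => _; ring.
exists c, a1, a2, b1, b2; split; first by rewrite ea1 ea2 ec1; ring.
by rewrite eb1 eb2 ec2; ring.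
Qed.

Local Notation x00 := (ix false false).
Local Notation x01 := (ix false true).
Local Notation x10 := (ix true false).
Local Notation x11 := (ix true true).

(* Eliminating 'X_x11 modulo the quadric after multiplication by a power of 'X_x00. *)
Lemma quadric_reduction p : exists N q r,
  'X_x00 ^+ N * p = ('X_x00 * 'X_x11 - 'X_x01 * 'X_x10) * q + r /\
  forall y y', (forall j, j != x11 -> y j = y' j) -> r.@[y] = r.@[y'].
Proof.
elim/mpoly_ring_ind: p =>
  [c|j|p p' [n [q [r [e h]]]] [n' [q' [r' [e' h']]]]|p p' [n [q [r [e h]]]] [n' [q' [r' [e' h']]]]].
- by exists 0%N, 0, c%:MP; split=> [|y y' _]; rewrite ?mulr0 ?add0r ?mul1r // !mevalC.
- have [->|n] := eqVneq j x11.
    exists 1%N, 1, ('X_x01 * 'X_x10); split=> [|y y' hy]; first by rewrite expr1; ring.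
    by rewrite !mevalM !mevalXU !hy.
  exists 0%N, 0, 'X_j; split=> [|y y' hy]; first by rewrite expr0; ring.
  by rewrite !mevalXU hy.
- exists (n + n')%N, ('X_x00 ^+ n' * q + 'X_x00 ^+ n * q'), ('X_x00 ^+ n' * r + 'X_x00 ^+ n * r').
  split=> [|y y' hy].
    rewrite exprD; transitivity ('X_x00 ^+ n' * ('X_x00 ^+ n * p) + 'X_x00 ^+ n * ('X_x00 ^+ n' * p')).
      ring.
    by rewrite e e'; ring.
  by rewrite !mevalD !mevalM !rmorphXn /= !mevalXU (h _ _ hy) (h' _ _ hy) hy.
exists (n + n')%N, ('X_x00 ^+ n * p * q' + q * r'), (r * r'); split=> [|y y' hy].
  rewrite exprD; transitivity (('X_x00 ^+ n * p) * ('X_x00 ^+ n' * p')); first ring.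
  by rewrite e'; rewrite mulrDr [X in _ + X = _]mulrC [X in _ + _ * X = _]e; ring.
by rewrite !mevalM (h _ _ hy) (h' _ _ hy).
Qed.

Lemma standard_quadric_ideal p :
  (forall y, y x00 * y x11 = y x01 * y x10 -> p.@[y] = 0) ->
  divides ('X_x00 * 'X_x11 - 'X_x01 * 'X_x10) p.
Proof.
move=> hp; have [n [q [r [e hr]]]] := quadric_reduction p.
have r0 : r = 0.
  suff /eqP : 'X_x00 * r = 0 by rewrite mulf_eq0 (negPf (var_neq0 _ _)) => /eqP.
  apply: mpoly_vanish => y; rewrite mevalM mevalXU.
  have [->|y0] := eqVneq (y x00) 0; first by rewrite mul0r.
  (* Where x00 is nonzero, the equation can be solved for x11, and the remainder does not notice
     this change of x11. *)
  pose y' : pt := fun j => if j == x11 then y x01 * y x10 / y x00 else y j.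
  have hy' : y' x00 * y' x11 = y' x01 * y' x10 by rewrite /y' /= mulrC divfK.
  have := congr1 (meval y') e.
  rewrite mevalM hp // mulr0 mevalD mevalM mevalB !mevalM !mevalXU hy' subrr mul0r add0r.
  rewrite (hr y y') => [<-|j /negPf nj]; first by rewrite mulr0.
  by rewrite /y' nj.
(* The powers of x00 cancel one at a time, since x00 is prime and does not divide the quadric. *)
rewrite r0 addr0 in e; elim: n q e => [|n IH] q e; first by exists q; rewrite -e mul1r.
have [_ _ hpr] := var_prime x00.
have : divides 'X_x00 (('X_x00 * 'X_x11 - 'X_x01 * 'X_x10) * q).
  by rewrite -e exprS -mulrA; exists ('X_x00 ^+ n * p).
case/hpr=> [[w ew]|[w ew]].
  have := congr1 (meval (fun j => (j != x00)%:R)) ew.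
  rewrite mevalB !mevalM !mevalXU /= mul0r mulr1 sub0r mul0r => /eqP.
  by rewrite oppr_eq0 oner_eq0.
apply: (IH w); apply: (mulfI (var_neq0 k x00)).
by rewrite mulrA -exprS e ew; ring.
Qed.

End Variables4.

(** * Linear changes of coordinates and syzygies *)

Section Coordinates.
Variables (k : closedFieldType) (L : 'M[k]_4).
Hypothesis LU : L \in unitmx.
Local Notation S := {mpoly k[4]}.
Local Notation pt := ('I_4 -> k).
Local Notation lf := (linform L).
Local Notation quad := (quadric L).
Local Notation ell := (ell L).
Local Notation pb := (pullback L).

(** [to_std] and [of_std] are inverse changes of variables exchanging the forms [lf j] with the
    variables, so that results on variables carry over. *)
Definition to_std (p : S) : S := p \mPo [tuple \sum_j invmx L j i *: 'X_j | i < 4].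
Definition of_std (p : S) : S := p \mPo [tuple lf j | j < 4].

Lemma of_std_eval p (x : pt) : (of_std p).@[x] = p.@[fun j => (lf j).@[x]].
Proof. by rewrite comp_mpoly_meval; apply: meval_eq => i; rewrite tnth_mktuple. Qed.

Lemma to_std_eval p (y : pt) : (to_std p).@[y] = p.@[fun i => \sum_j invmx L j i * y j].
Proof.
rewrite comp_mpoly_meval; apply: meval_eq => i; rewrite tnth_mktuple raddf_sum /=.
by apply: eq_bigr => j _; rewrite mevalZ mevalXU.
Qed.

Lemma linform_coordinates (y : pt) j : (lf j).@[fun i => \sum_l invmx L l i * y l] = y j.
Proof.
pose r := \row_j y j.
have -> : (lf j).@[fun i => \sum_l invmx L l i * y l] = (r *m invmx L *m L) 0 j.
  rewrite linform_eval [RHS]mxE; apply: eq_bigr => i _; rewrite mulrC mxE; congr (_ * _).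
  by apply: eq_bigr => l _; rewrite mxE mulrC.
by rewrite mulmxKV // mxE.
Qed.

Lemma to_stdK p : of_std (to_std p) = p.
Proof.
apply/eqP; rewrite -subr_eq0; apply/eqP/mpoly_vanish => x; apply/eqP.
rewrite mevalB subr_eq0 of_std_eval to_std_eval; apply/eqP; congr (meval _ p).
by apply: (linform_inj LU) => j; rewrite linform_coordinates.
Qed.

Lemma of_stdK p : to_std (of_std p) = p.
Proof.
apply/eqP; rewrite -subr_eq0; apply/eqP/mpoly_vanish => x; apply/eqP.
rewrite mevalB subr_eq0 to_std_eval of_std_eval; apply/eqP; apply: meval_eq => j.
exact: linform_coordinates.
Qed.

Lemma of_stdX j : of_std 'X_j = lf j.
Proof.
by apply/eqP; rewrite -subr_eq0; apply/eqP/mpoly_vanish => x; rewrite mevalB of_std_eval mevalXU subrr.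
Qed.

Lemma to_std_linform j : to_std (lf j) = 'X_j.
Proof. by rewrite -of_stdX of_stdK. Qed.

Lemma to_stdD p q : to_std (p + q) = to_std p + to_std q. Proof. exact: raddfD. Qed.
Lemma to_stdM p q : to_std (p * q) = to_std p * to_std q. Proof. exact: rmorphM. Qed.
Lemma to_std0 : to_std 0 = 0. Proof. exact: raddf0. Qed.
Lemma of_stdD p q : of_std (p + q) = of_std p + of_std q. Proof. exact: raddfD. Qed.
Lemma of_stdN p : of_std (- p) = - of_std p. Proof. exact: raddfN. Qed.
Lemma of_stdM p q : of_std (p * q) = of_std p * of_std q. Proof. exact: rmorphM. Qed.

Lemma linform_koszul i j a b : i != j -> lf i * a + lf j * b = 0 ->
  exists c, a = lf j * c /\ b = - (lf i * c).
Proof.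
move=> ij /(congr1 to_std); rewrite to_stdD !to_stdM !to_std_linform to_std0.
case/(var_koszul ij)=> c [e1 e2]; exists (of_std c); split.
  by rewrite -[a]to_stdK e1 of_stdM of_stdX.
by rewrite -[b]to_stdK e2 of_stdN of_stdM of_stdX.
Qed.

Lemma linform_koszul_mod i j l m a b e e' : i != j -> i != l -> i != m -> j != l -> j != m ->
  lf i * a + lf j * b = lf l * e + lf m * e' ->
  exists c a' a'' b' b'', a = lf j * c + lf l * a' + lf m * a'' /\
     b = - (lf i * c) + lf l * b' + lf m * b''.
Proof.
move=> ij il im jl jm /(congr1 to_std); rewrite !to_stdD !to_stdM !to_std_linform.
case/(var_koszul_mod ij il im jl jm)=> c [a' [a'' [b' [b'' [e1 e2]]]]].
exists (of_std c), (of_std a'), (of_std a''), (of_std b'), (of_std b''); split.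
  by rewrite -[a]to_stdK e1 !of_stdD !of_stdM !of_stdX.
by rewrite -[b]to_stdK e2 !of_stdD of_stdN !of_stdM !of_stdX.
Qed.

Lemma ell_index_eq c b b' d d' : ((if c then ix b b' else ix b' b) == (if c then ix d d' else ix d' d))
  = ((b, b') == (d, d')).
Proof. by case: c; case: b; case: b'; case: d; case: d'. Qed.

Lemma ell_koszul_mod c (i j l m : bool * bool) a b e e' :
  i != j -> i != l -> i != m -> j != l -> j != m ->
  ell c i.1 i.2 * a + ell c j.1 j.2 * b = ell c l.1 l.2 * e + ell c m.1 m.2 * e' ->
  exists t a' a'' b' b'', a = ell c j.1 j.2 * t + ell c l.1 l.2 * a' + ell c m.1 m.2 * a'' /\
     b = - (ell c i.1 i.2 * t) + ell c l.1 l.2 * b' + ell c m.1 m.2 * b''.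
Proof.
move: i j l m => [i1 i2] [j1 j2] [l1 l2] [m1 m2].
rewrite -!(ell_index_eq c) => ij il im jl jm; exact: linform_koszul_mod.
Qed.

Lemma pullback_kernel p : pb p = 0 -> divides quad p.
Proof.
move=> hp; have : divides ('X_(ix false false) * 'X_(ix true true)
     - 'X_(ix false true) * 'X_(ix true false)) (to_std p).
  apply: standard_quadric_ideal => y hy; rewrite to_std_eval.
  set x := fun i => _.
  have hx : quad.@[x] = 0 by rewrite mevalB !mevalM !linform_coordinates hy subrr.
  (* The vector may be the vertex of the cone, which comes from no good vector but is the image of
     0. *)
  case: (classic (exists j, x j != 0)) => [xn|x0].
    have [z gz ->] := segre_onto LU (conj xn hx).
    by rewrite -pullback_eval hp meval0.
  have -> : x = segre L (fun=> 0).
    apply: functional_extensionality => i; rewrite /segre big1 => [|j _]; last by rewrite !mulr0.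
    by apply/eqP; apply: contraT => xi; case: x0; exists i.
  by rewrite -pullback_eval hp meval0.
case=> c /(congr1 of_std); rewrite to_stdK => ->; exists (of_std c).
by rewrite of_stdM of_stdD of_stdN !of_stdM !of_stdX.
Qed.

(* The columns of the matrix [[ell c 1 0, ell c 1 1], [-ell c 0 0, -ell c 0 1]]
   generate the relations between the two coordinates of the factor c. *)
Lemma factor_syzygy c p0 p1 :
  'X_(ix c false) * pb p0 + 'X_(ix c true) * pb p1 = 0 ->
  exists w0 w1, p0 = ell c true false * w0 + ell c true true * w1 /\
    p1 = - (ell c false false * w0) - ell c false true * w1.
Proof.
(* The relation itself does not descend; multiplied by a coordinate of the other factor it is the
   pullback of a polynomial that vanishes on the quadric. *)
move=> h; have [r er] : divides quad (ell c false false * p0 + ell c true false * p1).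
  apply: pullback_kernel; rewrite pullbackD !pullbackM !pullback_ell //.
  transitivity ('X_(ix (~~ c) false) *
    ('X_(ix c false) * pb p0 + 'X_(ix c true) * pb p1)); last by rewrite h mulr0.
  ring.
have ne : (if c then ix false false else ix false false) != (if c then ix true false else ix false true).
  by case: (c).
(* Expanding the quadric as a determinant absorbs [r] and leaves a Koszul relation. *)
have [|w [e0 e1]] := @linform_koszul _ _ (p0 - ell c true true * r) (p1 + ell c false true * r) ne.
  rewrite -[lf _]/(ell c false false) -[lf (if c then ix true _ else _)]/(ell c true false).
  transitivity (quad * r - quad * r); last by rewrite subrr.
  by rewrite -{1}er (quadricE L c); ring.
exists w, r; split.
  by apply/eqP; rewrite -subr_eq e0.
by rewrite -[p1](addrK (ell c false true * r)) e1.
Qed.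

Lemma syzygy_factor c w0 w1 :
  'X_(ix c false) * pb (ell c true false * w0 + ell c true true * w1) +
  'X_(ix c true) * pb (- (ell c false false * w0) - ell c false true * w1) = 0.
Proof.
rewrite !pullbackD !pullbackN !pullbackM !pullback_ell //; ring.
Qed.

End Coordinates.

(** * The bundle O(1,0)^a + O(0,1)^b *)

Section RegularFunctions.
Variables (k : closedFieldType) (n : nat) (X : ('I_n.+1 -> k) -> Prop).

Lemma regular_quotient (m : int) (h p q : {mpoly k[n.+1]}) (f : ('I_n.+1 -> k) -> k) (d e : nat) :
  p \is d.-homog -> q \is e.-homog -> d%:Z = e%:Z + m ->
  (forall x, on X h x -> q.@[x] != 0) ->
  (forall x, on X h x -> f x = p.@[x] / q.@[x]) -> regular_on X m h f.
Proof.
move=> hp hq hd q0 hf x hx; exists d, e, p, q; split=> //; first exact: q0.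
by move=> y hy _; apply: hf.
Qed.

Lemma regular_zero (d : nat) (h : {mpoly k[n.+1]}) (f : ('I_n.+1 -> k) -> k) :
  (forall x, on X h x -> f x = 0) -> regular_on X d%:Z h f.
Proof.
move=> hf; apply: (@regular_quotient _ _ 0 1 _ d 0); rewrite ?dhomog0 ?dhomog1 ?add0r //.
  by move=> x _; rewrite meval1 oner_neq0.
by move=> x hx; rewrite hf // meval0 mul0r.
Qed.

End RegularFunctions.

Lemma meval_sum (k : closedFieldType) n (x : 'I_n -> k) (I : Type) (r : seq I)
    (G : I -> {mpoly k[n]}) : (\sum_(i <- r) G i).@[x] = \sum_(i <- r) (G i).@[x].
Proof. exact: raddf_sum. Qed.

Lemma total_add (k : fieldType) (T : Type) (W : lmodType k) (G : int -> (T -> W) -> Prop) f g :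
  Defs.total G f -> Defs.total G g -> Defs.total G (fun t => f t + g t).
Proof.
move=> [m [d [u [hu eu]]]] [m' [d' [u' [hu' eu']]]].
exists (m + m')%N, (fun j => match split j with inl i => d i | inr i => d' i end),
  (fun j => match split j with inl i => u i | inr i => u' i end); split.
  by move=> j; case: split.
move=> t; rewrite big_split_ord /= eu eu'; congr (_ + _); apply: eq_bigr => i _.
  by rewrite (unsplitK (inl i)).
by rewrite (unsplitK (inr i)).
Qed.

Lemma total_ext (k : fieldType) (T : Type) (W : lmodType k) (G : int -> (T -> W) -> Prop) f g :
  f =1 g -> Defs.total G f -> Defs.total G g.
Proof.
by move=> e [m [d [u [hu eu]]]]; exists m, d, u; split=> // t; rewrite -e.
Qed.

Lemma total0 (k : fieldType) (T : Type) (W : lmodType k) (G : int -> (T -> W) -> Prop) :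
  Defs.total G (fun=> 0).
Proof.
exists 0%N, (fun=> 0), (fun _ _ => 0); split; first by case.
by move=> t; rewrite big_ord0.
Qed.

Lemma total_homog (k : fieldType) (T : Type) (W : lmodType k) (G : int -> (T -> W) -> Prop) d f :
  G d f -> Defs.total G f.
Proof.
move=> h; exists 1%N, (fun=> d), (fun=> f); split=> // t; by rewrite big_ord1.
Qed.

Lemma total_sum (k : fieldType) (T : Type) (W : lmodType k) (G : int -> (T -> W) -> Prop)
    (I : Type) (r : seq I) (f : I -> T -> W) :
  (forall i, Defs.total G (f i)) -> Defs.total G (fun t => \sum_(i <- r) f i t).
Proof.
move=> h; elim: r => [|i r IH]; first by apply: total_ext (total0 G) => t; rewrite big_nil.
by apply: total_ext (total_add (h i) IH) => t; rewrite big_cons.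
Qed.

Lemma krull_dim_ext (k : fieldType) n (J J' : {mpoly k[n]} -> Prop) d :
  (forall p, J p <-> J' p) -> krull_dim J d -> krull_dim J' d.
Proof.
move=> e [[P [h1 h2 h3]] h]; split.
  by exists P; split=> // p /e; apply: h2.
by move=> [Q [q1 q2 q3]]; apply: h; exists Q; split=> // p /e; apply: q2.
Qed.

Section SplitBundle.
Variables (k : closedFieldType) (L : 'M[k]_4).
Hypothesis LU : L \in unitmx.
Local Notation S := {mpoly k[4]}.
Local Notation pt := ('I_4 -> k).
Local Notation lf := (linform L).
Local Notation quad := (quadric L).
Local Notation ell := (ell L).
Local Notation pb := (pullback L).
Local Notation segre := (segre L).
Local Notation X := (hypersurface quad).
Implicit Types (c b : bool) (i j : 'I_4) (x z : pt) (p q : S).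

(** On the chart D(lf i) the coordinate number [bit c i] of the factor [c] is nonzero, for both
    factors. *)
Definition bit c i := if c then hb i else lb i.

Lemma linform_bit c i : lf i = ell c (bit c i) (bit (~~ c) i).
Proof. by rewrite linform_hl; case: c. Qed.

Lemma linform_segre_bit c i z : (lf i).@[segre z] = z (ix c (bit c i)) * z (ix (~~ c) (bit (~~ c) i)).
Proof. by rewrite (linform_bit c) ell_segre. Qed.

Lemma on_chart i x : on X (lf i) x <-> quad.@[x] = 0 /\ (lf i).@[x] != 0.
Proof.
split=> [[[_ h] h']//|[h h']]; split=> //; split=> //.
by move: h'; rewrite linform_hl; apply: ell_nonzero.
Qed.

Lemma on_chart_segre i x : on X (lf i) x -> exists z, [/\ good z, x = segre z,
  forall c, z (ix c (bit c i)) != 0 & (lf i).@[x] != 0].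
Proof.
move=> [hx h]; have [z gz e] := segre_onto LU hx; exists z; split=> // c.
by move: h; rewrite e (linform_segre_bit c) mulf_eq0 negb_or => /andP[].
Qed.

Lemma good_chart z : good z -> exists i, (lf i).@[segre z] != 0 /\ on X (lf i) (segre z).
Proof.
move=> gz; have [b [b' [h1 h2]]] := goodP true gz; exists (ix b b').
have h : (lf (ix b b')).@[segre z] != 0.
  by rewrite (linform_segre_bit true) /bit /= hb_ix lb_ix mulf_neq0.
by split=> //; split=> //; apply: segre_on.
Qed.

(* Transition functions of the pullback of O(1) from the factor c. *)
Definition factor_trans c i j x : k := (ell c (bit c j) (bit (~~ c) i)).@[x] / (lf i).@[x].

Lemma factor_trans_segre c i j z : (lf i).@[segre z] != 0 ->
  factor_trans c i j (segre z) = z (ix c (bit c j)) / z (ix c (bit c i)).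
Proof.
rewrite /factor_trans (linform_segre_bit c i) ell_segre // mulf_eq0 negb_or => /andP[h1 h2].
by field; rewrite h1 h2.
Qed.

Lemma factor_trans_regular c i j h : (forall x, on X h x -> (lf i).@[x] != 0) ->
  regular_on X 0 h (factor_trans c i j).
Proof.
move=> hh; apply: (@regular_quotient _ _ _ _ _ (ell c (bit c j) (bit (~~ c) i)) (lf i) _ 1 1) => //.
- exact: ell_homog.
- exact: linform_homog.
Qed.

(* Sections of that line bundle, twisted by O_X(m). *)
Definition factor_section c (m : int) (s : 'I_4 * pt -> k) : Prop :=
  [/\ forall i, regular_on X m (lf i) (fun x => s (i, x)),
      forall i j x, on X (lf i * lf j) x -> s (i, x) = factor_trans c i j x * s (j, x) &
      forall i x, ~ on X (lf i) x -> s (i, x) = 0].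

(** The coordinate s_b of the factor [c] as a section: s_b / s_i on the chart i. The test and the
    convention x / 0 = 0 make it 0 off the chart. *)
Definition coord_section c b (t : 'I_4 * pt) : k :=
  if quad.@[t.2] == 0 then (ell c b (bit (~~ c) t.1)).@[t.2] / (lf t.1).@[t.2] else 0.

Lemma coord_section_segre c b i z : good z -> (lf i).@[segre z] != 0 ->
  coord_section c b (i, segre z) = z (ix c b) / z (ix c (bit c i)).
Proof.
move=> gz h; have [_ q0] := segre_on LU gz.
rewrite /coord_section /= q0 eqxx ell_segre //.
move: h; rewrite (linform_segre_bit c) mulf_eq0 negb_or => /andP[h1 h2].
by field; rewrite h1 h2.
Qed.

Lemma coord_section_off c b i x : ~ on X (lf i) x -> coord_section c b (i, x) = 0.
Proof.
move=> h; rewrite /coord_section /=; case: eqP => // hq.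
have [->|n] := eqVneq (lf i).@[x] 0; first by rewrite invr0 mulr0.
by case: h; apply/on_chart.
Qed.

Lemma on_mul h1 h2 x : on X (h1 * h2) x <-> on X h1 x /\ on X h2 x.
Proof.
rewrite /on mevalM mulf_eq0 negb_or; split=> [[hx /andP[a b]]|[[hx a] [_ b]]] //.
by rewrite a b.
Qed.

(** Multiplied by the nonvanishing coordinate of the factor [c] on its chart, the local components
    of the section agree and define a function [f] on good vectors. It is a polynomial, and its
    weight in the factor [c] exceeds the other by one, so it is a combination of the two coordinates
    with coefficients from P^3. *)
Lemma factor_section_poly c m s : factor_section c m s -> exists p0 p1, forall t,
  s t = p0.@[t.2] * coord_section c false t + p1.@[t.2] * coord_section c true t.
Proof.
move=> [sreg strans soff].
pose f z := if [pick i | (lf i).@[segre z] != 0] is Some i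
  then z (ix c (bit c i)) * s (i, segre z) else 0.
have fE z i : good z -> (lf i).@[segre z] != 0 -> f z = z (ix c (bit c i)) * s (i, segre z).
  move=> gz hi; rewrite /f; case: pickP => [j hj|/(_ i)]; last by rewrite hi.
  rewrite (strans i j) ?factor_trans_segre //; last first.
    by split; [apply: segre_on|rewrite mevalM mulf_neq0].
  move: hi; rewrite (linform_segre_bit c) mulf_eq0 negb_or => /andP[h1 h2].
  by field.
(* The open set is everything, h = 1, so no denominator survives. *)
have [P [N hP]] : exists P N, forall z, good z -> (1 : S).@[z] != 0 -> f z * (1 : S).@[z] ^+ N = P.@[z].
  apply: local_fraction_global => z gz _; have [i [hi oi]] := good_chart gz.
  have [d [e [p [q [_ _ _ qz hpq]]]]] := sreg i _ oi.
  (* The common factor [pb (lf i)] forces every vector at which the denominator is nonzero into the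
     chart i. *)
  exists ('X_(ix c (bit c i)) * pb p * pb (lf i)), (pb q * pb (lf i)).
  rewrite mevalM !pullback_eval // mulf_neq0 //; split=> // z' gz' _.
  rewrite [in X in X -> _]mevalM !pullback_eval // mulf_eq0 negb_or => /andP[qz' hi'].
  have o' : on X (lf i) (segre z') by split=> //; apply: segre_on.
  rewrite (fE z' i gz' hi') (hpq _ o' qz') !mevalM !pullback_eval mevalXU.
  by field; rewrite qz' hi'.
have {hP} fP z : good z -> f z = P.@[z].
  by move=> gz; rewrite -hP ?meval1 ?oner_neq0 // expr1n mulr1.
have fscale (a : k) z : a != 0 -> good z ->
    f (scale a a^-1 z) = (if c then a else a^-1) * f z.
  move=> a0 gz; have [i [hi _]] := good_chart gz.
  have es : segre (scale a a^-1 z) = segre z.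
    by rewrite segre_scale; apply: functional_extensionality => l; rewrite divff // mul1r.
  rewrite !(fE _ i) ?es //; last by apply: good_scale; rewrite ?invr_eq0.
  by rewrite /scale hb_ix mulrA.
have [p0 [p1 eP]] : exists p0 p1, P = 'X_(ix c false) * pb p0 + 'X_(ix c true) * pb p1.
  apply: (descends_weight1 LU) => mu hm; case: (c) fscale => /= fs.
    have := @torus_weight k 0 1 P; move/(_ _ mu hm); rewrite add0n add1n; apply.
    move=> a z a0 gz; rewrite expr0 mul1r expr1 -!fP ?fs //.
    by apply: good_scale; rewrite ?invr_eq0.
  have := @torus_weight k 1 0 P; move/(_ _ mu hm); rewrite add0n add1n => -> //.
  move=> a z a0 gz; rewrite expr0 mul1r expr1 -!fP ?fs ?mulVKf //.
  by apply: good_scale; rewrite ?invr_eq0.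
exists p0, p1 => -[i x] /=; case: (classic (on X (lf i) x)) => [o|no]; last first.
  by rewrite soff // !coord_section_off // !mulr0 addr0.
have [z [gz e zi hi]] := on_chart_segre o; rewrite e in hi *.
rewrite !coord_section_segre //; have := fP z gz.
rewrite (fE z i) // eP mevalD !mevalM !mevalXU !pullback_eval // => h.
apply: (mulfI (zi c)); rewrite h; field; exact: zi.
Qed.

Lemma poly_factor_section c b p (d : nat) : p \is d.-homog ->
  factor_section c d%:Z (fun t => p.@[t.2] * coord_section c b t).
Proof.
move=> hp; split.
- move=> i; apply: (@regular_quotient _ _ _ _ _ (p * ell c b (bit (~~ c) i)) (lf i) _ (d + 1) 1).
  + by apply: dhomogM => //; apply: ell_homog.
  + exact: linform_homog.
  + by rewrite PoszD addrC.
  + by move=> x [].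
  by move=> x [[_ qx] _]; rewrite /coord_section /= qx eqxx mevalM mulrA.
- move=> i j x /on_mul[o1 o2] /=; have [z [gz e zi hi]] := on_chart_segre o1.
  have hj : (lf j).@[segre z] != 0 by case: o2; rewrite e.
  rewrite e in hi *; rewrite !coord_section_segre // factor_trans_segre //.
  have zj : z (ix c (bit c j)) != 0.
    by move: hj; rewrite (linform_segre_bit c) mulf_eq0 negb_or => /andP[].
  by field; rewrite zj zi.
by move=> i x no /=; rewrite coord_section_off // mulr0.
Qed.

(** The section v.1 s_0 + v.2 s_1 in the coordinates of the factor [c]. [pair_poly] is the same
    section as a polynomial, where equality of sections is decided. *)
Definition pair_eval c (v : S * S) (t : 'I_4 * pt) : k :=
  v.1.@[t.2] * coord_section c false t + v.2.@[t.2] * coord_section c true t.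

Definition pair_poly c (v : S * S) : S :=
  'X_(ix c false) * pb v.1 + 'X_(ix c true) * pb v.2.

Lemma pair_eval_segre c v i z : good z -> (lf i).@[segre z] != 0 ->
  pair_eval c v (i, segre z) = (pair_poly c v).@[z] / z (ix c (bit c i)).
Proof.
move=> gz hi; rewrite /pair_eval !(coord_section_segre _ _ gz hi) /pair_poly mevalD !mevalM.
by rewrite !mevalXU !pullback_eval /=; ring.
Qed.

Lemma pair_eval_off c v i x : ~ on X (lf i) x -> pair_eval c v (i, x) = 0.
Proof. by move=> no; rewrite /pair_eval !coord_section_off // !mulr0 addr0. Qed.

Lemma pair_relation c v N (s : 'I_N -> S) (W : 'I_N -> S * S) :
  (forall t, pair_eval c v t = \sum_(j < N) (s j).@[t.2] * pair_eval c (W j) t) <->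
  pair_poly c v = \sum_(j < N) pb (s j) * pair_poly c (W j).
Proof.
split=> h.
  apply/eqP; rewrite -subr_eq0; apply/eqP/good_vanish => z gz.
  have [i [hi _]] := good_chart gz; have := h (i, segre z).
  rewrite pair_eval_segre // (eq_bigr (fun j : 'I_N => (pb (s j) * pair_poly c (W j)).@[z] / z (ix c (bit c i)))).
    rewrite -big_distrl /= mevalB meval_sum.
    have zi : z (ix c (bit c i)) != 0.
      by move: hi; rewrite (linform_segre_bit c) mulf_eq0 negb_or => /andP[].
    have zi' : (z (ix c (bit c i)))^-1 != 0 by rewrite invr_eq0.
    by move/(mulIf zi') => e; apply/eqP; rewrite subr_eq0; apply/eqP.
  by move=> j _; rewrite pair_eval_segre // mevalM pullback_eval // mulrA.
move=> [i x]; case: (classic (on X (lf i) x)) => [o|no]; last first.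
  by rewrite pair_eval_off // big1 // => j _; rewrite pair_eval_off // mulr0.
have [z [gz -> zi hi]] := on_chart_segre o; case: o => _ hi'.
rewrite pair_eval_segre // h meval_sum big_distrl; apply: eq_bigr => j _.
by rewrite pair_eval_segre //= mevalM pullback_eval // mulrA.
Qed.

Variables (r : nat) (side : 'I_r -> bool).

Definition split_trans i j x : 'M[k]_r := diag_mx (\row_a factor_trans (side a) i j x).

Definition split_data : bundle_data k 3 := @BundleData k 3 r 4 lf split_trans.

Lemma split_cover : open_cover X (@chart _ _ split_data).
Proof.
split=> [i|x hx]; first by exists 1%N; apply: linform_homog.
have [z gz ->] := segre_onto LU hx; have [i [hi _]] := good_chart gz; by exists i.
Qed.

Lemma split_regular (i j : 'I_(ncharts split_data)) :
  regular_mx_on X (chart i * chart j) (trans i j).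
Proof.
move=> a b; have [->|n] := eqVneq a b.
  have -> : (fun x => @trans _ _ split_data i j x b b) = factor_trans (side b) i j.
    by apply: functional_extensionality => x; rewrite !mxE eqxx mulr1n.
  by apply: factor_trans_regular => x /on_mul[[]].
by apply: regular_zero => x _; rewrite !mxE (negPf n) mulr0n.
Qed.

Lemma split_id (i : 'I_(ncharts split_data)) x : on X (chart i) x -> trans i i x = 1%:M.
Proof.
move=> o; have [z [gz e zi hi]] := on_chart_segre o.
apply/matrixP=> a b; rewrite !mxE; case: eqP => [->|//]; rewrite !mulr1n.
by rewrite /factor_trans -linform_bit divff.
Qed.

Lemma split_cocycle (i j l : 'I_(ncharts split_data)) x :
  on X (chart i * chart j * chart l) x -> trans i j x *m trans j l x = trans i l x.
Proof.
move=> /on_mul[/on_mul[o1 o2] o3]; have [z [gz e zi hi]] := on_chart_segre o1.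
rewrite /= /split_trans mulmx_diag; congr diag_mx; apply/rowP=> a; rewrite !mxE.
have hj : (lf j).@[segre z] != 0 by case: o2; rewrite e.
rewrite e in hi *; rewrite !factor_trans_segre //.
have zj : z (ix (side a) (bit (side a) j)) != 0.
  by move: hj; rewrite (linform_segre_bit (side a)) mulf_eq0 negb_or => /andP[].
by field; rewrite zj zi.
Qed.

Definition split_bundle : vector_bundle X :=
  @VectorBundle k 3 X split_data split_cover split_regular split_id split_cocycle.

Local Notation E := split_bundle.
Local Notation T := ('I_4 * pt)%type.

Lemma twisted_componentwise m (s : T -> 'cV[k]_r) :
  @twisted_sections k 3 X E m s <-> forall a, factor_section (side a) m (fun t => s t a 0).
Proof.
split=> [[h1 h2 h3] a|h].
  split=> [i|i j x o|i x no]; first exact: h1.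
    have := h2 i j x o; rewrite /= => ->; by rewrite mul_diag_mx !mxE.
  by have := h3 i x no => ->; rewrite mxE.
split=> [i a|i j x o|i x no]; first by case: (h a) => h1 _ _; apply: h1.
  apply/colP=> a; rewrite /= mul_diag_mx !mxE; case: (h a) => _ h2 _; exact: h2.
by apply/colP=> a; rewrite mxE; case: (h a) => _ _; apply.
Qed.

Lemma Gamma_componentwise (f : T -> 'cV[k]_r) :
  @Gamma_star k 3 X E f <-> exists v : 'I_r -> S * S, forall t a, f t a 0 = pair_eval (side a) (v a) t.
Proof.
split.
  move=> [N [d [g [hg ef]]]].
  have [v hv] : exists v : 'I_r -> S * S, forall a, forall t, f t a 0 = pair_eval (side a) (v a) t.
    suff H a : exists v, forall t, f t a 0 = pair_eval (side a) v t by exact: (fin_all_exists H).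
    have [w hw] : exists w : 'I_N -> S * S, forall (j : 'I_N), forall t, g j t a 0 = pair_eval (side a) (w j) t.
      suff H (j : 'I_N) : exists w, forall t, g j t a 0 = pair_eval (side a) w t by exact: (fin_all_exists H).
      have /twisted_componentwise/(_ a) := hg j.
      by case/factor_section_poly=> p0 [p1 h]; exists (p0, p1).
    exists (\sum_j (w j).1, \sum_j (w j).2) => t; rewrite ef summxE /pair_eval /= !raddf_sum /=.
    by rewrite !big_distrl -big_split; apply: eq_bigr => j _; rewrite hw.
  by exists v => t a; apply: hv.
move=> [v hv].
pose g a b (t : T) : 'cV[k]_r := ((if b then (v a).2 else (v a).1).@[t.2] * coord_section (side a) b t) *: delta_mx a 0.
have hg a b : @Gamma_star k 3 X E (g a b).
  pose p := if b then (v a).2 else (v a).1.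
  (* The coefficient is an arbitrary polynomial while [total] asks for sections of single twists, so
     it is split into monomials. *)
  apply: (@total_ext _ _ _ _ (fun t => \sum_(m <- msupp p)
     (((p@_m *: 'X_[m] : S).@[t.2] * coord_section (side a) b t) *: delta_mx a 0 : 'cV[k]_r))).
    move=> t; rewrite /g -/p [in RHS](mpolyE p) raddf_sum /= big_distrl scaler_suml.
    by apply: eq_bigr.
  apply: total_sum => m; apply: (@total_homog _ _ _ _ (mdeg m)%:Z).
  apply/twisted_componentwise=> a'.
  have hm : (p@_m *: 'X_[m] : S) \is (mdeg m).-homog by apply: dhomogZ; rewrite dhomogX.
  have [->|n] := eqVneq a' a.
    have -> : (fun t : T => (((p@_m *: 'X_[m] : S).@[t.2] * coord_section (side a) b t) *:
        delta_mx a 0 : 'cV[k]_r) a 0) = fun t => (p@_m *: 'X_[m] : S).@[t.2] * coord_section (side a) b t.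
      by apply: functional_extensionality => t; rewrite !mxE !eqxx mulr1.
    exact: poly_factor_section.
  split=> [i|i j x _|i x _]; rewrite ?mxE ?(negPf n) /= ?mulr0 //.
  by apply: regular_zero => x _; rewrite !mxE (negPf n) mulr0.
apply: (@total_ext _ _ _ _ (fun t => \sum_a (g a false t + g a true t))).
  move=> t; apply/colP=> a; rewrite summxE hv (bigD1 a) //= big1 ?addr0 => [|a' n].
    by rewrite !mxE !eqxx !mulr1.
  by rewrite !mxE eq_sym (negPf n) !mulr0 addr0.
by apply: total_sum => a; apply: total_add; apply: hg.
Qed.

Lemma pair_sections (v : 'I_r -> S * S) :
  @Gamma_star k 3 X E (fun t => \col_a pair_eval (side a) (v a) t).
Proof. by apply/Gamma_componentwise; exists v => t a; rewrite mxE. Qed.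

End SplitBundle.

(** * The dimension of the cone over the quadric *)

Section QuadricDimension.
Variables (k : closedFieldType) (L : 'M[k]_4).
Hypothesis LU : L \in unitmx.
Local Notation S := {mpoly k[4]}.
Local Notation pt := ('I_4 -> k).
Local Notation lf := (linform L).
Local Notation quad := (quadric L).
Local Notation pb := (pullback L).
Local Notation segre := (segre L).
Local Notation X := (hypersurface quad).

Lemma vanishing_pullback p : vanishing_ideal X p <-> pb p = 0.
Proof.
split=> [h|h x hx]; last first.
  by have [z gz ->] := segre_onto LU hx; rewrite -pullback_eval h meval0.
by apply: good_vanish => z gz; rewrite pullback_eval; apply: h; apply: segre_on.
Qed.

Definition coord_subspace (keep : pred 'I_4) (y : pt) : pt :=
  fun i => \sum_j invmx L j i * (if keep j then y j else 0).

Lemma linform_coord_subspace keep y j :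
  (lf j).@[coord_subspace keep y] = if keep j then y j else 0.
Proof. exact: (linform_coordinates LU (fun j => if keep j then y j else 0)). Qed.

(** The ideal of a variety parametrised by polynomials is the kernel of a substitution into a
    domain. *)
Lemma prime_vanishing (n : nat) (U : n.-tuple S) (K : {mpoly k[n]} -> Prop) :
  (forall p, K p <-> forall y, p.@[fun i => (tnth U i).@[y]] = 0) -> prime_ideal K.
Proof.
move=> hK; have {}hK p : K p <-> p \mPo U = 0.
  rewrite hK; split=> [h|h y]; last by rewrite -comp_mpoly_meval h meval0.
  by apply: mpoly_vanish => y; rewrite comp_mpoly_meval.
split.
- by rewrite hK raddf0.
- by move=> p q; rewrite !hK comp_mpolyD => -> ->; rewrite addr0.
- by move=> p q; rewrite !hK => hq; rewrite rmorphM /= hq mulr0.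
- by rewrite hK rmorph1; apply/eqP/oner_neq0.
by move=> p q; rewrite !hK rmorphM => /eqP; rewrite mulf_eq0 => /orP[]/eqP; [left|right].
Qed.

Definition vanishing_on (keep : pred 'I_4) (p : S) := forall y, p.@[coord_subspace keep y] = 0.

Lemma prime_vanishing_on keep : prime_ideal (vanishing_on keep).
Proof.
apply: (@prime_vanishing 4
  [tuple \sum_j invmx L j i *: (if keep j then 'X_j else 0) | i < 4]) => p.
have e (y : pt) : p.@[coord_subspace keep y] =
    p.@[fun i => (tnth [tuple \sum_j invmx L j i *: (if keep j then 'X_j else 0) | i < 4] i).@[y]].
  apply: meval_eq => i; rewrite tnth_mktuple meval_sum; apply: eq_bigr => j _.
  by rewrite mevalZ; case: (keep j); rewrite ?mevalXU ?meval0.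
by split=> h y; have := h y; rewrite e.
Qed.

Lemma prime_pullback : prime_ideal (fun p => pb p = 0).
Proof.
split.
- exact: pullback0.
- by move=> p q; rewrite pullbackD => -> ->; rewrite addr0.
- by move=> p q; rewrite pullbackM => ->; rewrite mulr0.
- by rewrite pullback1; apply/eqP/oner_neq0.
by move=> p q; rewrite pullbackM => /eqP; rewrite mulf_eq0 => /orP[]/eqP; [left|right].
Qed.

Lemma quadric_neq0 : quad != 0.
Proof.
apply/eqP=> /(congr1 (meval (coord_subspace (fun j => hb j == lb j) (fun=> 1)))).
rewrite meval0 mevalB !mevalM !linform_coord_subspace !hb_ix !lb_ix /= mulr1 mulr0 subr0.
by move/eqP; rewrite oner_eq0.
Qed.

(* The chain of the cone, a plane in it, a line and the vertex. *)
Lemma krull_dim_quadric : krull_dim (vanishing_ideal X) 3.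
Proof.
split; last first.
  apply: (@prime_chain_bound k 4 quad); first exact: quadric_neq0.
  by move=> x [].
(* The plane is l00 = l01 = 0, the line keeps l11 alone, and for i = 3 nothing is kept. *)
pose keep i : pred 'I_4 := fun j => if i == 1%N then hb j else (i == 2) && (hb j && lb j).
exists (fun i => if i is 0%N then fun p => pb p = 0 else vanishing_on (keep i)); split.
- by move=> [|i] _; [apply: prime_pullback|apply: prime_vanishing_on].
- by move=> p /vanishing_pullback.
move=> [|[|[|//]]] _.
- split=> [p hp y|].
    (* With s = (0, 1) the Segre map parametrises the plane. *)
    pose z : pt := fun v => if hb v then (lb v)%:R else y (ix true (lb v)).
    have -> : coord_subspace (keep 1%N) y = segre z; last by rewrite -pullback_eval hp meval0.
    apply: (linform_inj LU) => j; rewrite linform_coord_subspace linform_segre // /z !hb_ix !lb_ix /keep /=.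
    by case e : (hb j); rewrite ?mul0r ?mul1r // -{1}(ixK j) e.
  exists (lf (ix false true)); split=> [y|].
    by rewrite linform_coord_subspace.
  move/(congr1 (meval (fun=> 1))); rewrite pullback_eval linform_segre // mulr1 meval0.
  by move/eqP; rewrite oner_eq0.
- split=> [p hp y|].
    pose y' : pt := fun j => if hb j && lb j then y j else 0.
    have -> : coord_subspace (keep 2%N) y = coord_subspace (keep 1%N) y'; last exact: hp.
    apply: (linform_inj LU) => j; rewrite !linform_coord_subspace /keep /y' /=.
    by case: (hb j).
  exists (lf (ix true false)); split=> [y|h].
    by rewrite linform_coord_subspace.
  have := h (fun=> 1); rewrite linform_coord_subspace => /eqP; apply/negP; exact: oner_neq0.
split=> [p hp y|].
  have -> : coord_subspace (keep 3%N) y = coord_subspace (keep 2%N) (fun=> 0); last exact: hp.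
  apply: (linform_inj LU) => j; rewrite !linform_coord_subspace /keep /=.
  by case: ifP.
exists (lf (ix true true)); split=> [y|h].
  by rewrite linform_coord_subspace /keep.
have := h (fun=> 1); rewrite linform_coord_subspace => /eqP; apply/negP; exact: oner_neq0.
Qed.

End QuadricDimension.

(** * The regular sequence and the linear resolution *)

Section Ulrich.
Variables (k : closedFieldType) (L : 'M[k]_4).
Hypothesis LU : L \in unitmx.
Local Notation S := {mpoly k[4]}.
Local Notation pt := ('I_4 -> k).
Local Notation lf := (linform L).
Local Notation quad := (quadric L).
Local Notation ell := (ell L).
Local Notation pb := (pullback L).
Local Notation segre := (segre L).
Local Notation X := (hypersurface quad).
Local Notation pair_poly := (pair_poly L).
Local Notation pair_eval := (pair_eval L).
Variables (r : nat) (side : 'I_r -> bool).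
Hypothesis r_pos : (0 < r)%N.
Local Notation E := (split_bundle LU side).
Local Notation T := ('I_4 * pt)%type.
Local Notation ev := (fun t : T => t.2).
Local Notation Gam := (@Gamma_star k 3 X E).
Implicit Types (c b : bool) (p q : S) (v W : S * S).

Definition pair_scale p v : S * S := (p * v.1, p * v.2).
Definition pair_add v W : S * S := (v.1 + W.1, v.2 + W.2).

Lemma pair_polyZ c p v : pair_poly c (pair_scale p v) = pb p * pair_poly c v.
Proof. by rewrite /pair_poly /pair_scale /= !pullbackM; ring. Qed.

Lemma pair_polyD c v W : pair_poly c (pair_add v W) = pair_poly c v + pair_poly c W.
Proof. by rewrite /pair_poly /pair_add /= !pullbackD; ring. Qed.

Lemma pair_poly_syzygy c w0 w1 :
  pair_poly c (ell c true false * w0 + ell c true true * w1,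
               - (ell c false false * w0) - ell c false true * w1) = 0.
Proof. exact: syzygy_factor. Qed.

Lemma pair_poly_eq c v W : pair_poly c v = pair_poly c W ->
  exists w0 w1, v.1 = W.1 + (ell c true false * w0 + ell c true true * w1) /\
    v.2 = W.2 + (- (ell c false false * w0) - ell c false true * w1).
Proof.
move=> h; have [|w0 [w1 [e1 e2]]] := @factor_syzygy k L LU c (v.1 - W.1) (v.2 - W.2).
  move/eqP: h; rewrite -subr_eq0 => /eqP <-; rewrite /pair_poly !pullbackD !pullbackN; ring.
by exists w0, w1; rewrite -e1 -e2 ![_ + (_ - _)]addrC !subrK.
Qed.

(** Write l_bb' for [ell c b b']. Up to syzygies the components read l11 v2 + l01 w1 = 0 and l11 (v1
    - w1) - l10 w0 = 0 modulo l00. The Koszul lemma solves both, and removing a syzygy from v leaves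
    a multiple of l00. *)
Lemma factor_regular2 c v W :
  pb (ell c true true) * pair_poly c v = pb (ell c false false) * pair_poly c W ->
  exists W', pair_poly c v = pb (ell c false false) * pair_poly c W'.
Proof.
rewrite -!pair_polyZ => /pair_poly_eq[w0 [w1 [/= e1 e2]]].
have [||||||t [a' [a'' [b' [b'' [E1 E2]]]]]] := @ell_koszul_mod k L LU c
  (true, true) (false, true) (false, false) (false, false) v.2 w1 (W.2 - w0) 0 => //=.
  by rewrite e2; ring.
have [||||||s [c' [c'' [d' [d'' [F1 F2]]]]]] := @ell_koszul_mod k L LU c
  (true, true) (true, false) (false, false) (false, false) (v.1 - w1) (- w0) W.1 0 => //=.
  by rewrite mulrBr e1; ring.
exists (b' + b'' + c' + c'', a' + a'' + s).
rewrite -pair_polyZ -[RHS]add0r -(pair_poly_syzygy c s (- t)) -pair_polyD; apply: (congr1 (pair_poly c)).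
rewrite [v]surjective_pairing -[v.1](subrK w1) F1 E2 /= E1 /pair_add /=; congr (_, _); ring.
Qed.

(** Both components are relations between l01 and l10 modulo l00 and l11, so by the Koszul lemma v
    is again a syzygy modulo these two forms. *)
Lemma factor_regular3 c v W W' :
  pb (ell c false true - ell c true false) * pair_poly c v =
    pb (ell c false false) * pair_poly c W + pb (ell c true true) * pair_poly c W' ->
  exists V V', pair_poly c v =
    pb (ell c false false) * pair_poly c V + pb (ell c true true) * pair_poly c V'.
Proof.
rewrite -!pair_polyZ -pair_polyD => /pair_poly_eq[w0 [w1 [/= e1 e2]]].
have [||||||s [a' [a'' [b' [b'' [E1 E2]]]]]] := @ell_koszul_mod k L LU c
  (false, true) (true, false) (false, false) (true, true) v.1 (- (v.1 + w0)) W.1 (W'.1 + w1) => //=.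
  transitivity ((ell c false true - ell c true false) * v.1 - ell c true false * w0); first ring.
  by rewrite e1; ring.
have [||||||t [c' [c'' [d' [d'' [F1 F2]]]]]] := @ell_koszul_mod k L LU c
  (true, false) (false, true) (false, false) (true, true) (- v.2) (v.2 + w1) (W.2 - w0) W'.2 => //=.
  transitivity ((ell c false true - ell c true false) * v.2 + ell c false true * w1); first ring.
  by rewrite e2; ring.
exists (a', s - c'), (a'' - t, - c'').
rewrite -!pair_polyZ -pair_polyD -[RHS]add0r -(pair_poly_syzygy c s t) -pair_polyD.
apply: (congr1 (pair_poly c)).
rewrite [v]surjective_pairing -[v.2]opprK F1 E1 /pair_add /=; congr (_, _); ring.
Qed.

Definition pairs (f : T -> 'cV[k]_r) (v : 'I_r -> S * S) :=
  forall t a, f t a 0 = pair_eval (side a) (v a) t.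

Lemma in_multiple_pairs (th : seq S) f (v : 'I_r -> S * S) : pairs f v ->
  (in_multiple ev Gam th f <-> forall a, exists W : 'I_(size th) -> S * S,
    pair_poly (side a) (v a) = \sum_(j < size th) pb (th`_j) * pair_poly (side a) (W j)).
Proof.
move=> hf; split.
  move=> [w [hw ew]] a.
  have [W hW] : exists W : 'I_(size th) -> S * S, forall j t, w j t a 0 = pair_eval (side a) (W j) t.
    suff H (j : 'I_(size th)) : exists V, forall t, w j t a 0 = pair_eval (side a) V t by exact: (fin_all_exists H).
    by have /Gamma_componentwise[V hV] := hw j; exists (V a) => t; rewrite hV.
  exists W; apply/(pair_relation LU) => t; rewrite -hf ew summxE.
  by apply: eq_bigr => j _; rewrite mxE hW.
move=> h; have [W hW] : exists W : 'I_r -> 'I_(size th) -> S * S, forall a,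
    pair_poly (side a) (v a) = \sum_(j < size th) pb (th`_j) * pair_poly (side a) (W a j) by exact: (fin_all_exists h).
exists (fun j t => \col_a pair_eval (side a) (W a j) t); split.
  by move=> j; apply: pair_sections.
move=> t; apply/colP=> a; rewrite summxE hf.
have /(pair_relation LU) -> := hW a.
by apply: eq_bigr => j _; rewrite !mxE.
Qed.

(** A system of parameters: on its common zeros the quadric is -l01^2, so only the vertex is left.
    Exchanging the two factors changes only the sign of the third form, so it serves both kinds of
    summands. *)
Definition parameters : seq S :=
  [:: ell true false false; ell true true true; ell true false true - ell true true false].

Lemma ell_diag c b : ell true b b = ell c b b.
Proof. by case: c. Qed.

Lemma pullback_ell_neq0 c b b' : pb (ell c b b') != 0.
Proof. by rewrite pullback_ell // mulf_neq0 // var_neq0. Qed.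

Lemma pairs_scale f (v : 'I_r -> S * S) p : pairs f v ->
  pairs (fun t => p.@[t.2] *: f t) (fun a => pair_scale p (v a)).
Proof. by move=> hf t a; rewrite mxE hf /pair_eval /= !mevalM; ring. Qed.

Lemma parameters_regular : regular_sequence ev Gam parameters.
Proof.
split.
  move=> i f hi /Gamma_componentwise[v hv] /(in_multiple_pairs _ (pairs_scale _ hv)) h.
  apply/(in_multiple_pairs _ hv) => a; have [W] := h a; rewrite pair_polyZ.
  case: i hi {h} W => [|[|[|//]]] _ /= W; set c := side a.
  - rewrite big_ord0 (ell_diag c) => /eqP; rewrite mulf_eq0 (negPf (pullback_ell_neq0 _ _ _)) => /eqP e.
    by exists W; rewrite big_ord0.
  - rewrite big_ord1 /= !(ell_diag c) => /factor_regular2[V eV].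
    by exists (fun=> V); rewrite big_ord1.
  rewrite !big_ord_recl big_ord0 addr0 /= !(ell_diag c) => e.
  have [V [V' eV]] : exists V V', pair_poly c (v a) =
      pb (ell c false false) * pair_poly c V + pb (ell c true true) * pair_poly c V'.
    case: (c) e => e; first exact: factor_regular3 e.
    (* For the other factor the sign of the third parameter is moved into the coefficients. *)
    apply: (@factor_regular3 false _ (pair_scale (-1) (W ord0)) (pair_scale (-1) (W (lift ord0 ord0)))).
    have -> : ell false false true - ell false true false =
        - (ell true false true - ell true true false) by rewrite opprB.
    rewrite !pair_polyZ !pullbackN pullback1 mulNr e; ring.
  exists (fun j => nth (0, 0) [:: V; V'] j).
  by rewrite !big_ord_recl big_ord0 addr0.
(* This is s_0 in every summand. At the vector [z] below, where s_0 of one factor is 1 and all else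
   is 0, every parameter pulls back to 0 but s_0 does not vanish. *)
pose v (a : 'I_r) : S * S := (1, 0).
exists (fun t => \col_a pair_eval (side a) (v a) t); split; first exact: pair_sections.
have hv : pairs (fun t => \col_a pair_eval (side a) (v a) t) v by move=> t a; rewrite mxE.
move/(in_multiple_pairs _ hv)/(_ (Ordinal r_pos)) => [W].
set c := side _; pose z : pt := fun i => (i == ix c false)%:R.
move/(congr1 (meval z)); rewrite meval_sum.
rewrite /pair_poly /= pullback1 pullback0 mulr0 addr0 mulr1 mevalXU /z eqxx.
rewrite big1 => [/eqP|j _]; first by rewrite oner_eq0.
rewrite mevalM; suff -> : (pb parameters`_j).@[z] = 0 by rewrite mul0r.
have zz b : z (ix (~~ c) b) = 0 by rewrite /z; case: (c); case: b.
have ez b b' : (ell true b b').@[segre z] = 0.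
  rewrite ell_segre //; case: (c) zz => zz /=; first by rewrite (zz b') mulr0.
  by rewrite (zz b) mul0r.
rewrite pullback_eval; case: j => [[|[|[|//]]] hj] /=; rewrite ?mevalB !ez ?subr0 //.
Qed.

Lemma annihilator_Gamma p : annihilator ev Gam p <-> vanishing_ideal X p.
Proof.
split=> [h x hx|h f hf [i x]].
  have [z gz ex] := segre_onto LU hx; have [i [hi o]] := good_chart LU gz.
  (* The coordinate that trivialises the chart i: this section has the value 1 there. *)
  pose v (a : 'I_r) : S * S := if bit (side a) i then (0, 1) else (1, 0).
  have := h _ (pair_sections LU side v) (i, x); move/colP/(_ (Ordinal r_pos)).
  rewrite !mxE ex; set c := side _.
  rewrite pair_eval_segre // /v /pair_poly -/c.
  have zi : z (ix c (bit c i)) != 0.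
    by move: hi; rewrite (linform_segre_bit LU c) mulf_eq0 negb_or => /andP[].
  by case: (bit c i) zi => zi /=; rewrite pullback1 pullback0 mulr0 mulr1 ?addr0 ?add0r mevalXU divff // mulr1 => ->.
move: hf => /Gamma_componentwise[v hv]; apply/colP=> a; rewrite !mxE hv /=.
case: (classic (on X (lf i) x)) => [[hx _]|no]; first by rewrite h // mul0r.
by rewrite pair_eval_off // mulr0.
Qed.

Lemma homog1_coef0 (p : S) : p \is 1.-homog -> p@_0%MM = 0.
Proof. by move=> hp; apply: (dhomog_nemf_coeff hp); rewrite /= mdeg0. Qed.

Lemma Gamma_cohen_macaulay : cohen_macaulay ev Gam.
Proof.
exists 3%N, parameters; split => //; last exact: parameters_regular.
  apply: krull_dim_ext (krull_dim_quadric LU) => p; by rewrite annihilator_Gamma.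
move=> p; rewrite !inE => /or3P[]/eqP->; rewrite ?mcoeffB !homog1_coef0 ?subr0 //; exact: ell_homog.
Qed.

Definition resolution_rank (i : nat) : nat := if i is i'.+2 then 0 else r + r.

Definition generator (j : 'I_(resolution_rank 0)) (t : T) : 'cV[k]_r :=
  match split (j : 'I_(r + r)) with
  | inl a => coord_section L (side a) false t *: delta_mx a 0
  | inr a => coord_section L (side a) true t *: delta_mx a 0
  end.

(** For each summand the syzygies (l10, -l00) and (l11, -l01), in blocks of size r because all s_0
    precede all s_1 among the generators. *)
Definition relation_mx : 'M[S]_(r + r) :=
  block_mx (diag_mx (\row_a ell (side a) true false)) (diag_mx (\row_a ell (side a) true true))
    (diag_mx (\row_a - ell (side a) false false)) (diag_mx (\row_a - ell (side a) false true)).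

Definition resolution_mx (i : nat) : 'M[S]_(resolution_rank i, resolution_rank i.+1) :=
  match i with 0 => relation_mx | _ => 0 end.

Lemma generator_sum (p : 'cV[S]_(r + r)) t :
  \sum_(j : 'I_(r + r)) (p j 0).@[t.2] *: generator j t =
  \col_a pair_eval (side a) (p (lshift r a) 0, p (rshift r a) 0) t.
Proof.
rewrite big_split_ord /=; apply/colP=> a; rewrite !mxE !summxE.
have El (i : 'I_r) : generator (lshift r i) t = coord_section L (side i) false t *: delta_mx i 0.
  by rewrite /generator (unsplitK (inl i)).
have Er (i : 'I_r) : generator (rshift r i) t = coord_section L (side i) true t *: delta_mx i 0.
  by rewrite /generator (unsplitK (inr i)).
rewrite (bigD1 a) //= big1 ?addr0 => [|i /negPf ni]; last first.
  by rewrite El !mxE eq_sym ni !mulr0.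
rewrite (bigD1 a) //= [X in _ + (_ + X)]big1 ?addr0 => [|i /negPf ni]; last first.
  by rewrite Er !mxE eq_sym ni !mulr0.
by rewrite El Er !mxE !eqxx !mulr1.
Qed.

Lemma relation_mx_mul (q : 'cV[S]_(r + r)) a :
  (relation_mx *m q) (lshift r a) 0 =
    ell (side a) true false * q (lshift r a) 0 + ell (side a) true true * q (rshift r a) 0 /\
  (relation_mx *m q) (rshift r a) 0 =
    - (ell (side a) false false * q (lshift r a) 0) - ell (side a) false true * q (rshift r a) 0.
Proof.
rewrite -[q]vsubmxK mul_block_col !col_mxEu !col_mxEd !mul_diag_mx !mxE.
by rewrite !mulNr.
Qed.

Lemma relation_mx_homog i j : relation_mx i j \is 1.-homog.
Proof.
rewrite /relation_mx -(splitK i) -(splitK j) /unsplit.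
by case: split => a; case: split => b;
  rewrite ?block_mxEul ?block_mxEur ?block_mxEdl ?block_mxEdr !mxE rpredMn ?rpredN ?ell_homog.
Qed.

Lemma has_linear_resolution_Gamma :
  has_linear_resolution ev (@twisted_sections k 3 X E) 1.
Proof.
exists resolution_rank, (fun i _ => i%:Z), generator, resolution_mx; split=> //; last first.
  by move=> [|[|i]].
split.
- split.
    move=> j; apply/(twisted_componentwise LU) => a; rewrite /generator.
    have H b (a' : 'I_r) : factor_section L (side a) 0 (fun t => (coord_section L (side a') b t *: delta_mx a' 0 : 'cV[k]_r) a 0).
      have [->|n] := eqVneq a a'.
        have -> : (fun t => (coord_section L (side a') b t *: delta_mx a' 0 : 'cV[k]_r) a' 0) =
            fun t => (1 : S).@[t.2] * coord_section L (side a') b t.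
          by apply: functional_extensionality => t; rewrite !mxE !eqxx mulr1 meval1 mul1r.
        by apply: (poly_factor_section LU _ _ (d := 0%N)); apply: dhomog1.
      split=> [i|i i' x _|i x _]; rewrite ?mxE ?(negPf n) /= ?mulr0 //.
      by apply: (@regular_zero _ _ _ 0%N) => x _; rewrite !mxE (negPf n) mulr0.
    by case: split => a'; apply: H.
  move=> [|i] j l; last by case: l.
  have -> : (1%:Z - 0%:Z) = 1%N%:Z by [].
  exact: relation_mx_homog.
- move=> [|i] j l; last by case: l.
  by apply: homog1_coef0; apply: relation_mx_homog.
- move=> f /Gamma_componentwise[v hv].
  exists (col_mx (\col_a (v a).1) (\col_a (v a).2)) => t; rewrite generator_sum.
  apply/colP=> a; rewrite hv mxE col_mxEu col_mxEd !mxE; by rewrite -surjective_pairing.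
- move=> p; split.
    move=> h; have H a : exists w : S * S,
        p (lshift r a) 0 = ell (side a) true false * w.1 + ell (side a) true true * w.2 /\
        p (rshift r a) 0 = - (ell (side a) false false * w.1) - ell (side a) false true * w.2.
      have e : pair_poly (side a) (p (lshift r a) 0, p (rshift r a) 0) = pair_poly (side a) (0, 0).
        have := pair_relation LU (side a) (p (lshift r a) 0, p (rshift r a) 0)
           (fun j : 'I_0 => 0) (fun=> (0, 0)).
        rewrite big_ord0 => -[H _].
        rewrite H /pair_poly ?pullback0 ?mulr0 ?addr0 // => t; rewrite big_ord0.
        by have := h t; rewrite generator_sum => /colP/(_ a); rewrite !mxE.
      have [w0 [w1 [e1 e2]]] := pair_poly_eq e; exists (w0, w1).
      by rewrite /= !add0r in e1 e2.
    have [w hw] := fin_all_exists H.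
    exists (col_mx (\col_a (w a).1) (\col_a (w a).2)); apply/colP=> j.
    rewrite -(splitK j) /unsplit; case: split => a; have [h1 h2] := hw a.
      by rewrite (relation_mx_mul _ a).1 h1 col_mxEu col_mxEd !mxE.
    by rewrite (relation_mx_mul _ a).2 h2 col_mxEu col_mxEd !mxE.
  move=> [q ->] t; rewrite generator_sum; apply/colP=> a; rewrite [LHS]mxE [RHS]mxE.
  have := pair_relation LU (side a) ((relation_mx *m q) (lshift r a) 0, (relation_mx *m q) (rshift r a) 0)
           (fun j : 'I_0 => 0) (fun=> (0, 0)).
  rewrite !big_ord0 => -[_ H]; rewrite H ?big_ord0 //.
  by rewrite (relation_mx_mul q a).1 (relation_mx_mul q a).2 pair_poly_syzygy.
move=> [|i] p; last first.
  split=> [_|_]; first by exists 0; apply/colP; case.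
  exact: mul0mx.
split=> [h|[q ->]]; last by rewrite mul0mx mulmx0.
exists 0; rewrite mulmx0; apply/colP=> j; rewrite mxE.
(* The adjugate of the 2 x 2 matrix of a summand turns the equations into quad * p = 0, so the
   relation matrix is injective and the resolution stops. *)
have H a : p (lshift r a) 0 = 0 /\ p (rshift r a) 0 = 0.
  have [e1 e2] := relation_mx_mul p a; rewrite h !mxE in e1 e2.
  have Q0 := quadric_neq0 LU; rewrite (quadricE L (side a)) in Q0.
  split; apply: (mulfI Q0); rewrite mulr0.
    transitivity (- (ell (side a) false true * 0 + ell (side a) true true * 0) : S); last by rewrite !mulr0 addr0 oppr0.
    by rewrite {1}e1 e2; ring.
  transitivity (ell (side a) false false * 0 + ell (side a) true false * 0 : S); last by rewrite !mulr0 addr0.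
  by rewrite {1}e1 e2; ring.
by rewrite -(splitK j) /unsplit; case: split => a; have [] := H a.
Qed.

Lemma split_bundle_ulrich : ulrich E.
Proof.
split=> //; first exact: Gamma_cohen_macaulay.
exists 2%N; split; first exact: krull_dim_quadric.
exact: has_linear_resolution_Gamma.
Qed.

End Ulrich.

(** * Equations of effective divisors *)

Section Units.
Variables (k : closedFieldType).
Local Notation S := {mpoly k[4]}.
Local Notation pt := ('I_4 -> k).
Implicit Types (p q P Q G A B : S) (z : pt).

Lemma msize_prime_mul P Q : prime_elt P -> Q != 0 -> (msize Q < msize (P * Q))%N.
Proof.
move=> hP Q0; have [P0 _ _] := hP; rewrite msizeM //.
have := prime_msize hP; case: (msize P) => [|[|n]] //= _.
by rewrite addSn ltnS leq_addl.
Qed.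

Lemma no_primes_const P : P != 0 -> (forall p, prime_elt p -> ~ divides p P) ->
  exists2 c, c != 0 & P = c%:MP.
Proof.
move=> P0 h; have [m [u [s [uu hs _ e]]]] := mpoly_ufd P0.
case: s hs e => [_|p s hs e].
  by rewrite big_nil mulr1 => ->; apply: mpoly_unit_const.
case: (h p); first by apply: hs; rewrite mem_head.
by rewrite e big_cons mulrCA; exists (u * \prod_(j <- s) j).
Qed.

Lemma prime_vanishes_somewhere P : prime_elt P -> ~ (forall z, good z -> P.@[z] != 0).
Proof.
move=> hP h; have [d] : divides P 1.
  by apply: prime_nonvanishing => // z gz _; apply: h.
move=> e; apply: (@prime_divides_unit _ P 1) => //; [exact: unitr1|by exists d].
Qed.

(** In lowest terms, a prime of the numerator or the denominator would divide some [A] or [B] that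
    is nonzero at the given vector. So it would vanish at no good vector, which no prime does. *)
Lemma unit_ratio_const P Q : P != 0 -> Q != 0 ->
  (forall z, good z -> exists A B, [/\ A.@[z] != 0, B.@[z] != 0 & P * A = Q * B]) ->
  exists2 c, c != 0 & P = c *: Q.
Proof.
move=> P0 Q0 h; have [P' [Q' [Q'0 e red]]] := reduced_fraction (@mpoly_ufd k 4) Q0 P.
have P'0 : P' != 0.
  by apply: contra_eq_neq e => ->; rewrite mul0r mulf_neq0.
have cross z : good z -> exists A B, [/\ A.@[z] != 0, B.@[z] != 0 & P' * A = Q' * B].
  move=> /h[A [B [A0 B0 eAB]]]; exists A, B; split=> //; apply: (mulIf Q0).
  by rewrite mulrAC -e mulrAC eAB; ring.
have [c c0 ec] : exists2 c, c != 0 & Q' = c%:MP.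
  apply: no_primes_const => // p hp pQ; apply: (prime_vanishes_somewhere hp) => z gz.
  have [A [B [A0 B0 eAB]]] := cross z gz.
  have : divides p (P' * A) by rewrite eAB; apply: divides_mulr.
  case: (hp) => _ _ hpp /hpp[/(red p hp pQ)//|[C eC]].
  by move: A0; rewrite eC mevalM mulf_eq0 negb_or => /andP[].
have [d d0 ed] : exists2 d, d != 0 & P' = d%:MP.
  apply: no_primes_const => // p hp pP; apply: (prime_vanishes_somewhere hp) => z gz.
  have [A [B [A0 B0 eAB]]] := cross z gz.
  have : divides p (Q' * B) by rewrite -eAB; apply: divides_mulr.
  case: (hp) => _ _ hpp /hpp[/(red p hp)//|[C eC]].
  by move: B0; rewrite eC mevalM mulf_eq0 negb_or => /andP[].
exists (d / c); first by rewrite mulf_neq0 ?invr_eq0.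
apply: (@mulIf _ (c%:MP_[4])); first by rewrite mpolyC_eq0.
by rewrite -ec e ed ec -scalerAl [Q * _]mulrC !mul_mpolyC scalerA divfK.
Qed.

Lemma homog_eval_scale n (h : {mpoly k[n]}) d (a : k) (x : 'I_n -> k) : h \is d.-homog ->
  h.@[fun i => a * x i] = a ^+ d * h.@[x].
Proof.
move=> hh; rewrite [h]mpolyE !meval_sum big_distrr big_seq [RHS]big_seq /=.
apply: eq_bigr => m hm; rewrite !mevalZ !mevalX mulrCA; congr (_ * _).
rewrite -(dhomog_mf hh hm : mdeg m = d) mdegE expr_sum -big_split /=.
by apply: eq_bigr => i _; rewrite exprMn.
Qed.

Definition scale_poly (a b : k) P : S :=
  locked (comp_mpoly [tuple (if hb i then a else b) *: 'X_i | i < 4]) P.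

Lemma scale_poly_eval a b P z : (scale_poly a b P).@[z] = P.@[scale a b z].
Proof.
rewrite /scale_poly -lock comp_mpoly_meval; apply: meval_eq => i.
by rewrite tnth_mktuple mevalZ mevalXU.
Qed.

Lemma horner_mmap (g : 'I_4 -> {poly k}) P (a : k) :
  (mmap (@polyC k) g P).[a] = P.@[fun i => (g i).[a]].
Proof.
elim/mpoly_ring_ind: P => [c|i|p q hp hq|p q hp hq].
- by rewrite mmapC hornerC mevalC.
- by rewrite mmapX mmap1U mevalXU.
- by rewrite mmapD hornerD mevalD hp hq.
by rewrite rmorphM hornerM mevalM /= hp hq.
Qed.

(** All roots are 0, so [p] is a multiple of a power of X, and the value at 1 fixes the factor. *)
Lemma nonvanishing_power (p : {poly k}) : (forall a, a != 0 -> p.[a] != 0) -> p.[1] = 1 ->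
  exists n, forall a, p.[a] = a ^+ n.
Proof.
move=> h h1; have p0 : p != 0 by apply: contraTneq (oner_neq0 k) => e; rewrite -h1 e horner0 eqxx.
have [r er] := closed_field_poly_normal p.
have hr a : a \in r -> a = 0.
  move=> ar; apply/eqP; apply: contraTT isT => /h/eqP[].
  rewrite er hornerZ horner_prod (big_rem a) //= hornerD hornerN hornerX hornerC subrr.
  by rewrite mul0r mulr0.
have e a : p.[a] = lead_coef p * a ^+ size r.
  rewrite {1}er hornerZ horner_prod; congr (_ * _).
  rewrite -[RHS]iter_mulr_1 -(big_const_seq 1 *%R r xpredT a) ?count_predT.
  rewrite big_seq [RHS]big_seq; apply: eq_bigr => b /hr ->.
  by rewrite hornerD hornerN hornerX hornerC subr0.
exists (size r) => a; rewrite e; have := e 1; rewrite h1 expr1n mulr1 => <-.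
by rewrite mul1r.
Qed.

(* Divide out, one after another, the primes of the numerators that vanish
   somewhere on their chart; such a prime divides every local equation. *)
Lemma common_equation (I : finType) (H P Q : I -> S) :
  (forall i, P i != 0) -> (forall i, Q i != 0) ->
  (forall i z, good z -> (H i).@[z] != 0 -> (Q i).@[z] != 0) ->
  (forall i j z, good z -> (H i).@[z] != 0 -> (H j).@[z] != 0 ->
     exists A B, B.@[z] != 0 /\ P i * Q j * B = A * P j * Q i) ->
  exists (G : S) (P' Q' : I -> S), [/\ G != 0, forall i, Q' i != 0,
    forall i z, good z -> (H i).@[z] != 0 -> (P' i).@[z] != 0,
    forall i z, good z -> (H i).@[z] != 0 -> (Q' i).@[z] != 0 &
    forall i, P i * Q' i = G * P' i * Q i].
Proof.
have [n] := ubnP (\sum_i msize (P i))%N; elim: n P Q => // n IH P Q.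
rewrite ltnS => hn P0 Q0 hQ hu.
case: (classic (forall i z, good z -> (H i).@[z] != 0 -> (P i).@[z] != 0)) => [hP|nP].
  by exists 1, P, Q; split=> // [|i]; rewrite ?oner_neq0 ?mul1r.
have [i [z [gz Hz Pz]]] : exists i z, [/\ good z, (H i).@[z] != 0 & (P i).@[z] = 0].
  apply: NNPP => no; apply: nP => i z gz Hz; apply/eqP=> Pz; apply: no; by exists i, z.
have [p [hp [C eC] pz]] : exists p, [/\ prime_elt p, divides p (P i) & p.@[z] = 0].
  apply: NNPP => no; have := P0 i; move/eqP: Pz; move: (P i) no => Pi no Pz Pi0.
  have [m [u [s [uu hs _ e]]]] := mpoly_ufd Pi0.
  have [c c0 eu] := mpoly_unit_const uu.
  move: Pz; rewrite e mevalM eu mevalC mulf_eq0 (negPf c0) /= rmorph_prod /=.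
  rewrite prodf_seq_eq0 => /hasP[q qs /= /eqP qz]; apply: no; exists q; split=> //; first exact: hs.
  by rewrite e (perm_big _ (perm_to_rem qs)) big_cons mulrCA; exists (u * \prod_(j <- rem q s) j).
have p0 : p != 0 by case: hp.
(* If [p] does not divide [P j], it has no zeros on the overlap of the charts i and j, hence divides
   the product of their equations. It vanishes at a point of the chart i, so it divides [H j] and is
   a unit on the chart j. *)
have unit_p j : ~ divides p (P j) -> divides p (H j).
  move=> npj; have : divides p (H i * H j).
    apply: prime_nonvanishing => // z' gz'; rewrite mevalM mulf_eq0 negb_or => /andP[Hi Hj].
    have [A [B [B0 e]]] := hu j i z' gz' Hj Hi.
    have : divides p (P j * Q i * B) by rewrite e eC; exists (A * C * Q j); ring.
    case: (hp) => _ _ hpp /hpp[/hpp[/npj//|[D eD]]|[D eD]].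
      by have := hQ i z' gz' Hi; rewrite eD mevalM mulf_eq0 negb_or => /andP[].
    by move: B0; rewrite eD mevalM mulf_eq0 negb_or => /andP[].
  case: (hp) => _ _ hpp /hpp[[D eD]|//].
  by move: Hz; rewrite eD mevalM pz mul0r eqxx.
(* The new numerator and denominator: either [p] is cancelled from [P j], or the denominator is
   multiplied by [p], a unit on that chart. The numerator on the chart i gets smaller. *)
have [R hR] : exists R : I -> S * S, forall j,
    [/\ P j * (R j).2 = p * (R j).1 * Q j, (R j).1 != 0, (R j).2 != 0,
        forall z', good z' -> (H j).@[z'] != 0 -> (R j).2.@[z'] != 0 &
        (msize (R j).1 <= msize (P j))%N /\ (j == i -> msize (R j).1 < msize (P j))%N].
  suff K j : exists w : S * S, [/\ P j * w.2 = p * w.1 * Q j, w.1 != 0, w.2 != 0,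
        forall z', good z' -> (H j).@[z'] != 0 -> w.2.@[z'] != 0 &
        (msize w.1 <= msize (P j))%N /\ (j == i -> msize w.1 < msize (P j))%N].
    exact: (fin_all_exists K).
  case: (classic (divides p (P j))) => [[D eD]|nd].
    have D0 : D != 0 by apply: contraNneq (P0 j) => e; rewrite eD e mulr0.
    exists (D, Q j); split=> //=; first by rewrite eD.
      exact: hQ.
    have := msize_prime_mul hp D0; rewrite -eD => lt.
    by split=> [|_]; [apply: ltnW lt|apply: lt].
  exists (P j, Q j * p); split=> //=; first ring.
    - by rewrite mulf_neq0.
    - move=> z' gz' Hj; rewrite mevalM mulf_neq0 //; first exact: hQ.
      have [D eD] := unit_p j nd; move: Hj; rewrite eD mevalM mulf_eq0 negb_or.
      by case/andP.
  split=> // /eqP e; case: nd; rewrite e eC; by exists C.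
have [||||| G [P' [Q' [G0 Q'0 hP' hQ' e]]]] := IH (fun j => (R j).1) (fun j => (R j).2).
- apply: leq_trans hn; rewrite (bigD1 i) //= [X in (_ < X)%N](bigD1 i) //= -addSn leq_add //.
    by case: (hR i) => _ _ _ _ [_]; apply.
  apply: leq_sum => j _; by case: (hR j) => _ _ _ _ [].
- by move=> j; case: (hR j).
- by move=> j; case: (hR j).
- by move=> j; case: (hR j).
- move=> j l z' gz' Hj Hl; have [A [B [B0 eAB]]] := hu j l z' gz' Hj Hl.
  exists A, B; split=> //; have [ej _ _ _ _] := hR j; have [el _ _ _ _] := hR l.
  apply: (@mulfI _ (p * Q j * Q l)); first by rewrite !mulf_neq0.
  transitivity ((p * (R j).1 * Q j) * Q l * (R l).2 * B); first ring.
  rewrite -ej; transitivity ((P j * Q l * B) * (R j).2 * (R l).2); first ring.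
  rewrite eAB; transitivity (A * Q j * (R j).2 * (P l * (R l).2)); first ring.
  by rewrite el; ring.
exists (p * G), P', Q'; split=> // [|j]; first by rewrite mulf_neq0.
have [ej _ r20 _ _] := hR j; apply: (mulIf r20).
transitivity ((P j * (R j).2) * Q' j); first ring.
rewrite ej; transitivity (p * Q j * ((R j).1 * Q' j)); first ring.
by rewrite e; ring.
Qed.

End Units.

(** * The global equation of an effective divisor *)

Section Divisor.
Variables (k : closedFieldType) (L : 'M[k]_4).
Hypothesis LU : L \in unitmx.
Local Notation S := {mpoly k[4]}.
Local Notation pt := ('I_4 -> k).
Local Notation lf := (linform L).
Local Notation quad := (quadric L).
Local Notation ell := (ell L).
Local Notation pb := (pullback L).
Local Notation segre := (segre L).
Local Notation X := (hypersurface quad).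
Implicit Types (p q P Q A B : S) (z : pt).

Lemma regular_fraction m (h : S) (f : pt -> k) : regular_on X m h f ->
  exists P N, forall z, good z -> (pb h).@[z] != 0 -> f (segre z) * (pb h).@[z] ^+ N = P.@[z].
Proof.
move=> hf; apply: (@local_fraction_global k (pb h) (fun z => f (segre z))) => z gz hz.
have hz' : h.@[segre z] != 0 by rewrite -pullback_eval.
have [d [e [p [q [_ _ _ q0 hpq]]]]] := hf (segre z) (conj (segre_on LU gz) hz').
exists (pb p), (pb q); rewrite pullback_eval; split=> // z' gz' Hz' qz'.
rewrite !pullback_eval; apply: hpq; last by rewrite -pullback_eval.
by split; [apply: segre_on|rewrite -pullback_eval].
Qed.

Variable D : eff_divisor X.
Local Notation I := 'I_(dncharts D).
Local Notation h := (@dchart k 3 X D).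
Local Notation H i := (pb (h i)).
Local Notation f i z := (@deqn k 3 X D i (segre z)).
Implicit Types i j : I.

Lemma on_pullback (g : S) z : good z -> (pb g).@[z] != 0 -> on X g (segre z).
Proof. by move=> gz; rewrite pullback_eval; split=> //; apply: segre_on. Qed.

Lemma nonzero_point (g : S) : g != 0 -> exists2 z, good z & g.@[z] != 0.
Proof.
move=> g0; apply: NNPP => no; case/eqP: g0; apply: good_vanish => z gz.
by apply/eqP; apply: contraT => gz0; case: no; exists z.
Qed.

Lemma local_equation i : exists P Q, [/\ P != 0, Q != 0,
  forall z, good z -> (H i).@[z] != 0 -> Q.@[z] != 0 &
  forall z, good z -> (H i).@[z] != 0 -> f i z * Q.@[z] = P.@[z]].
Proof.
have [H0|H0] := eqVneq (H i) 0.
  (* The chart is empty and imposes nothing. *)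
  exists 1, 1; rewrite H0; split; rewrite ?oner_neq0 // => z _; by rewrite meval0 eqxx.
have [P [N hP]] := regular_fraction (@d_regular k 3 X D i).
have mX z : (H i ^+ N).@[z] = (H i).@[z] ^+ N by rewrite rmorphXn.
exists P, (H i ^+ N); split.
- have [z gz Hz] := nonzero_point H0.
  have [||x [[hx hx'] fx]] := @d_nonzerodiv k 3 X D i 1 0; first exact: dhomog1.
    exists (segre z); rewrite mulr1; exact: on_pullback.
  apply: contraNneq fx => P0; have [z' gz' ex] := segre_onto LU hx.
  rewrite mulr1 ex -pullback_eval in hx'.
  have := hP z' gz' hx'; rewrite P0 meval0 ex => /eqP.
  by rewrite mulf_eq0 expf_eq0 (negPf hx') andbF orbF.
- exact: expf_neq0.
- by move=> z gz Hz; rewrite mX expf_neq0.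
by move=> z gz Hz; rewrite mX hP.
Qed.

Lemma local_unit i j z : good z -> (H i).@[z] != 0 -> (H j).@[z] != 0 ->
  exists A B, [/\ B.@[z] != 0, @dunit k 3 X D i j (segre z) = A.@[z] / B.@[z] &
    forall z', good z' -> (H i).@[z'] != 0 -> (H j).@[z'] != 0 -> B.@[z'] != 0 ->
      f i z' * B.@[z'] = A.@[z'] * f j z'].
Proof.
move=> gz Hi Hj; have on2 z' : good z' -> (H i).@[z'] != 0 -> (H j).@[z'] != 0 -> on X (h i * h j) (segre z').
  move=> gz' Hi' Hj'; apply: on_pullback => //; by rewrite pullbackM mevalM mulf_neq0.
have [d [e [p [q [_ _ _ q0 hpq]]]]] := @d_unit_regular k 3 X D i j _ (on2 z gz Hi Hj).
exists (pb p), (pb q); rewrite !pullback_eval; split=> //; first by apply: hpq => //; apply: on2.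
move=> z' gz' Hi' Hj'; rewrite !pullback_eval => qz'.
have o := on2 z' gz' Hi' Hj'.
by rewrite (@d_eqn k 3 X D i j _ o) (hpq _ o qz') mulrAC divfK.
Qed.

(** On the chart i the local equation is G U_i / H_i^(N_i), and V_i certifies that U_i is invertible
    there, as a divisor of a power of H_i. *)
Lemma divisor_equation : exists (G : S) (U V : I -> S) (N M : I -> nat),
  [/\ G != 0,
      forall i z, good z -> (H i).@[z] != 0 -> f i z * (H i).@[z] ^+ N i = G.@[z] * (U i).@[z],
      forall i, U i * V i = H i ^+ (N i + M i) &
      forall i, H i = 0 -> U i = 0 /\ V i = 0].
Proof.
have [P hP] : exists P : I -> S, forall i, exists Q, [/\ P i != 0, Q != 0,
    forall z, good z -> (H i).@[z] != 0 -> Q.@[z] != 0 &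
    forall z, good z -> (H i).@[z] != 0 -> f i z * Q.@[z] = (P i).@[z]].
  exact: (fin_all_exists local_equation).
have [Q hQ] := fin_all_exists hP.
have [|||i j z gz Hi Hj|G [P' [Q' [G0 Q'0 hP' hQ' e]]]] := @common_equation k I (fun i => H i) P Q.
- by move=> i; case: (hQ i).
- by move=> i; case: (hQ i).
- by move=> i; case: (hQ i).
- have [A [B [B0 _ hAB]]] := local_unit gz Hi Hj; exists A, B; split=> //.
  have [_ _ _ fi] := hQ i; have [_ _ _ fj] := hQ j.
  have nz (R : S) : R.@[z] != 0 -> R != 0 by apply: contraNneq => ->; rewrite meval0.
  apply/eqP; rewrite -subr_eq0; apply/eqP.
  apply: (@good_vanish_mul k _ (H i * H j * B)); first by rewrite !mulf_neq0 ?nz.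
  move=> z' gz'; rewrite !mevalM !mulf_eq0 !negb_or => /andP[/andP[Hi' Hj'] B'].
  rewrite mevalB !mevalM -(fi _ gz' Hi') -(fj _ gz' Hj').
  transitivity ((f i z' * B.@[z'] - A.@[z'] * f j z') * (Q i).@[z'] * (Q j).@[z']); first ring.
  by rewrite hAB // subrr !mul0r.
suff K i : exists w : (S * S) * (nat * nat), [/\
    forall z, good z -> (H i).@[z] != 0 -> f i z * (H i).@[z] ^+ w.2.1 = G.@[z] * w.1.1.@[z],
    w.1.1 * w.1.2 = H i ^+ (w.2.1 + w.2.2) & H i = 0 -> w.1.1 = 0 /\ w.1.2 = 0].
  have [w hw] := fin_all_exists K.
  exists G, (fun i => (w i).1.1), (fun i => (w i).1.2), (fun i => (w i).2.1), (fun i => (w i).2.2).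
  by split=> // i; case: (hw i).
have [H0|H0] := eqVneq (H i) 0.
  (* On an empty chart the exponents must be positive, since 0^0 is 1. *)
  exists ((0, 0), (1, 1)%N) => /=; split=> // [z _|]; first by rewrite H0 meval0 eqxx.
  by rewrite mul0r H0 expr0n.
have [_ Qi0 hQi fi] := hQ i.
have P'0 : P' i != 0.
  have [z gz Hz] := nonzero_point H0; apply: contraTneq (hP' i z gz Hz) => ->.
  by rewrite meval0 eqxx.
have power (R : S) : R != 0 -> (forall z, good z -> (H i).@[z] != 0 -> R.@[z] != 0) ->
    exists N, divides R (H i ^+ N).
  move=> R0 hR; have [n hn] := mpoly_ufd R0; apply: (divides_power hn) => p hp [C eC].
  apply: prime_nonvanishing => // z gz Hz; have := hR z gz Hz.
  by rewrite eC mevalM mulf_eq0 negb_or => /andP[].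
have [N [W eW]] := power _ (Q'0 i) (hQ' i).
have [M [V eV]] := power _ P'0 (hP' i).
(* The unit P' / Q' and its inverse are rewritten over powers of H, using Q' W = H^N and P' V =
   H^M. *)
exists ((P' i * W, V * Q' i), (N, M)) => /=; split.
- move=> z gz Hz; have mX : (H i).@[z] ^+ N = (Q' i).@[z] * W.@[z].
    by rewrite -mevalM -eW rmorphXn.
  apply: (mulIf (hQi z gz Hz)); rewrite mX.
  transitivity ((f i z * (Q i).@[z]) * (Q' i).@[z] * W.@[z]); first ring.
  have := congr1 (meval z) (e i); rewrite !mevalM (fi z gz Hz) => ->; ring.
- rewrite exprD eW eV; ring.
by move/eqP; rewrite (negPf H0).
Qed.

Lemma chart_degree : exists dd : I -> nat, forall i, h i \is (dd i).-homog.
Proof. exact: (fin_all_exists (proj1 (@d_cover k 3 X D))). Qed.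

(** * The bidegree of the equation and the first Chern class *)

Section Class.
Variables (G : S) (U V : I -> S) (N M dd : I -> nat).
Hypotheses (G0 : G != 0) (hdd : forall i, h i \is (dd i).-homog).
Hypothesis hU : forall i z, good z -> (H i).@[z] != 0 ->
  f i z * (H i).@[z] ^+ N i = G.@[z] * (U i).@[z].
Hypothesis hUV : forall i, U i * V i = H i ^+ (N i + M i).
Hypothesis hH0 : forall i, H i = 0 -> U i = 0 /\ V i = 0.

Lemma chart_scale i (a b : k) z : (H i).@[scale a b z] = (a * b) ^+ dd i * (H i).@[z].
Proof. by rewrite !pullback_eval segre_scale (homog_eval_scale _ _ (hdd i)). Qed.

Lemma equation_scale i (a b : k) z : a != 0 -> b != 0 -> good z -> (H i).@[z] != 0 ->
  f i (scale a b z) = f i z.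
Proof.
move=> a0 b0 gz Hz; have o := on_pullback gz Hz.
have [d [e [p [q [hp hq de q0 hpq]]]]] := @d_regular k 3 X D i _ o.
have gz' : good (scale a b z) by apply: good_scale.
have Hz' : (H i).@[scale a b z] != 0 by rewrite chart_scale mulf_neq0 ?expf_neq0 ?mulf_neq0.
have ed : d = e by move: de; rewrite addr0 => -[].
have o' := on_pullback gz' Hz'.
have qs : q.@[segre (scale a b z)] = (a * b) ^+ e * q.@[segre z].
  by rewrite segre_scale (homog_eval_scale _ _ hq).
have ps : p.@[segre (scale a b z)] = (a * b) ^+ e * p.@[segre z].
  by rewrite segre_scale (homog_eval_scale _ _ hp) ed.
rewrite (hpq _ o q0) (hpq _ o'); last by rewrite qs mulf_neq0 ?expf_neq0 ?mulf_neq0.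
by rewrite qs ps -mulf_div divff ?mul1r // expf_neq0 ?mulf_neq0.
Qed.

Lemma GU_scale i (a b : k) : a != 0 -> b != 0 ->
  scale_poly a b G * scale_poly a b (U i) = (a * b) ^+ (dd i * N i) *: (G * U i).
Proof.
move=> a0 b0; have [H0|H0] := eqVneq (H i) 0.
  by rewrite (hH0 H0).1 /scale_poly -lock comp_mpoly0 !mulr0 scaler0.
apply/eqP; rewrite -subr_eq0; apply/eqP; apply: (good_vanish_mul H0) => z gz Hz.
have Hz' : (H i).@[scale a b z] != 0 by rewrite chart_scale mulf_neq0 ?expf_neq0 ?mulf_neq0.
rewrite mevalB mevalZ !mevalM !scale_poly_eval -hU //; last exact: good_scale.
by rewrite -hU // equation_scale // chart_scale exprMn -exprM; ring.
Qed.

(** Scaling does not move the divisor: on each chart the scaled equation and [G] differ by a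
    quotient of units, so their ratio is constant. *)
Lemma G_scale (a b : k) : a != 0 -> b != 0 -> exists2 c, c != 0 & scale_poly a b G = c *: G.
Proof.
move=> a0 b0; apply: unit_ratio_const => //.
  have [z gz Gz] := nonzero_point G0.
  apply/eqP=> /(congr1 (meval (scale a^-1 b^-1 z))); rewrite scale_poly_eval meval0 => e.
  case/eqP: Gz; rewrite -[RHS]e; apply: meval_eq => v; rewrite /scale.
  by case: (hb v); rewrite mulrA divff ?mul1r.
move=> z gz; have [i Hi] : exists i, (H i).@[z] != 0.
  have [i hi] := proj2 (@d_cover k 3 X D) _ (segre_on LU gz); exists i; by rewrite pullback_eval.
have Uz z' : (H i).@[z'] != 0 -> (U i).@[z'] != 0.
  move=> Hz'; have := congr1 (meval z') (hUV i); rewrite mevalM rmorphXn /= => e.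
  have : (U i).@[z'] * (V i).@[z'] != 0 by rewrite e expf_neq0.
  by rewrite mulf_eq0 negb_or => /andP[].
exists (scale_poly a b (U i)), ((a * b) ^+ (dd i * N i) *: U i); split.
- by rewrite scale_poly_eval Uz // chart_scale mulf_neq0 ?expf_neq0 ?mulf_neq0.
- by rewrite mevalZ mulf_neq0 ?Uz ?expf_neq0 ?mulf_neq0.
by rewrite GU_scale // scalerAr.
Qed.

(** At a fixed vector with G nonzero, scaling one factor makes G a polynomial in the parameter
    without zeros except 0, hence a constant times a power; by [G_scale] the power does not depend
    on the vector. *)
Lemma G_exponent c : exists n : nat, forall (a : k) z, a != 0 ->
  G.@[scale (if c then a else 1) (if c then 1 else a) z] = a ^+ n * G.@[z].
Proof.
have [z0 gz0 Gz0] := nonzero_point G0.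
pose g v : {poly k} := if hb v == c then z0 v *: 'X else (z0 v)%:P.
pose p := (G.@[z0])^-1 *: mmap (@polyC k) g G.
have ep a : p.[a] = (G.@[z0])^-1 * G.@[scale (if c then a else 1) (if c then 1 else a) z0].
  rewrite /p hornerZ horner_mmap; congr (_ * _); apply: meval_eq => v; rewrite /g /scale.
  by case: (hb v); case: (c) => /=; rewrite ?hornerZ ?hornerX ?hornerC ?mul1r // mulrC.
have Gs a : a != 0 -> exists2 e, e != 0 & forall z,
    G.@[scale (if c then a else 1) (if c then 1 else a) z] = e * G.@[z].
  move=> a0; have [||e e0 he] := @G_scale (if c then a else 1) (if c then 1 else a).
  - by case: (c); rewrite ?oner_neq0.
  - by case: (c); rewrite ?oner_neq0.
  by exists e => // z; rewrite -scale_poly_eval he mevalZ.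
have [a a0||n hn] := @nonvanishing_power k p.
- by have [e e0 he] := Gs a a0; rewrite ep he mulrCA mulVf ?mulr1.
- rewrite ep; have -> : G.@[scale (if c then 1 else 1) (if c then 1 else 1) z0] = G.@[z0].
    by apply: meval_eq => v; rewrite /scale; case: (c); case: (hb v); rewrite mul1r.
  by rewrite mulVf.
exists n => a z a0; have [e e0 he] := Gs a a0; rewrite he; congr (_ * _).
by rewrite -hn ep he mulrCA mulVf ?mulr1.
Qed.

Variables (al be : nat).
Hypothesis G_bihom : forall (a b : k) z, a != 0 -> b != 0 ->
  G.@[scale a b z] = a ^+ al * b ^+ be * G.@[z].

Lemma U_scale i (a b : k) z : a != 0 -> b != 0 ->
  a ^+ al * b ^+ be * (U i).@[scale a b z] = (a * b) ^+ (dd i * N i) * (U i).@[z].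
Proof.
move=> a0 b0; rewrite -scale_poly_eval -!mevalZ; congr (meval _ _).
apply: (mulfI G0); rewrite -scalerAr scalerAl -[RHS]scalerAr -GU_scale //.
congr (_ * _); apply/eqP; rewrite -subr_eq0; apply/eqP/mpoly_vanish => z'.
by rewrite mevalB mevalZ scale_poly_eval G_bihom // subrr.
Qed.

Lemma V_scale i (a b : k) z : a != 0 -> b != 0 ->
  (V i).@[scale a b z] = a ^+ al * b ^+ be * (a * b) ^+ (dd i * M i) * (V i).@[z].
Proof.
move=> a0 b0; have [H0|H0] := eqVneq (H i) 0.
  by rewrite (hH0 H0).2 !meval0 mulr0.
have U0 : U i != 0.
  apply: contraNneq H0 => U0; have /eqP := hUV i.
  by rewrite U0 mul0r eq_sym expf_eq0 => /andP[].
rewrite -scale_poly_eval -mevalZ; congr (meval _ _).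
apply: (mulfI U0); apply/eqP; rewrite -subr_eq0; apply/eqP/mpoly_vanish => z'.
rewrite mevalB !mevalM mevalZ scale_poly_eval; apply/eqP; rewrite subr_eq0; apply/eqP.
apply: (@mulfI _ ((a * b) ^+ (dd i * N i))); first by rewrite expf_neq0 ?mulf_neq0.
rewrite mulrA -U_scale //.
have E z1 : (U i).@[z1] * (V i).@[z1] = (H i).@[z1] ^+ (N i + M i).
  by rewrite -mevalM hUV rmorphXn.
transitivity (a ^+ al * b ^+ be * ((U i).@[scale a b z'] * (V i).@[scale a b z'])); first ring.
rewrite E chart_scale exprMn -E -exprM mulnDr exprD; ring.
Qed.

(** [U i] has bidegree (e - al, e - be) with e = dd i * N i; the two powers restore the balance. *)
Lemma descend_U i (j : 'I_4) : exists2 p, p \is (dd i * N i).-homog &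
  pb p = U i * 'X_(ix true (hb j)) ^+ al * 'X_(ix false (lb j)) ^+ be.
Proof.
apply: descends_homog => // m hm.
have := @bihomogeneous_weight k 0 0 (dd i * N i) (dd i * N i) _ _ _ hm; rewrite !add0n; apply.
move=> a b z a0 b0 _; rewrite !expr0 !mul1r !mevalM !rmorphXn /= !mevalXU /scale !hb_ix !exprMn.
rewrite -/(scale a b z); transitivity ((a ^+ al * b ^+ be * (U i).@[scale a b z]) *
  z (ix true (hb j)) ^+ al * z (ix false (lb j)) ^+ be); first ring.
by rewrite U_scale // exprMn; ring.
Qed.

(** [V i] has bidegree (e + al, e + be) with e = dd i * M i; the exchanged exponents bring both
    degrees to e + al + be. *)
Lemma descend_V i (j : 'I_4) : exists2 p, p \is (dd i * M i + (al + be)).-homog &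
  pb p = V i * 'X_(ix true (hb j)) ^+ be * 'X_(ix false (lb j)) ^+ al.
Proof.
apply: descends_homog => // m hm.
have := @bihomogeneous_weight k 0 0 (dd i * M i + (al + be)) (dd i * M i + (al + be)) _ _ _ hm.
rewrite !add0n; apply.
move=> a b z a0 b0 _; rewrite !expr0 !mul1r !mevalM !rmorphXn /= !mevalXU V_scale //.
by rewrite /scale !hb_ix !exprMn !exprD; ring.
Qed.

(** At a zero of the divisor the values of the local equations do not determine [dunit]; the
    identity is therefore proved for polynomials, where G cancels. *)
Lemma unit_ratio i j z : good z -> (H i).@[z] != 0 -> (H j).@[z] != 0 ->
  (U i).@[z] / (H i).@[z] ^+ N i =
  @dunit k 3 X D i j (segre z) * ((U j).@[z] / (H j).@[z] ^+ N j).
Proof.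
move=> gz Hi Hj; have [A [B [B0 -> hAB]]] := local_unit gz Hi Hj.
have nz (R : S) : R.@[z] != 0 -> R != 0 by apply: contraNneq => ->; rewrite meval0.
have e : U i * H j ^+ N j * B = A * U j * H i ^+ N i.
  apply: (mulfI G0); apply/eqP; rewrite -subr_eq0; apply/eqP.
  apply: (@good_vanish_mul k _ (H i * H j * B)); first by rewrite !mulf_neq0 ?nz.
  move=> z' gz'; rewrite !mevalM !mulf_eq0 !negb_or => /andP[/andP[Hi' Hj'] B'].
  rewrite mevalB !mevalM !rmorphXn /=.
  transitivity ((G.@[z'] * (U i).@[z']) * (H j).@[z'] ^+ N j * B.@[z']
    - A.@[z'] * (G.@[z'] * (U j).@[z']) * (H i).@[z'] ^+ N i); first ring.
  rewrite -!hU //.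
  transitivity ((f i z' * B.@[z'] - A.@[z'] * f j z') * (H i).@[z'] ^+ N i * (H j).@[z'] ^+ N j).
    ring.
  by rewrite hAB // subrr !mul0r.
have := congr1 (meval z) e; rewrite !mevalM !rmorphXn /= => E.
have Hi' : (H i).@[z] ^+ N i != 0 by rewrite expf_neq0.
have Hj' : (H j).@[z] ^+ N j != 0 by rewrite expf_neq0.
by rewrite mulf_div; apply/eqP; rewrite eqr_div ?mulf_neq0 //; apply/eqP; rewrite -E; ring.
Qed.

(** With al = be = 0, G would be a nonzero constant, yet it vanishes wherever a local equation does.
    This makes the rank positive. *)
Lemma exponent_pos : nonzero_divisor D -> (0 < al + be)%N.
Proof.
move=> [i [x [[hx hi] fx]]]; rewrite lt0n addn_eq0; apply/negP=> /andP[/eqP al0 /eqP be0].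
have [z gz ex] := segre_onto LU hx.
have Hz : (H i).@[z] != 0 by rewrite pullback_eval -ex.
have Gz : G.@[z] = 0.
  have := hU gz Hz; rewrite -ex fx mul0r => /esym/eqP; rewrite mulf_eq0 => /orP[/eqP//|/eqP Uz].
  have := congr1 (meval z) (hUV i); rewrite mevalM Uz mul0r rmorphXn /= => /esym/eqP.
  by rewrite expf_eq0 (negPf Hz) andbF.
have hw m : m \in msupp G -> m = 0%MM.
  move=> hm; have := @bihomogeneous_weight k 0 0 0 0 _ _ _ hm; rewrite !add0n => -[|h1 h2].
    by move=> a b z' a0 b0 _; rewrite !expr0 !mul1r G_bihom // al0 be0 !expr0 !mul1r.
  apply/mnmP=> v; rewrite mnm0E -(ixK v); move: h1 h2 => /eqP; rewrite addn_eq0 => /andP[/eqP e1 /eqP e2].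
  move/eqP; rewrite addn_eq0 => /andP[/eqP e3 /eqP e4].
  by case: (hb v); case: (lb v).
have eG : G = (G@_0%MM)%:MP.
  apply/mpolyP=> m; rewrite mcoeffC; have [->|nm] := eqVneq m 0%MM; first by rewrite mulr1.
  rewrite mulr0; apply: memN_msupp_eq0; by apply: contra nm => /hw ->.
by move/eqP: Gz G0; rewrite eG mevalC => /eqP ->; rewrite mpolyC0 eqxx.
Qed.

Definition side_of (a : 'I_(al + be)) : bool := (a < al)%N.

Lemma det_split_trans (i j : 'I_4) x : \det (split_trans L side_of i j x) =
  factor_trans L true i j x ^+ al * factor_trans L false i j x ^+ be.
Proof.
rewrite /split_trans det_diag (eq_bigr (fun a => factor_trans L (side_of a) i j x)); last first.
  by move=> a _; rewrite mxE.
rewrite big_split_ord /=; congr (_ * _).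
  rewrite (eq_bigr (fun=> factor_trans L true i j x)) ?prodr_const ?card_ord // => a _.
  by rewrite /side_of /= ltn_ord.
rewrite (eq_bigr (fun=> factor_trans L false i j x)) ?prodr_const ?card_ord // => a _.
by rewrite /side_of /= ltnNge leq_addr.
Qed.

Lemma split_bundle_represents : represents_c1 D (split_bundle LU side_of).
Proof.
have [p hp] : exists p : I -> 'I_4 -> S, forall i (j : 'I_4), p i j \is (dd i * N i).-homog /\
  pb (p i j) = U i * 'X_(ix true (hb j)) ^+ al * 'X_(ix false (lb j)) ^+ be.
  suff K i : exists w : 'I_4 -> S, forall j : 'I_4, w j \is (dd i * N i).-homog /\
     pb (w j) = U i * 'X_(ix true (hb j)) ^+ al * 'X_(ix false (lb j)) ^+ be.
    exact: (fin_all_exists K).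
  suff K (j : 'I_4) : exists w : S, w \is (dd i * N i).-homog /\
     pb w = U i * 'X_(ix true (hb j)) ^+ al * 'X_(ix false (lb j)) ^+ be.
    exact: (fin_all_exists K).
  by have [w h1 h2] := descend_U i j; exists w.
have [q hq] : exists q : I -> 'I_4 -> S, forall i (j : 'I_4), q i j \is (dd i * M i + (al + be)).-homog /\
  pb (q i j) = V i * 'X_(ix true (hb j)) ^+ be * 'X_(ix false (lb j)) ^+ al.
  suff K i : exists w : 'I_4 -> S, forall j : 'I_4, w j \is (dd i * M i + (al + be)).-homog /\
     pb (w j) = V i * 'X_(ix true (hb j)) ^+ be * 'X_(ix false (lb j)) ^+ al.
    exact: (fin_all_exists K).
  suff K (j : 'I_4) : exists w : S, w \is (dd i * M i + (al + be)).-homog /\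
     pb w = V i * 'X_(ix true (hb j)) ^+ be * 'X_(ix false (lb j)) ^+ al.
    exact: (fin_all_exists K).
  by have [w h1 h2] := descend_V i j; exists w.
(* [phi] is U_l / H_l^(N_l) times s_i^al u_i^be, of bidegree 0. Its inverse [psi] replaces the
   negative powers of s_i and u_i by s_i^be u_i^al over a power of l_i = s_i u_i. *)
pose phi (l : I) (i : 'I_4) (x : pt) : 'M[k]_1 := ((p l i).@[x] / (h l ^+ N l).@[x])%:M.
pose psi (i : 'I_4) (l : I) (x : pt) : 'M[k]_1 :=
  ((q l i).@[x] / (h l ^+ M l * lf i ^+ (al + be)).@[x])%:M.
have mX (g : S) n x : (g ^+ n).@[x] = g.@[x] ^+ n by rewrite rmorphXn.
have phiE l (i : 'I_4) z : (H l).@[z] != 0 -> (p l i).@[segre z] / (h l ^+ N l).@[segre z] =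
    (U l).@[z] / (H l).@[z] ^+ N l * (z (ix true (hb i)) ^+ al * z (ix false (lb i)) ^+ be).
  move=> Hz; rewrite -pullback_eval (hp l i).2 !mevalM !mX !mevalXU pullback_eval; ring.
exists phi, psi; split.
- move=> l i a b; rewrite (ord1 a) (ord1 b).
  apply: (@regular_quotient _ _ _ _ _ (p l i) (h l ^+ N l) _ (dd l * N l) (dd l * N l)).
  + by case: (hp l i).
  + exact: dhomogMn.
  + by rewrite addr0.
  + by move=> x /on_mul[[_ hx] _]; rewrite mX expf_neq0.
  by move=> x _; rewrite /phi mxE eqxx mulr1n.
- move=> i l a b; rewrite (ord1 a) (ord1 b).
  apply: (@regular_quotient _ _ _ _ _ (q l i) (h l ^+ M l * lf i ^+ (al + be)) _
     (dd l * M l + (al + be)) (dd l * M l + (al + be))).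
  + by case: (hq l i).
  + apply: dhomogM; first exact: dhomogMn.
    by rewrite -[X in X.-homog]mul1n; apply: dhomogMn; apply: linform_homog.
  + by rewrite addr0.
  + by move=> x /on_mul[[_ hx] [_ hx']]; rewrite mevalM !mX mulf_neq0 ?expf_neq0.
  by move=> x _; rewrite /psi mxE eqxx mulr1n.
- move=> l i x /on_mul[[hx hl] [_ hi]]; have [z gz ex] := segre_onto LU hx.
  have Hz : (H l).@[z] != 0 by rewrite pullback_eval -ex.
  suff e : (p l i).@[x] / (h l ^+ N l).@[x] * ((q l i).@[x] / (h l ^+ M l * lf i ^+ (al + be)).@[x]) = 1.
    by rewrite /phi /psi -!scalar_mxM e mulrC e.
  have hi' : (lf i).@[segre z] != 0 by rewrite -ex.
  have eq : (q l i).@[segre z] = (V l).@[z] * z (ix true (hb i)) ^+ be * z (ix false (lb i)) ^+ al.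
    by rewrite -pullback_eval (hq l i).2 !mevalM !mX !mevalXU.
  rewrite ex (phiE l i z Hz) eq mevalM !mX -pullback_eval linform_segre //.
  move: hi'; rewrite linform_segre // mulf_eq0 negb_or => /andP[z1 z2].
  rewrite exprMn.
  have E : (U l).@[z] * (V l).@[z] = (H l).@[z] ^+ N l * (H l).@[z] ^+ M l.
    by rewrite -mevalM hUV rmorphXn exprD.
  have Hn : (H l).@[z] ^+ N l != 0 by rewrite expf_neq0.
  have Hm : (H l).@[z] ^+ M l != 0 by rewrite expf_neq0.
  rewrite !exprD; have zn n : z (ix true (hb i)) ^+ n != 0 by rewrite expf_neq0.
  have zn' n : z (ix false (lb i)) ^+ n != 0 by rewrite expf_neq0.
  transitivity ((U l).@[z] * (V l).@[z] / ((H l).@[z] ^+ N l * (H l).@[z] ^+ M l)).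
    by field; rewrite Hn Hm !zn !zn'.
  by rewrite E divff // mulf_neq0.
(* The determinant of the transition turns s_i^al u_i^be into s_j^al u_j^be, and [unit_ratio]
   accounts for the change from l to m. *)
move=> i j l m x /= /on_mul[/on_mul[o1 o2] /on_mul[o3 o4]].
have [z [gz ex zi hi]] := on_chart_segre LU o1.
have Hl : (H l).@[z] != 0 by rewrite pullback_eval -ex; case: o3.
have Hm : (H m).@[z] != 0 by rewrite pullback_eval -ex; case: o4.
rewrite /= -!scalar_mxM; congr (_%:M).
rewrite det_split_trans ex in hi *; rewrite !factor_trans_segre //.
rewrite !phiE // (unit_ratio gz Hl Hm) /bit /=.
have z1 := zi true; have z2 := zi false; rewrite /bit /= in z1 z2.
have z1n : z (ix true (hb i)) ^+ al != 0 by rewrite expf_neq0.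
have z2n : z (ix false (lb i)) ^+ be != 0 by rewrite expf_neq0.
have Hmn : (H m).@[z] ^+ N m != 0 by rewrite expf_neq0.
by rewrite !expr_div_n; field; rewrite z1n z2n Hmn.
Qed.

End Class.
End Divisor.

Theorem proposition2p15 (k : closedFieldType) (hk : [pchar k] =i pred0)
    (F : {mpoly k[4]}) (hF : F \is 2.-homog) (hsm : smooth_hypersurface F)
    (D : eff_divisor (hypersurface F)) (hD : nonzero_divisor D) :
  exists E : vector_bundle (hypersurface F), ulrich E /\ represents_c1 D E.
Proof.
have [L [LU eF]] := quadric_normal_form hF hsm.
have {eF} eF : F = quadric L := eF; subst F.
have [G [U [V [N [M [G0 hU hUV hH0]]]]]] := divisor_equation LU D.
have [dd hdd] := chart_degree D.
have [al hal] := G_exponent LU G0 hdd hU hUV hH0 true.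
have [be hbe] := G_exponent LU G0 hdd hU hUV hH0 false.
have hG (a b : k) z : a != 0 -> b != 0 -> G.@[scale a b z] = a ^+ al * b ^+ be * G.@[z].
  move=> a0 b0; rewrite -mulrA -hbe // -hal //; apply: meval_eq => v; rewrite /scale.
  by case: (hb v); rewrite mul1r.
exists (split_bundle LU (@side_of al be)); split.
  by apply: split_bundle_ulrich; apply: (exponent_pos LU G0 hU hUV hG hD).
exact: (split_bundle_represents LU G0 hdd hU hUV hH0 hG).
Qed.
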